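(* Let $k\in\mathbb N$ and let $f\in\mathcal W_s(g_k)$ (see context). Then: (F1) For any $x=f^l(0)$, $l\in\mathbb N$, and any $p>2$, $$\lim_{n\to\infty}\frac{\Lambda_p(x,n)}{\{\Lambda_2(x,n)\}^{p/2}}=0 .$$ Let $(\xi_n)$ be a sequence of independent real random variables on $(\Omega,\mathcal F,\mathbb P)$ which have $p>2$ finite moments and satisfy A3($p$) (see context). (F2) Let $$w_n(x,\sigma)=\frac{x_n(x,\sigma)-f^n(x)}{\sigma\sqrt{\sum_{j=1}^n\big((f^{n-j})'\circ f^j(x)\big)^2\,\mathbb E[\xi_j^2]}} .$$ There is a constant $\gamma>0$ such that if $\sigma_n>0$ and $\lim_n\sigma_n n^{\gamma+1}=0$, then for each $x=f^l(0)$, $l\in\mathbb N$, there are events $\{B_n(x)\}_n\subset\mathcal F$ with $\lim_n\mathbb P[B_n(x)]=1$ such that $w_n(x,\sigma_n)\mathbf 1_{B_n(x)}$, and hence $w_n(x,\sigma_n)$, converge in distribution to the standard Gaussian. (F3) Furthermore, there are constants $\alpha>0$ and $\theta>0$ depending on $p$ such that if $0<\sigma_n\le n^{-\theta}$ then, for each $x=f^l(0)$, $l\in\mathbb N$, with such events $B_n(x)$ ($\lim_n\mathbb P[B_n(x)]=1$), $$\sup_{z\in\mathbb R}\big|\mathbb P[w_n(x,\sigma_n)\mathbf 1_{B_n(x)}\le z]-\Phi(z)\big|\le C_x\,n^{-\alpha}$$ for a constant $C_x$.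
   Context: Period doubling. $I=[-1,1]$. $\mathcal P$ is the set of analytic even maps $f:I\to I$ such that (P1) $f(0)=1$; (P2) $xf'(x)<0$ for $x\ne0$; (P3) $Sf(x)<0$ for $x\neq0$, where $Sf=\frac{f'''}{f'}-\frac32\big(\frac{f''}{f'}\big)^2$; and, with $\lambda_f=f(1)$, $b_f=f(\lambda_f)$, (P4) $0<|\lambda_f|<b_f$; (P5) $0<f(b_f)<|\lambda_f|$ (so $\lambda_f<0$). The period doubling operator is $Tf(x)=\lambda_f^{-1}f(f(\lambda_f x))$ on $\mathcal P$. For each $k\in\mathbb N$ there is a known fixed point $g_k\in\mathcal P$, $Tg_k=g_k$, of the form $g_k(x)=\phi_k(x^{2k})$ with $\phi_k$ analytic (order-$2k$ critical point), analytic on a bounded open domain $D_k\subset\mathbb C$ with $D_k\supset[-1,1]$, $\partial D_k$ smooth, $\overline{\lambda_kD_k}\subset D_k$, $\overline{g_k(\lambda_kD_k)}\subset D_k$, where $\lambda_k=g_k(1)$. Let $\mathcal G_k$ be the Banach space (sup norm) of functions $z^{2k}\hat f(z)$ with $\hat f$ analytic on $D_k$ and continuous on $\overline{D_k}$. $\mathcal W_s(g_k)$ denotes the invariant stable manifold of $T$ at $g_k$ in $(1+\mathcal G_k)\cap\mathcal P$; for $f\in\mathcal W_s(g_k)$ all $T^nf$ are defined and $\|T^nf-g_k\|_{C(\overline{D_k})}=O(\omega_k^n)$ with a universal $0<\omega_k<1$. Such $f$ satisfies $f^{(j)}(0)=0$ for $1\le j\le 2k-1$ and $f^{(2k)}(0)\ne0$.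 Noise. A3($p$): $\mathbb E[\xi_n]=0$ for all $n$, and there are constants $c,C>0$ with $c\le\|\xi_n\|_2\le\|\xi_n\|_p\le C$, $\|\xi\|_s=(\mathbb E|\xi|^s)^{1/s}$. Standing assumption: for some $a>0$, $f\in C^2([-1-a,1+a])$ and $f([-1-a,1+a])\subset I$. For $x\in I$, $\sigma>0$: $x_0=x$, $x_m=f(x_{m-1})+\sigma\xi_m$, and $x_n(x,\sigma)$ is the value at time $n$; it is defined on the event $\{\sigma\max_{1\le j\le n}|\xi_j|\le a\}$, on which one conditions. $\Lambda_s(x,n)=\sum_{j=1}^n|(f^{n-j})'\circ f^j(x)|^s$ for $s\ge0$ ($f^0=\mathrm{id}$); $\Phi(z)=\frac1{\sqrt{2\pi}}\int_{-\infty}^ze^{-t^2/2}dt$. *)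

(* Defs.v *)
From mathcomp Require Import all_boot all_order all_algebra.
From mathcomp Require Import all_classical all_reals all_analysis.
From mathcomp Require Export complex.

Set Implicit Arguments.
Unset Strict Implicit.
Unset Printing Implicit Defensive.

Import Order.TTheory GRing.Theory Num.Theory.
Import numFieldNormedType.Exports.

Local Open Scope classical_set_scope.
Local Open Scope ring_scope.

(** R[i], packed as a numFieldType so that it carries the norm topology. *)
Definition Cplx (R : realType) : numFieldType := R[i].

Definition toC (R : realType) (x : R) : Cplx R := (x%:C)%C.

(** Each point of A has a power series expansion representing h on the part of
    A near that point; used both for real functions on an interval and for
    complex functions on an open set. *)
Definition analytic_on (K : numFieldType) (A : set K) (h : K -> K) : Prop :=
  forall x0, A x0 -> exists (c : nat -> K) (r : K), 0 < r /\
    forall x, A x -> `|x - x0| < r ->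
      series (fun n => c n * (x - x0) ^+ n) @ \oo --> h x.


(** One-sided at the endpoints of an interval, so that they depend only on the
    restriction of f to A; at interior points they are the usual derivatives. *)
Section derivatives_within.
Variables (R : realType) (A : set R).

Definition slope_at (f : R -> R) (x : R) : R -> R :=
  fun y => (f y - f x) / (y - x).

Definition derivable_in (f : R -> R) (x : R) : Prop :=
  cvg (slope_at f x y @[y --> within A x^']).

Definition deriv_in (f : R -> R) (x : R) : R :=
  lim (slope_at f x y @[y --> within A x^']).

Definition C2_on (f : R -> R) : Prop :=
  [/\ forall x, A x -> derivable_in f x,
      forall x, A x -> derivable_in (deriv_in f) x
    & {within A, continuous (deriv_in (deriv_in f))} ].

Definition schwarzian (f : R -> R) (x : R) : R :=
  deriv_in (deriv_in (deriv_in f)) x / deriv_in f x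
  - 3 / 2 * (deriv_in (deriv_in f) x / deriv_in f x) ^+ 2.

End derivatives_within.


(** Maps I -> I are coded as total functions on R; all notions up to [Lam]
    depend only on their restriction to [I11] = I. *)
Section period_doubling.
Variable R : realType.
Implicit Types (f g : R -> R) (F G : Cplx R -> Cplx R) (D : set (Cplx R)).

Definition I11 : set R := `[-1, 1].

Record renormalizable f : Prop := {
  renorm_self : forall x, I11 x -> I11 (f x);
  renorm_analytic : analytic_on I11 f;
  renorm_even : forall x, I11 x -> f (- x) = f x;
  renorm_crit : f 0 = 1;
  renorm_mono : forall x, I11 x -> x != 0 -> x * deriv_in I11 f x < 0;
  renorm_schwarz : forall x, I11 x -> x != 0 -> schwarzian I11 f x < 0;
  renorm_nested : 0 < `|f 1| < f (f 1);
  renorm_disjoint : 0 < f (f (f 1)) < `|f 1| }.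

Definition Tdoubling f : R -> R := fun x => (f 1)^-1 * f (f (f 1 * x)).

(** ∂D is smooth: near each boundary point, in suitable Euclidean coordinates,
    D is the region lying strictly below the graph of a C^∞ function. *)
Definition smooth_boundary D : Prop :=
  forall z0, (closure D `\` D°) z0 ->
    exists (u : Cplx R) (h : R -> R) (r : R),
      [/\ `|u| = 1, 0 < r,
          forall n s, derivable (derive1n n h) s 1
        & forall s t : R, s ^+ 2 + t ^+ 2 < r ^+ 2 ->
            D (z0 + u * ((s +i* t)%C : Cplx R)) <-> t < h s].

Definition extends F f : Prop := forall x, I11 x -> F (toC x) = toC (f x).

(** The affine space 1 + 𝒢_k; only the values on closure D matter. *)
Definition one_plus_G (k : nat) D F : Prop :=
  exists Fh : Cplx R -> Cplx R,
    [/\ analytic_on D Fh, {within closure D, continuous Fh}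
      & forall z, closure D z -> F z = 1 + z ^+ (2 * k) * Fh z].

Definition sup_dist D F G : \bar R :=
  ereal_sup [set (complex.Re `|F z - G z|)%:E | z in closure D].

(** G is the analytic continuation of g_k to D_k, and λ_k = g 1. *)
Record doubling_fixed_point (k : nat) g G D : Prop := {
  fp_renorm : renormalizable g;
  fp_fixed : forall x, I11 x -> Tdoubling g x = g x;
  fp_form : exists phi : R -> R, analytic_on `[0, 1] phi /\
              forall x, I11 x -> g x = phi (x ^+ (2 * k));
  fp_order : iter (2 * k) (deriv_in I11) g 0 != 0;
  fp_open : open D;
  fp_connected : connected D;
  fp_bounded : bounded_set D;
  fp_smooth : smooth_boundary D;
  fp_I : forall x, I11 x -> D (toC x);
  fp_extends : extends G g;
  fp_analytic : analytic_on D G;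
  fp_continuous : {within closure D, continuous G};
  fp_scale : closure [set toC (g 1) * z | z in D] `<=` D;
  fp_image : closure [set G (toC (g 1) * z) | z in D] `<=` D }.

(** W_s(g_k): the maps of (1 + 𝒢_k) ∩ 𝒫 all of whose renormalizations are
    defined and stay there, and converge to g_k at the geometric rate omega.
    The continuation F of the n-th renormalization is unique on closure D. *)
Definition stable_manifold (k : nat) G D (omega : R) : set (R -> R) :=
  [set f | exists M : R, forall n,
     renormalizable (iter n Tdoubling f) /\
     exists F, [/\ one_plus_G k D F, extends F (iter n Tdoubling f)
       & (sup_dist D F G <= (M * omega ^+ n)%:E)%E] ].

Definition Lam (s : R) f (x : R) (n : nat) : R :=
  \sum_(1 <= j < n.+1) `|deriv_in I11 (iter (n - j) f) (iter j f x)| `^ s.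

End period_doubling.


Section noise.
Context {d : measure_display} {Omega : measurableType d} {R : realType}.
Variable P : probability Omega R.
Local Open Scope ereal_scope.

Definition mutually_independent (X : nat -> {RV P >-> R}) : Prop :=
  forall (J : seq nat) (B : nat -> set R), uniq J ->
    (forall j, measurable (B j)) ->
    P (\bigcap_(j in [set` J]) (X j @^-1` B j)) =
    \prod_(j <- J) P (X j @^-1` B j).

Definition A3 (p : R) (X : nat -> {RV P >-> R}) : Prop :=
  (forall n, 'E_P[X n] = 0) /\
  exists c C : R, [/\ (0 < c)%R, (0 < C)%R & forall n,
    [/\ c%:E <= 'N[P]_(2%:E) [EFin \o X n],
        'N[P]_(2%:E) [EFin \o X n] <= 'N[P]_(p%:E) [EFin \o X n]
      & 'N[P]_(p%:E) [EFin \o X n] <= C%:E] ].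

Local Close Scope ereal_scope.

(** The noise is ξ_1, ξ_2, ...; [xi 0] is never used. *)
Fixpoint noisy_orbit (f : R -> R) (sigma : R) (xi : nat -> {RV P >-> R})
    (x : R) (n : nat) (w : Omega) : R :=
  if n is m.+1 then f (noisy_orbit f sigma xi x m w) + sigma * xi n w else x.

(** The event on which x_n(x, sigma) is meaningful: there the orbit up to time
    n stays in [-1 - a, 1 + a], where f is prescribed. *)
Definition small_noise (a sigma : R) (xi : nat -> {RV P >-> R}) (n : nat) :
    set Omega :=
  [set w | forall j, (1 <= j <= n)%N -> sigma * `|xi j w| <= a].

Definition wn (f : R -> R) (xi : nat -> {RV P >-> R}) (x : R) (n : nat)
    (sigma : R) (w : Omega) : R :=
  (noisy_orbit f sigma xi x n w - iter n f x) /
  (sigma * Num.sqrt (\sum_(1 <= j < n.+1)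
     deriv_in (@I11 R) (iter (n - j) f) (iter j f x) ^+ 2
     * fine 'E_P[fun w => xi j w ^+ 2])).

Definition cond_prob (A B : set Omega) : R :=
  fine (P (A `&` B)) / fine (P B).

End noise.

Definition Phi (R : realType) (z : R) : R :=
  (Num.sqrt (2 * pi))^-1 *
  \int[lebesgue_measure]_(t in `]-oo, z]) expR (- (t ^+ 2) / 2).

(** Convergence in distribution, in terms of distribution functions. *)
Definition cvg_in_distribution (R : realType) (Fn : nat -> R -> R)
    (F : R -> R) : Prop :=
  forall z, {for z, continuous F} -> Fn n z @[n --> \oo] --> F z.

(* Main.v *)
From HB Require Import structures.
Require Import Defs.
From mathcomp Require Import all_boot all_order all_algebra.
From mathcomp Require Import all_classical all_reals all_analysis.
From mathcomp Require Import measurable_realfun.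
From mathcomp Require Import ring lra zify.

Set Implicit Arguments.
Unset Strict Implicit.
Unset Printing Implicit Defensive.

Import Order.TTheory GRing.Theory Num.Theory.
Import numFieldNormedType.Exports.

Local Open Scope classical_set_scope.
Local Open Scope ring_scope.

(** A kick at time [j] is multiplied by the derivative of [f^(n-j)] at [f^j x]
    until time [n]. The first claim says that, along the critical orbit, no
    single kick dominates the sum of all of them; this is Lyapunov's condition
    for the linear response to the noise, and the two other claims follow from
    a central limit theorem with rate and a bound on nonlinear effects.

    Derivatives along the critical orbit. Let [fn n] be the n-th renormalization
    of [f] and [Lam n] the product of the first scaling factors. Then [f^(2^n)]
    on [Lam n * I] is a rescaled copy of [fn n]. Adding to a time [t], whose
    binary digits below [n] form [r < 2^n], the missing digit [2^n] therefore
    amounts to inserting one application of [fn n], whose derivative is under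
    control once its critical point is divided out, and to moving the starting
    point of the remaining [r] steps inside [Lam n * I]. The latter is harmless
    by bounded distortion, because the inverse branches of renormalization,
    [u |-> fn n 1 * u] and [u |-> fn n (fn n 1 * u)], contract: for [n] large
    they map the complex domain [D] well inside itself, and the Schwarz lemma
    makes their compositions exponentially contracting ([composition_contract],
    [stable_estimates]). So the derivatives are quotients of a single sequence
    that changes at most by a bounded factor when a binary digit of the time is
    flipped ([critical_orbit_derivatives]). For such a sequence every block of
    times of length [2^(m+1)] consists of two blocks of comparable mass, so that
    a single time carries a share of the mass which is exponentially small in
    [m], that is, polynomially small in the length ([flips_no_dominant_term]).
    This gives the first claim at a polynomial rate ([sens_ratio]), and also
    polynomial bounds for all derivatives ([sens_growth]).

    Complex analysis enters only through the Schwarz lemma, which is obtained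
    from the maximum principle for functions that are, at each point, polynomial
    up to an error of order three.

    Central limit theorem. Stein's method compares the normalised linear response
    with a Gaussian variable on Lipschitz test functions, up to the sum of the
    powers [|c j|^(r+2)] of the weights, where [r = min(p, 3) - 2]; smoothing
    the indicators of half lines yields a bound for the distribution functions
    ([berry_esseen]). It needs only that each summand is independent of the sum
    of the others ([indep_wsum]).

    Nonlinear effects. If all kicks up to time [n] are at most [n], which fails
    with probability [O(1/n)], then the noisy orbit differs from the orbit of
    [f] plus the linear response by [sigma^2] times a fixed power of [n]
    ([orbit_linearisation]). After division by [sigma], and by the standard
    deviation, which is bounded below, this is negligible as soon as [sigma]
    decays fast enough, and [cdf_sandwich] transfers the Gaussian bound to the
    nonlinear variable ([clt_estimate]). *)

(** * The modulus of a complex number *)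

(** The norm of [Cplx R] takes its values in [Cplx R]; all estimates below are
    made with this real-valued modulus. *)
Definition cmod (R : realType) (z : Cplx R) : R := complex.Re `|z|.

Section modulus.
Variable R : realType.
Implicit Types (z w : Cplx R) (x y : R).

Lemma toCD x y : toC (x + y) = toC x + toC y. Proof. exact: rmorphD. Qed.
Lemma toCB x y : toC (x - y) = toC x - toC y. Proof. exact: rmorphB. Qed.
Lemma toCM x y : toC (x * y) = toC x * toC y. Proof. exact: rmorphM. Qed.
Lemma toCX x n : toC (x ^+ n) = toC x ^+ n. Proof. exact: rmorphXn. Qed.
Lemma toCV x : toC x^-1 = (toC x)^-1. Proof. exact: fmorphV. Qed.
Lemma toC0 : toC (0 : R) = 0. Proof. by []. Qed.
Lemma toC1 : toC (1 : R) = 1. Proof. by []. Qed.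
Lemma toC_nat n : toC (n%:R : R) = n%:R. Proof. exact: rmorph_nat. Qed.
Lemma toC_inj : injective (@toC R). Proof. exact: complexI. Qed.
Lemma ltr_toC x y : (toC x < toC y) = (x < y). Proof. exact: ltcR. Qed.
Lemma ler_toC x y : (toC x <= toC y) = (x <= y). Proof. exact: lecR. Qed.

Lemma normCE z : `|z| = toC (cmod z).
Proof. by rewrite /cmod [`|z|]normc_def. Qed.

Lemma gt0_toC (e : Cplx R) : 0 < e -> exists2 x, 0 < x & e = toC x.
Proof.
case: e => a b; rewrite ltcE /= => /andP[/eqP b0 a0].
by exists a => //; rewrite b0.
Qed.

Lemma cmod_ge0 z : 0 <= cmod z.
Proof. by rewrite -ler_toC -normCE normr_ge0. Qed.
Lemma cmod0 : cmod (0 : Cplx R) = 0.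
Proof. by apply: toC_inj; rewrite -normCE normr0. Qed.
Lemma cmod_eq0 z : (cmod z == 0) = (z == 0).
Proof. by rewrite -(inj_eq toC_inj) -normCE toC0 normr_eq0. Qed.
Lemma cmod_gt0 z : (0 < cmod z) = (z != 0).
Proof. by rewrite lt0r cmod_eq0 cmod_ge0 andbT. Qed.
Lemma cmodD z w : cmod (z + w) <= cmod z + cmod w.
Proof. by rewrite -ler_toC toCD -!normCE ler_normD. Qed.
Lemma cmodN z : cmod (- z) = cmod z.
Proof. by apply: toC_inj; rewrite -!normCE normrN. Qed.
Lemma cmodB z w : cmod (z - w) <= cmod z + cmod w.
Proof. by rewrite (le_trans (cmodD _ _)) ?cmodN. Qed.
Lemma cmodC z w : cmod (z - w) = cmod (w - z).
Proof. by rewrite -cmodN opprB. Qed.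
Lemma cmodM z w : cmod (z * w) = cmod z * cmod w.
Proof. by apply: toC_inj; rewrite toCM -!normCE normrM. Qed.
Lemma cmodX z n : cmod (z ^+ n) = cmod z ^+ n.
Proof. by apply: toC_inj; rewrite toCX -!normCE normrX. Qed.
Lemma cmodV z : cmod z^-1 = (cmod z)^-1.
Proof. by apply: toC_inj; rewrite toCV -!normCE normfV. Qed.
Lemma cmod_toC x : cmod (toC x) = `|x|.
Proof.
rewrite /cmod normc_def /= expr0n addr0.
by rewrite sqrtr_sqr.
Qed.
Lemma cmod_dist3 z w v : cmod (z - v) <= cmod (z - w) + cmod (w - v).
Proof. by rewrite (le_trans _ (cmodD _ _))// addrA subrK. Qed.
Lemma lerB_cmod z w : cmod z - cmod w <= cmod (z - w).
Proof. by rewrite lerBlDr (le_trans _ (cmodD _ _))// subrK. Qed.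

Lemma sqr_cmod z : cmod z ^+ 2 = complex.Re z ^+ 2 + complex.Im z ^+ 2.
Proof. by rewrite /cmod normc_def /= sqr_sqrtr// addr_ge0 ?sqr_ge0. Qed.

Lemma Re_le_cmod z : `|complex.Re z| <= cmod z.
Proof.
rewrite -(@ler_pXn2r _ 2)// ?nnegrE ?cmod_ge0// sqr_cmod real_normK ?num_real//.
by rewrite lerDl sqr_ge0.
Qed.
Lemma Im_le_cmod z : `|complex.Im z| <= cmod z.
Proof.
rewrite -(@ler_pXn2r _ 2)// ?nnegrE ?cmod_ge0// sqr_cmod real_normK ?num_real//.
by rewrite lerDr sqr_ge0.
Qed.

Lemma cmod_le_ReIm z : cmod z <= `|complex.Re z| + `|complex.Im z|.
Proof.
rewrite -(@ler_pXn2r _ 2)// ?nnegrE ?cmod_ge0 ?addr_ge0// sqr_cmod.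
rewrite -[complex.Re z ^+ 2]real_normK ?num_real//.
rewrite -[complex.Im z ^+ 2]real_normK ?num_real//.
have := mulr_ge0 (normr_ge0 (complex.Re z)) (normr_ge0 (complex.Im z)); lra.
Qed.

Lemma nbhsC z (A : set (Cplx R)) :
  nbhs z A <-> exists2 r : R, 0 < r & forall w, cmod (w - z) < r -> A w.
Proof.
split=> [/nbhs_ballP[e /= e0 eA]|[r r0 rA]].
  have [r r0 er] := gt0_toC e0; exists r => // w wz; apply: eA.
  by rewrite /ball /= normCE er ltr_toC cmodC.
apply/nbhs_ballP; exists (toC r) => /=; first by rewrite -toC0 ltr_toC.
by move=> w; rewrite /ball /= normCE ltr_toC cmodC => /rA.
Qed.

Lemma cvgC (T : topologicalType) (F : set_system T) (h : T -> Cplx R) z :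
  Filter F -> h @ F --> z <->
  forall e : R, 0 < e -> \forall t \near F, cmod (h t - z) < e.
Proof.
move=> FF; split=> [hz e e0|hz].
  by apply: (hz [set w | cmod (w - z) < e]); apply/nbhsC; exists e.
by move=> A /nbhsC[e e0 eA]; apply: filterS (hz e e0) => t; exact: eA.
Qed.

Lemma cmod_continuous : continuous (@cmod R).
Proof.
move=> z; apply/(@cvgrPdist_lt _ _ _ _ (nbhs_filter z)) => e e0.
apply/nbhsC; exists e => // w wz.
rewrite ltr_norml; have := lerB_cmod z w; have := lerB_cmod w z.
by rewrite [cmod (z - w)]cmodC; move: wz; set a := cmod _; set b := cmod z; set c := cmod w; lra.
Qed.

Lemma closed_cmod_le (z : Cplx R) r : closed [set w | cmod (w - z) <= r].
Proof.
move=> w cw; rewrite /= leNgt; apply/negP => rw.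
have : nbhs w [set v | cmod (v - w) < cmod (w - z) - r].
  by apply/nbhsC; exists (cmod (w - z) - r) => //; rewrite subr_gt0.
move=> /cw[v [/= vz vw]].
have := cmod_dist3 w v z; rewrite [cmod (w - v)]cmodC.
by set a := cmod _ in rw vw *; set b := cmod _ in vw *; set c := cmod _ in vz *; lra.
Qed.

Lemma ReIm_continuous :
  continuous ((fun p => (p.1 +i* p.2)%C) : R * R -> Cplx R).
Proof.
move=> [a b]; apply/cvgC => e e0.
have h1 : \forall p \near (a, b), `|p.1 - a| < e / 2.
  have /cvgrPdist_lt/(_ (e / 2)) : ((fun p : R * R => p.1) @ (a, b)) --> a by exact: cvg_fst.
  by move=> /(_ (divr_gt0 e0 (ltr0Sn _ _))); apply: filterS => p; rewrite distrC.
have h2 : \forall p \near (a, b), `|p.2 - b| < e / 2.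
  have /cvgrPdist_lt/(_ (e / 2)) : ((fun p : R * R => p.2) @ (a, b)) --> b by exact: cvg_snd.
  by move=> /(_ (divr_gt0 e0 (ltr0Sn _ _))); apply: filterS => p; rewrite distrC.
near=> p.
apply: le_lt_trans (cmod_le_ReIm _) _ => /=.
rewrite [e]splitr ltrD//; [near: p; exact: h1|near: p; exact: h2].
Unshelve. all: by end_near. Qed.

(** Transported from the Heine-Borel theorem for [R * R], as [Cplx R] is its
    continuous image. *)
Lemma compact_closed_bounded (K : set (Cplx R)) M :
  closed K -> (forall z, K z -> cmod z <= M) -> compact K.
Proof.
move=> clK KM.
pose f := ((fun p => (p.1 +i* p.2)%C) : R * R -> Cplx R).
have cR : compact (f @` (`[- M, M] `*` `[- M, M])).
  apply: continuous_compact; last by apply: compact_setX; exact: segment_compact.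
  by apply: continuous_subspaceT; exact: ReIm_continuous.
apply: subclosed_compact clK cR _ => z Kz.
have {}KM := KM z Kz.
exists (complex.Re z, complex.Im z); last by rewrite /f /=; case: (z).
split; rewrite /= in_itv /= -ler_norml.
  exact: le_trans (Re_le_cmod z) KM.
exact: le_trans (Im_le_cmod z) KM.
Qed.

Lemma compact_margin (K D : set (Cplx R)) :
  compact K -> open D -> K `<=` D ->
  exists2 e : R, 0 < e & forall z w, K z -> cmod (w - z) < e -> D w.
Proof.
move=> cK oD KD.
have /compact_near_coveringP cov := cK.
have := cov R (0^'+) (fun e z => forall w, cmod (w - z) < e -> D w) _.
case.
  move=> z /KD Dz.
  have /nbhsC[r r0 rD] : nbhs z D by rewrite nbhsE/=; exists D.
  exists ([set w | cmod (w - z) < r / 2], [set e | e < r / 2]) => /=.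
    split; first by apply/nbhsC; exists (r / 2); rewrite ?divr_gt0.
    by apply: nbhs_right_lt; rewrite divr_gt0.
  move=> [w e] [/= wz er] v vw; apply: rD.
  have := cmod_dist3 v w z; move: wz vw.
  by set x1 := cmod _; set x2 := cmod _; set x3 := cmod _; lra.
move=> e /= e0 eP.
exists (e / 2); first by rewrite divr_gt0.
move=> z w Kz; apply: (eP (e / 2)) => //=; last by rewrite divr_gt0.
by rewrite sub0r normrN gtr0_norm ?divr_gt0//; lra.
Qed.

End modulus.

(** * Polynomial approximation at a point *)

Lemma cvg_series_terms_bounded (K : numFieldType) (u : nat -> K) (l : K) :
  series u @ \oo --> l -> exists2 B, 0 <= B & forall n, `|u n| <= B.
Proof.
move=> /cvgrPdist_lt/(_ 1 ltr01)[N _ lN].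
exists (2 + \sum_(n < N) `|u n|); first by rewrite addr_ge0// sumr_ge0.
move=> n; have [nN|Nn] := ltnP n N.
  rewrite (bigD1 (Ordinal nN))//= addrCA lerDl addr_ge0// sumr_ge0//.
apply: (@le_trans _ _ 2); last by rewrite lerDl sumr_ge0.
have -> : u n = (l - series u n) - (l - series u n.+1).
  by rewrite /series/= big_nat_recr//=; ring.
apply: le_trans (ler_normB _ _) _; rewrite -[2]/(1 + 1) lerD// ltW//; apply: lN => //=.
exact: leq_trans Nn _.
Qed.

(** Half way inside its radius of convergence, a power series is dominated by
    a geometric series, so each of its remainders is of the expected order. *)
Lemma series_taylor (K : numFieldType) (c : nat -> K) (t0 l0 : K) m :
  t0 != 0 -> series (fun n => c n * t0 ^+ n) @ \oo --> l0 ->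
  exists2 B, 0 <= B & forall t l, `|t| <= `|t0| / 2 ->
    series (fun n => c n * t ^+ n) @ \oo --> l ->
    `|l - \sum_(n < m) c n * t ^+ n| <= B * `|t| ^+ m.
Proof.
move=> t00 /cvg_series_terms_bounded[B B0 Bc].
have T0 : 0 < `|t0| by rewrite normr_gt0.
exists (B * 2 / `|t0| ^+ m); first by rewrite divr_ge0 ?mulr_ge0 ?exprn_ge0.
move=> t l tt0 /cvgrPdist_lt tl.
apply/ler_addgt0Pr => e e0.
have [N _ /(_ (maxn N m) (leq_maxl _ _)) lN] := tl _ e0.
rewrite [_ + e]addrC.
apply: le_trans (ler_distD (series (fun n => c n * t ^+ n) (maxn N m)) _ _) _.
apply: lerD; first exact: ltW.
rewrite /series /= -(big_mkord xpredT (fun n => c n * t ^+ n)).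
rewrite (@big_cat_nat _ _ _ m 0 (maxn N m))//= ?leq_maxr// addrAC subrr add0r.
set q := `|t| / `|t0|.
have q0 : 0 <= q by rewrite divr_ge0.
have q1 : q <= 2^-1 by rewrite /q ler_pdivrMr// mulrC.
have term n : `|c n * t ^+ n| <= B * q ^+ n.
  rewrite normrM normrX /q expr_div_n mulrA ler_pdivlMr ?exprn_gt0//.
  by rewrite mulrAC ler_wpM2r ?exprn_ge0// (le_trans _ (Bc n))// normrM normrX.
apply: le_trans (ler_norm_sum _ _ _) _.
apply: (@le_trans _ _ (\sum_(m <= n < maxn N m) B * q ^+ n)).
  by apply: ler_sum => n _; exact: term.
have geo j : \sum_(m <= n < m + j) q ^+ n + 2 * q ^+ (m + j) <= 2 * q ^+ m.
  elim: j => [|j IH]; first by rewrite addn0 big_geq// add0r.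
  rewrite addnS big_nat_recr ?leq_addr//= (le_trans _ IH)// -addrA lerD2l.
  rewrite [X in _ <= X]mulr_natl mulr2n lerD2l exprS mulrA ler_piMl ?exprn_ge0//.
  by rewrite mulrC -ler_pdivlMr// mul1r.
rewrite -mulr_sumr -mulrA.
apply: (@le_trans _ _ (B * (2 * q ^+ m))).
  rewrite ler_wpM2l//; have := geo (maxn N m - m)%N; rewrite subnKC ?leq_maxr//.
  by apply: le_trans; rewrite lerDl mulr_ge0 ?exprn_ge0.
by rewrite /q expr_div_n !mulrA mulrAC.
Qed.

(** [h] agrees with a polynomial up to an error of order [m] at [z]; this is
    all that the maximum principle and the Schwarz lemma need to know about
    analyticity, and it is visibly stable under composition. *)
Definition jet (R : realType) m (h : Cplx R -> Cplx R) (z : Cplx R) :=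
  exists (p : {poly Cplx R}) (K r : R), 0 < r /\
    forall w, cmod (w - z) < r ->
      cmod (h w - p.[w - z]) <= K * cmod (w - z) ^+ m.

Section jets.
Variable R : realType.
Implicit Types (z w t : Cplx R) (h : Cplx R -> Cplx R) (p : {poly Cplx R}).

Lemma poly_bounded p : exists2 B : R, 0 <= B &
  forall t, cmod t <= 1 -> cmod p.[t] <= B.
Proof.
elim/poly_ind: p => [|p c [B B0 Bp]].
  by exists 0 => // t _; rewrite horner0 cmod0.
exists (B + cmod c); first by rewrite addr_ge0 ?cmod_ge0.
move=> t t1; rewrite !hornerE; apply: le_trans (cmodD _ _) _.
rewrite lerD2r cmodM -[B]mulr1 ler_pM ?cmod_ge0//; exact: Bp.
Qed.

Lemma poly_lipschitz p : exists2 L : R, 0 <= L &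
  forall s t, cmod s <= 1 -> cmod t <= 1 -> cmod (p.[s] - p.[t]) <= L * cmod (s - t).
Proof.
elim/poly_ind: p => [|p c [L L0 Lp]].
  by exists 0 => // s t _ _; rewrite !horner0 subrr cmod0 mul0r.
have [B B0 Bp] := poly_bounded p.
exists (L + B); first by rewrite addr_ge0.
move=> s t s1 t1; rewrite !hornerE.
have -> : p.[s] * s + c - (p.[t] * t + c) = (p.[s] - p.[t]) * s + p.[t] * (s - t).
  by ring.
apply: le_trans (cmodD _ _) _; rewrite !cmodM mulrDl lerD//.
  by rewrite -[X in _ <= X]mulr1 ler_pM ?cmod_ge0 ?Lp.
by rewrite ler_wpM2r ?cmod_ge0 ?Bp.
Qed.

Lemma jetP m h z : jet m h z -> exists (p : {poly Cplx R}) (K r : R),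
  [/\ 0 <= K, 0 < r, r <= 1 & forall w, cmod (w - z) < r ->
      cmod (h w - p.[w - z]) <= K * cmod (w - z) ^+ m].
Proof.
move=> [p [K [r [r0 H]]]]; exists p, `|K|, (Num.min r 1); split => //.
- by rewrite lt_min r0 ltr01.
- by rewrite ge_min lexx orbT.
- move=> w; rewrite lt_min => /andP[wr _]; apply: le_trans (H w wr) _.
  by rewrite ler_wpM2r ?exprn_ge0 ?cmod_ge0 ?ler_norm.
Qed.

Lemma jet_near m h h' z : (\forall w \near z, h w = h' w) -> jet m h z -> jet m h' z.
Proof.
move=> /nbhsC[r r0 hh'] /jetP[p [K [r1 [K0 r10 _ H]]]].
exists p, K, (Num.min r r1); split; first by rewrite lt_min r0.
by move=> w; rewrite lt_min => /andP[wr wr1]; rewrite -hh'// H.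
Qed.

Lemma jet_poly m p z : jet m (horner p) z.
Proof.
exists (p \Po ('X + z%:P)), 0, 1; split => // w _.
by rewrite horner_comp !hornerE subrK subrr cmod0 ?mul0r.
Qed.

Lemma jet_id m z : jet m id z.
Proof.
have := jet_poly m 'X z; apply: jet_near.
by near=> w; rewrite hornerX.
Unshelve. all: by end_near. Qed.

Lemma jet_cst m c z : jet m (fun=> c) z.
Proof.
have := jet_poly m c%:P z; apply: jet_near.
by near=> w; rewrite hornerC.
Unshelve. all: by end_near. Qed.

Lemma jetD m h1 h2 z : jet m h1 z -> jet m h2 z -> jet m (fun w => h1 w + h2 w) z.
Proof.
move=> /jetP[p1 [K1 [r1 [K10 r10 _ H1]]]] /jetP[p2 [K2 [r2 [K20 r20 _ H2]]]].
exists (p1 + p2), (K1 + K2), (Num.min r1 r2); split; first by rewrite lt_min r10.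
move=> w; rewrite lt_min => /andP[wr1 wr2]; rewrite hornerD opprD addrACA.
by apply: le_trans (cmodD _ _) _; rewrite mulrDl lerD ?H1 ?H2.
Qed.

Lemma jetM m h1 h2 z : jet m h1 z -> jet m h2 z -> jet m (fun w => h1 w * h2 w) z.
Proof.
move=> /jetP[p1 [K1 [r1 [K10 r10 r11 H1]]]] /jetP[p2 [K2 [r2 [K20 r20 r21 H2]]]].
have [B1 B10 Bp1] := poly_bounded p1; have [B2 B20 Bp2] := poly_bounded p2.
exists (p1 * p2), (K1 * (B2 + K2) + B1 * K2), (Num.min r1 r2).
split; first by rewrite lt_min r10.
move=> w; rewrite lt_min => /andP[wr1 wr2]; rewrite hornerM.
set t := w - z in wr1 wr2 *.
have t1 : cmod t <= 1 by exact: le_trans (ltW wr1) r11.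
have -> : h1 w * h2 w - p1.[t] * p2.[t] =
  (h1 w - p1.[t]) * h2 w + p1.[t] * (h2 w - p2.[t]) by ring.
apply: le_trans (cmodD _ _) _; rewrite !cmodM mulrDl lerD//.
  rewrite mulrAC ler_pM ?cmod_ge0 ?H1//.
  rewrite -[h2 w](subrK p2.[t]) addrC; apply: le_trans (cmodD _ _) _.
  rewrite lerD ?Bp2// (le_trans (H2 _ wr2))// ler_piMr//.
  by rewrite exprn_ile1 ?cmod_ge0.
by rewrite -mulrA ler_pM ?cmod_ge0 ?H2 ?Bp1.
Qed.

Lemma jetX m h z n : jet m h z -> jet m (fun w => h w ^+ n) z.
Proof.
move=> hz; elim: n => [|n IH].
  by under eq_fun do rewrite expr0; exact: jet_cst.
by under eq_fun do rewrite exprS; exact: jetM.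
Qed.

Lemma jetB m h1 h2 z : jet m h1 z -> jet m h2 z -> jet m (fun w => h1 w - h2 w) z.
Proof.
move=> j1 j2; apply: jetD j1 _.
by under eq_fun do rewrite -mulN1r; apply: jetM j2; exact: jet_cst.
Qed.

Lemma jet_lip m h z : jet m.+1 h z -> exists (L r : R),
  [/\ 0 <= L, 0 < r & forall w, cmod (w - z) < r -> cmod (h w - h z) <= L * cmod (w - z)].
Proof.
move=> /jetP[p [K [r [K0 r0 r1 H]]]].
have [L L0 Lp] := poly_lipschitz p.
exists (K + L), r; split => //; first by rewrite addr_ge0.
move=> w wr.
have := H z; rewrite subrr cmod0 => /(_ r0).
rewrite exprS mul0r mulr0 => hz.
have /eqP : cmod (h z - p.[0]) = 0 by apply/eqP; rewrite eq_le hz cmod_ge0.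
rewrite cmod_eq0 subr_eq0 => /eqP ->.
apply: le_trans (cmod_dist3 _ p.[w - z] _) _; rewrite mulrDl lerD//.
  apply: le_trans (H _ wr) _; rewrite exprS mulrA ler_piMr ?mulr_ge0 ?cmod_ge0//.
  by rewrite exprn_ile1 ?cmod_ge0// (le_trans (ltW wr)).
rewrite -[X in _ <= L * cmod X]subr0 Lp ?cmod0//.
exact: le_trans (ltW wr) r1.
Qed.

Lemma jet_continuous m h z : jet m.+1 h z -> {for z, continuous h}.
Proof.
move=> /jet_lip[L [r [L0 r0 H]]]; apply/(cvgC _ _ (nbhs_filter z)) => e e0.
apply/nbhsC; exists (Num.min r (e / (L + 1))).
  by rewrite lt_min r0 divr_gt0// ltr_wpDl.
move=> w; rewrite lt_min => /andP[wr we].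
apply: le_lt_trans (H _ wr) _.
apply: (@le_lt_trans _ _ ((L + 1) * cmod (w - z))).
  by rewrite ler_wpM2r ?cmod_ge0// lerDl.
by rewrite mulrC -ltr_pdivlMr// ltr_wpDl.
Qed.

(** Substituting the polynomial of [f] into that of [h] works because a jet is
    Lipschitz at its base point, so errors of order [m] stay of order [m]. *)
Lemma jet_comp m f h z : jet m.+1 f z -> jet m.+1 h (f z) -> jet m.+1 (fun w => h (f w)) z.
Proof.
move=> jf /jetP[p [K1 [r1 [K10 r10 r11 H1]]]].
have [L [r2 [L0 r20 fL]]] := jet_lip jf.
move: jf => /jetP[q [K2 [r3 [K20 r30 r31 H2]]]].
have [Lp Lp0 Lpp] := poly_lipschitz p.
have [Lq Lq0 Lqq] := poly_lipschitz q.
have := H2 z; rewrite subrr cmod0 => /(_ r30).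
rewrite exprS mul0r mulr0 => fz.
have /eqP : cmod (f z - q.[0]) = 0 by apply/eqP; rewrite eq_le fz cmod_ge0.
rewrite cmod_eq0 subr_eq0 => /eqP {}fz.
pose M := 1 + L + Lq.
have M0 : 0 < M by rewrite /M -addrA ltr_wpDr ?addr_ge0.
pose r := Num.min (Num.min r2 r3) (r1 / M).
exists (p \Po (q - q.[0]%:P)), (K1 * L ^+ m.+1 + Lp * K2), r.
split; first by rewrite /r !lt_min r20 r30 divr_gt0.
move=> w; rewrite /r !lt_min => /andP[/andP[wr2 wr3] wr1].
have wM : M * cmod (w - z) < r1 by rewrite mulrC -ltr_pdivlMr.
have c0 := cmod_ge0 (w - z).
have fwr : cmod (f w - f z) <= L * cmod (w - z) by exact: fL.
have Lr1 : L * cmod (w - z) < r1.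
  by apply: le_lt_trans wM; rewrite ler_wpM2r// /M addrAC lerDr addr_ge0.
have qr1 : cmod (q.[w - z] - q.[0]) <= 1.
  apply: le_trans (Lqq _ _ _ _) _; rewrite ?cmod0// ?subr0.
    exact: le_trans (ltW wr3) r31.
  apply: le_trans (ltW (lt_le_trans wM r11)).
  by rewrite ler_wpM2r// /M lerDr addr_ge0.
have -> : (p \Po (q - (q.[0])%:P)).[w - z] = p.[q.[w - z] - q.[0]].
  by rewrite horner_comp !hornerE.
apply: le_trans (cmod_dist3 _ p.[f w - f z] _) _; rewrite mulrDl lerD//.
  apply: le_trans (H1 _ (le_lt_trans fwr Lr1)) _.
  by rewrite -mulrA -exprMn ler_wpM2l// lerXn2r ?nnegrE ?cmod_ge0 ?mulr_ge0.
apply: le_trans (Lpp _ _ _ qr1) _.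
  exact: le_trans fwr (le_trans (ltW Lr1) r11).
rewrite -mulrA ler_wpM2l// fz.
have -> : f w - q.[0] - (q.[w - z] - q.[0]) = f w - q.[w - z] by ring.
exact: H2.
Qed.

(** The geometric series around [z], cut at order [m]. *)
Lemma jet_inv m z : z != 0 -> jet m (fun w => w^-1) z.
Proof.
move=> z0; have Z0 : 0 < cmod z by rewrite cmod_gt0.
exists (\poly_(j < m) ((-1) ^+ j * z^-1 ^+ j.+1)).
exists (2 / cmod z ^+ m.+1), (cmod z / 2); split; first by rewrite divr_gt0.
move=> w wz; set t := w - z in wz *.
have -> : w = z + t by rewrite /t addrC subrK.
have zt : cmod z / 2 <= cmod (z + t).
  have := lerB_cmod z (- t); rewrite cmodN opprK; move: wz.
  by set a := cmod t; set b := cmod z; set c := cmod _; lra.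
have zt0 : z + t != 0 by rewrite -cmod_gt0 (lt_le_trans _ zt)// divr_gt0.
have E : \sum_(j < m) (-1) ^+ j * z^-1 ^+ j.+1 * t ^+ j =
   (z + t)^-1 * (1 - (- t / z) ^+ m).
  rewrite -[1 - _]opprB subrX1 -mulNr opprB.
  rewrite mulr_sumr mulr_sumr; apply: eq_bigr => j _.
  have -> : 1 - - t / z = (z + t) / z by field.
  have -> : (- t / z) ^+ j = (-1) ^+ j * t ^+ j * z^-1 ^+ j.
    by rewrite -!exprMn; congr (_ ^+ _); ring.
  rewrite exprS; move: ((-1) ^+ j) (t ^+ j) (z^-1 ^+ j) => a b c.
  by field; rewrite z0.
rewrite horner_poly E mulrBr mulr1 opprB addrC subrK cmodM cmodV cmodX cmodM cmodN cmodV.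
have -> : 2 / cmod z ^+ m.+1 * cmod t ^+ m = (cmod z / 2)^-1 * (cmod t / cmod z) ^+ m.
  by rewrite expr_div_n exprS; field; rewrite expf_neq0 ?gt_eqF//.
by rewrite ler_wpM2r ?exprn_ge0 ?divr_ge0 ?cmod_ge0// lef_pV2// posrE ?divr_gt0// cmod_gt0.
Qed.

Lemma analytic_jet m (D : set (Cplx R)) h z :
  open D -> analytic_on D h -> D z -> jet m h z.
Proof.
move=> oD hD Dz; have [c [r' [r'0 H]]] := hD z Dz.
have [r r0 rE] := gt0_toC r'0.
have /nbhsC[s s0 sD] : nbhs z D by rewrite nbhsE/=; exists D.
pose e := Num.min r s / 2.
have e0 : 0 < e by rewrite divr_gt0// lt_min r0.
have er : e < Num.min r s by rewrite /e ltr_pdivrMr// ltr_pMr ?ltr1n// lt_min r0.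
have He w : cmod (w - z) < Num.min r s ->
  series (fun n => c n * (w - z) ^+ n) @ \oo --> h w.
  by rewrite lt_min => /andP[wr ws]; apply: H; [exact: sD|rewrite normCE rE ltr_toC].
have et : cmod (z + toC e - z) = e by rewrite addrC addKr cmod_toC gtr0_norm.
have := He (z + toC e); rewrite et => /(_ er).
have -> : z + toC e - z = toC e by rewrite addrC addKr.
have e0' : toC e != 0 by rewrite -cmod_eq0 cmod_toC normr_eq0 gt_eqF.
move=> /(series_taylor m e0')[B B0 HB].
exists (\poly_(n < m) c n), (complex.Re B), (e / 2); split; first by rewrite divr_gt0.
move=> w we.
have := HB (w - z) (h w); rewrite !normCE cmod_toC gtr0_norm//.
rewrite horner_poly -ler_toC toCM toCX => HH.
have -> : toC (complex.Re B) = B.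
  by move: B0; rewrite lecE /= => /andP[/eqP]; case: (B) => a b /= -> _.
apply: HH.
  rewrite -[X in _ / X]toC_nat -toCV -toCM ler_toC.
  exact: ltW.
apply: He; apply: lt_trans we _; apply: lt_trans er.
by rewrite ltr_pdivrMr// ltr_pMr ?ltr1n.
Qed.

End jets.

(** * The maximum principle and the Schwarz lemma *)

Section maximum_principle.
Variable R : realType.
Implicit Types (z w t : Cplx R) (h : Cplx R -> Cplx R) (p : {poly Cplx R}).

Lemma poly_divX p : exists (q : {poly Cplx R}) (c : Cplx R), p = q * 'X + c%:P.
Proof.
by elim/poly_ind: p => [|p c _]; [exists 0, 0; rewrite mul0r add0r|exists p, c].
Qed.

(** Only a second order expansion enters the maximum principle. *)
Lemma jet3_quadratic h w0 : jet 3 h w0 -> exists (b c : Cplx R) (K r : R),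
  [/\ 0 <= K, 0 < r & forall t, cmod t < r ->
    cmod (h (w0 + t) - (h w0 + b * t + c * t ^+ 2)) <= K * cmod t ^+ 3].
Proof.
move=> /jetP[p [K [r [K0 r0 r1 H]]]].
have [p1 [a pE]] := poly_divX p.
have [p2 [b p1E]] := poly_divX p1.
have [p3 [c p2E]] := poly_divX p2.
have [B B0 Bp] := poly_bounded p3.
have ha : h w0 = a.
  have := H w0; rewrite subrr cmod0 => /(_ r0).
  rewrite exprS mul0r mulr0 pE !hornerE => fz.
  by apply/eqP; rewrite -subr_eq0 -cmod_eq0 eq_le fz cmod_ge0.
exists b, c, (K + B), r; split => //; first by rewrite addr_ge0.
move=> t tr; have := H (w0 + t); rewrite addrC addKr => /(_ tr) Ht.
apply: le_trans (cmod_dist3 _ p.[t] _) _; rewrite mulrDl lerD//.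
rewrite ha pE p1E p2E !(hornerD, hornerM, hornerX, hornerC).
have -> : ((p3.[t] * t + c) * t + b) * t + a - (a + b * t + c * t ^+ 2) = p3.[t] * t ^+ 3.
  by ring.
by rewrite cmodM cmodX ler_wpM2r ?exprn_ge0 ?cmod_ge0// Bp// (le_trans (ltW tr)).
Qed.

(** Adding [eta * |w - z|^2] to [|h|^2] makes it strictly subharmonic: its
    average over the four points [w0 + s], [w0 - s], [w0 + i s], [w0 - i s]
    exceeds its value at [w0], because the linear and quadratic terms of [h]
    cancel there while [|w - z|^2] gains [s^2]. *)
Lemma no_interior_max h z w0 (eta r : R) : 0 < eta -> 0 < r -> jet 3 h w0 ->
  ~ (forall t, cmod t < r -> cmod (h (w0 + t)) ^+ 2 + eta * cmod (w0 + t - z) ^+ 2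
      <= cmod (h w0) ^+ 2 + eta * cmod (w0 - z) ^+ 2).
Proof.
move=> eta0 r0 /jet3_quadratic[b [c [K [r1 [K0 r10 H]]]]] max.
set A := cmod (h w0) in max *.
have A0 : 0 <= A by exact: cmod_ge0.
pose d := Num.min (Num.min r r1) (eta / (2 * A * K + 1)).
have den : 0 < 2 * A * K + 1 by rewrite ltr_wpDl// !mulr_ge0.
have d0 : 0 < d by rewrite !lt_min r0 r10 divr_gt0.
pose s := d / 2.
have s0 : 0 < s by rewrite divr_gt0.
have sd : s < d by rewrite /s ltr_pdivrMr// ltr_pMr ?ltr1n.
move: (sd); rewrite /d !lt_min => /andP[/andP[sr sr1]].
rewrite ltr_pdivlMr// => sden.
pose j : Cplx R := ('i)%C.
have j2 : j ^+ 2 = -1 by exact: sqr_i.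
have cj : cmod j = 1.
  have := sqr_cmod j; rewrite /= expr0n expr1n add0r => /eqP.
  rewrite sqrf_eq1 => /orP[/eqP//|/eqP cj]; have := cmod_ge0 j.
  by rewrite cj; lra.
pose S := toC s.
have cS : cmod S = s by rewrite cmod_toC gtr0_norm.
have cjS : cmod (j * S) = s by rewrite cmodM cj cS mul1r.
have quad t : cmod t = s -> cmod (h (w0 + t) - (h w0 + b * t + c * t ^+ 2)) <= K * s ^+ 3.
  by move=> ts; rewrite -ts H// ts.
have mx t : cmod t = s -> cmod (h (w0 + t)) ^+ 2 + eta * cmod (w0 + t - z) ^+ 2
      <= A ^+ 2 + eta * cmod (w0 - z) ^+ 2.
  by move=> ts; apply: max; rewrite ts.
have q1 := quad _ cS; have q2 := quad (- S) (etrans (cmodN _) cS).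
have q3 := quad _ cjS; have q4 := quad (- (j * S)) (etrans (cmodN _) cjS).
have m1 := mx _ cS; have m2 := mx (- S) (etrans (cmodN _) cS).
have m3 := mx _ cjS; have m4 := mx (- (j * S)) (etrans (cmodN _) cjS).
have par : cmod (w0 + S - z) ^+ 2 + cmod (w0 - S - z) ^+ 2 +
   cmod (w0 + j * S - z) ^+ 2 + cmod (w0 - j * S - z) ^+ 2 =
   4 * cmod (w0 - z) ^+ 2 + 4 * s ^+ 2.
  rewrite !sqr_cmod /S /toC /j; case: (w0) => x y; case: (z) => x' y' /=; ring.
have avg : 4 * A <= cmod (h (w0 + S)) + cmod (h (w0 - S)) + cmod (h (w0 + j * S)) +
    cmod (h (w0 - j * S)) + 4 * (K * s ^+ 3).
  have -> : 4 * A = cmod (4 * h w0).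
    by rewrite cmodM -toC_nat cmod_toC normr_nat.
  have -> : 4 * h w0 = (h (w0 + S) + h (w0 - S) + h (w0 + j * S) + h (w0 - j * S))
     - ((h (w0 + S) - (h w0 + b * S + c * S ^+ 2)) +
        (h (w0 - S) - (h w0 + b * (- S) + c * (- S) ^+ 2)) +
        (h (w0 + j * S) - (h w0 + b * (j * S) + c * (j * S) ^+ 2)) +
        (h (w0 - j * S) - (h w0 + b * (- (j * S)) + c * (- (j * S)) ^+ 2))).
    by rewrite !sqrrN !exprMn j2; ring.
  apply: le_trans (cmodB _ _) _; apply: lerD.
    by do 3 (apply: le_trans (cmodD _ _) _; apply: lerD => //).
  have -> : 4 * (K * s ^+ 3) = K * s ^+ 3 + K * s ^+ 3 + K * s ^+ 3 + K * s ^+ 3 by ring.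
  by do 3 (apply: le_trans (cmodD _ _) _; apply: lerD => //).
move: m1 m2 m3 m4 avg par.
move: (cmod (h (w0 + S))) (cmod (h (w0 - S))) (cmod (h (w0 + j * S))) (cmod (h (w0 - j * S))).
move: (cmod (w0 + S - z)) (cmod (w0 - S - z)) (cmod (w0 + j * S - z)) (cmod (w0 - j * S - z)).
move: (cmod (w0 - z)) => e e1 e2 e3 e4 x1 x2 x3 x4 m1 m2 m3 m4 avg par.
have sq x : 2 * A * x - A ^+ 2 <= x ^+ 2.
  by rewrite -subr_ge0; have := sqr_ge0 (x - A); congr (_ <= _); ring.
have := sq x1; have := sq x2; have := sq x3; have := sq x4 => y4 y3 y2 y1.
have avg' : 2 * A * (4 * A) <= 2 * A * (x1 + x2 + x3 + x4 + 4 * (K * s ^+ 3)).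
  by rewrite ler_wpM2l// mulr_ge0.
have : eta * (4 * s ^+ 2) <= 2 * A * (4 * (K * s ^+ 3)).
  have : eta * (e1 ^+ 2 + e2 ^+ 2 + e3 ^+ 2 + e4 ^+ 2) = eta * (4 * e ^+ 2 + 4 * s ^+ 2).
    by rewrite par.
  lra.
have -> : 2 * A * (4 * (K * s ^+ 3)) = (2 * A * K * s) * (4 * s ^+ 2) by ring.
rewrite ler_pM2r ?mulr_gt0 ?exprn_gt0// leNgt => /negP; apply.
by apply: le_lt_trans sden; rewrite [s * _]mulrC ler_pM2r// lerDl.
Qed.

(** If [h] exceeded [M] inside the disc, then so small a multiple of
    [|w - z|^2] could be added to [|h|^2] that the maximum over the closed disc
    would still be interior, which [no_interior_max] excludes. *)
Lemma max_modulus h z (rho M : R) : 0 < rho -> 0 <= M ->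
  (forall w, cmod (w - z) <= rho -> jet 3 h w) ->
  (forall w, cmod (w - z) = rho -> cmod (h w) <= M) ->
  forall w, cmod (w - z) <= rho -> cmod (h w) <= M.
Proof.
move=> rho0 M0 jh bd w1 w1rho; rewrite leNgt; apply/negP => Mh.
pose eta := (cmod (h w1) ^+ 2 - M ^+ 2) / (2 * rho ^+ 2).
have diff0 : 0 < cmod (h w1) ^+ 2 - M ^+ 2.
  by rewrite subr_gt0 ltrXn2r// ?nnegrE ?cmod_ge0.
have eta0 : 0 < eta by rewrite divr_gt0// mulr_gt0 ?exprn_gt0.
pose u w := cmod (h w) ^+ 2 + eta * cmod (w - z) ^+ 2.
pose disc := [set w | cmod (w - z) <= rho].
have disc_compact : compact disc.
  apply: (@compact_closed_bounded _ _ (rho + cmod z)); first exact: closed_cmod_le.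
  move=> w wd; rewrite -[w](subrK z); apply: le_trans (cmodD _ _) _.
  by rewrite lerD2r.
have ucont : {within disc, continuous u}.
  apply: continuous_in_subspaceT => w; rewrite inE => wd.
  have ch : {for w, continuous (fun v => cmod (h v))}.
    apply: (@continuous_comp _ _ _ h (@cmod R)); last exact: cmod_continuous.
    exact: jet_continuous (jh w wd).
  have cz : {for w, continuous (fun v => cmod (v - z))}.
    apply: (@continuous_comp _ _ _ (fun v => v - z) (@cmod R)); last exact: cmod_continuous.
    by apply: (@jet_continuous R 0); apply: jetB; [exact: jet_id|exact: jet_cst].
  have uE : u = fun v => cmod (h v) * cmod (h v) + eta * (cmod (v - z) * cmod (v - z)).
    by apply/funext => v; rewrite /u !expr2.
  have FF := nbhs_filter w.
  have c1 : cmod (h v) * cmod (h v) @[v --> w] --> cmod (h w) * cmod (h w).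
    by apply: (@cvgM _ _ _ FF); exact: ch.
  have c2 : eta * (cmod (v - z) * cmod (v - z)) @[v --> w] -->
      eta * (cmod (w - z) * cmod (w - z)).
    apply: (@cvgM _ _ _ FF); first exact: (@cvg_cst _ _ _ _ FF).
    by apply: (@cvgM _ _ _ FF); exact: cz.
  rewrite uE; exact: (@cvgD _ _ _ _ FF _ _ _ _ c1 c2).
have [|w0 + w0max] := compact_EVT_max _ disc_compact ucont.
  by exists w1.
rewrite inE /= => w0d.
have uw1 : u w1 <= u w0 by apply: w0max; rewrite inE.
have w0int : cmod (w0 - z) < rho.
  rewrite lt_neqAle w0d andbT; apply/eqP => w0b.
  have := bd _ w0b; have := cmod_ge0 (h w0).
  move: uw1; rewrite /u w0b; set a := cmod (h w1) in diff0 *; set b := cmod (h w0).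
  move=> uw1 b0 bM.
  have : b ^+ 2 <= M ^+ 2 by rewrite lerXn2r ?nnegrE.
  have : eta * rho ^+ 2 = (a ^+ 2 - M ^+ 2) / 2.
    by rewrite /eta; field; rewrite gt_eqF.
  have : 0 <= eta * cmod (w1 - z) ^+ 2 by rewrite mulr_ge0 ?exprn_ge0 ?cmod_ge0// ltW.
  lra.
apply: (@no_interior_max h z w0 eta (rho - cmod (w0 - z))) => //.
- by rewrite subr_gt0.
- exact: jh.
move=> t tr; apply: w0max; rewrite inE /disc /= addrAC.
by apply: le_trans (cmodD _ _) _; rewrite -lerBrDl ltW.
Qed.

(** The Schwarz lemma: the difference quotient of [h] at [z] is again jet-like
    (one order is lost at [z]) and its modulus is at most [M / rho] on the
    circle of radius [rho]. *)
Lemma schwarz h z (rho M : R) : 0 < rho -> 0 <= M ->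
  (forall w, cmod (w - z) <= rho -> jet 4 h w) ->
  (forall w, cmod (w - z) <= rho -> cmod (h w - h z) <= M) ->
  forall w, cmod (w - z) <= rho -> cmod (h w - h z) <= M / rho * cmod (w - z).
Proof.
move=> rho0 M0 jh hM w wrho.
have jz : jet 4 h z by apply: jh; rewrite subrr cmod0 ltW.
have [p [K [r [K0 r0 r1 H]]]] := jetP jz.
have [p1 [a pE]] := poly_divX p.
have ha : h z = a.
  have := H z; rewrite subrr cmod0 => /(_ r0).
  rewrite exprS mul0r mulr0 pE !hornerE => fz.
  by apply/eqP; rewrite -subr_eq0 -cmod_eq0 eq_le fz cmod_ge0.
pose q v := if v == z then p1.[0] else (h v - h z) / (v - z).
have jq v : cmod (v - z) <= rho -> jet 3 q v.
  move=> vrho; have [->|vz] := eqVneq v z.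
    exists p1, K, r; split => // x xr; rewrite /q; have [->|xz] := eqVneq x z.
      by rewrite subrr subrr cmod0 expr0n mulr0.
    have xz0 : x - z != 0 by rewrite subr_eq0.
    have := H x xr; rewrite pE !hornerE ha => Hx.
    have -> : (h x - a) / (x - z) - p1.[x - z] =
       (h x - (p1.[x - z] * (x - z) + a)) * (x - z)^-1 by field.
    by rewrite cmodM cmodV ler_pdivrMr ?cmod_gt0// -mulrA -exprSr.
  have vz0 : v - z != 0 by rewrite subr_eq0.
  apply: (@jet_near _ _ (fun x => (h x - h z) * (x - z)^-1)).
    apply/nbhsC; exists (cmod (v - z)); first by rewrite cmod_gt0.
    move=> x xv; rewrite /q; case: eqP xv => // -> /=.
    by rewrite cmodC ltxx.
  apply: jetM.
    apply: jetB; last exact: jet_cst.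
    have [p' [K' [r' [K'0 r'0 r'1 H']]]] := jetP (jh v vrho).
    exists p', K', r'; split => // x xr; apply: le_trans (H' x xr) _.
    rewrite ler_wpM2l// exprSr ler_piMr ?exprn_ge0 ?cmod_ge0//.
    exact: le_trans (ltW xr) _.
  apply: (@jet_comp _ _ (fun x => x - z) (fun x => x^-1)).
    by apply: jetB; [exact: jet_id|exact: jet_cst].
  exact: jet_inv.
have := @max_modulus q z rho (M / rho) rho0 _ jq _ w wrho.
have Mr : 0 <= M / rho by rewrite divr_ge0// ltW.
move=> /(_ Mr) HH.
have [->|wz] := eqVneq w z; first by rewrite !subrr cmod0 mulr0.
rewrite -ler_pdivrMr ?cmod_gt0 ?subr_eq0// -cmodV -cmodM.
have := HH _; rewrite /q (negbTE wz); apply => v vrho.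
have vz : v != z.
  by apply: contra_eqT vrho => /negbNE/eqP->; rewrite subrr cmod0 lt_eqF.
rewrite (negbTE vz) cmodM cmodV vrho ler_wpM2r ?invr_ge0 ?(ltW rho0)//.
by apply: hM; rewrite vrho.
Qed.

End maximum_principle.

(** * Derivatives on an interval *)

(** Differentiability within [A] with a quadratic error. Analytic maps have it
    at every point, endpoints included, and it composes without any limit
    argument. *)
Definition sder (R : realType) (A : set R) (f : R -> R) (x d : R) :=
  exists (C r : R), 0 < r /\ forall y, A y -> `|y - x| < r ->
    `|f y - f x - d * (y - x)| <= C * (y - x) ^+ 2.

Section strong_derivative.
Variable R : realType.
Implicit Types (f g : R -> R) (A B : set R) (x y d : R).

Lemma sderP A f x d : sder A f x d -> exists (C r : R), [/\ 0 <= C, 0 < r, r <= 1 &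
  forall y, A y -> `|y - x| < r -> `|f y - f x - d * (y - x)| <= C * (y - x) ^+ 2].
Proof.
move=> [C [r [r0 H]]]; exists `|C|, (Num.min r 1); split => //.
- by rewrite lt_min r0 ltr01.
- by rewrite ge_min lexx orbT.
- move=> y Ay; rewrite lt_min => /andP[yr _]; apply: le_trans (H y Ay yr) _.
  by rewrite ler_wpM2r ?sqr_ge0 ?ler_norm.
Qed.

Lemma sder_lipat A f x d : sder A f x d -> exists (L r : R), [/\ 0 <= L, 0 < r &
  forall y, A y -> `|y - x| < r -> `|f y - f x| <= L * `|y - x|].
Proof.
move=> /sderP[C [r [C0 r0 r1 H]]]; exists (C + `|d|), r; split => //.
  by rewrite addr_ge0.
move=> y Ay yr; have := H y Ay yr.
rewrite -[(y - x) ^+ 2]real_normK ?num_real// => Hy.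
rewrite -[f y - f x](subrK (d * (y - x))) (le_trans (ler_normD _ _))//.
rewrite mulrDl lerD ?normrM// (le_trans Hy)// expr2 mulrA ler_piMr ?mulr_ge0//.
exact: le_trans (ltW yr) r1.
Qed.

Lemma sder_eq A f g x d : A x -> (forall y, A y -> f y = g y) -> sder A f x d -> sder A g x d.
Proof.
move=> Ax fg [C [r [r0 H]]]; exists C, r; split => // y Ay yr.
by rewrite -!fg// H.
Qed.

Lemma sder_cst A c x : sder A (fun=> c) x 0.
Proof.
by exists 0, 1; split => // y _ _; rewrite subrr mul0r subr0 normr0 mul0r.
Qed.

Lemma sder_id A x : sder A id x 1.
Proof. by exists 0, 1; split => // y _ _; rewrite mul1r subrr normr0 mul0r. Qed.

Lemma sderD A f g x d e : sder A f x d -> sder A g x e -> sder A (fun y => f y + g y) x (d + e).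
Proof.
move=> [C1 [r1 [r10 H1]]] [C2 [r2 [r20 H2]]].
exists (C1 + C2), (Num.min r1 r2); split; first by rewrite lt_min r10.
move=> y Ay; rewrite lt_min => /andP[yr1 yr2].
have -> : f y + g y - (f x + g x) - (d + e) * (y - x) =
  (f y - f x - d * (y - x)) + (g y - g x - e * (y - x)) by ring.
by rewrite (le_trans (ler_normD _ _))// mulrDl lerD ?H1 ?H2.
Qed.

Lemma sderM A f g x d e : sder A f x d -> sder A g x e ->
  sder A (fun y => f y * g y) x (d * g x + f x * e).
Proof.
move=> sf sg; have [L1 [s1 [L10 s10 l1]]] := sder_lipat sf.
have [L2 [s2 [L20 s20 l2]]] := sder_lipat sg.
move: sf sg => /sderP[C1 [r1 [C10 r10 _ H1]]] /sderP[C2 [r2 [C20 r20 _ H2]]].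
exists (C1 * `|g x| + `|f x| * C2 + L1 * L2), (Num.min (Num.min r1 r2) (Num.min s1 s2)).
split; first by rewrite !lt_min r10 r20 s10.
move=> y Ay; rewrite !lt_min => /andP[/andP[yr1 yr2] /andP[ys1 ys2]].
have -> : f y * g y - f x * g x - (d * g x + f x * e) * (y - x) =
  (f y - f x - d * (y - x)) * g x + f x * (g y - g x - e * (y - x)) +
  (f y - f x) * (g y - g x) by ring.
rewrite (le_trans (ler_normD _ _))// [X in _ <= X]mulrDl lerD//.
  rewrite (le_trans (ler_normD _ _))// [X in _ <= X]mulrDl !normrM lerD//.
    by rewrite mulrAC ler_wpM2r// H1.
  by rewrite -mulrA ler_wpM2l// H2.
rewrite normrM -[(y - x) ^+ 2]real_normK ?num_real// expr2 mulrACA.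
by rewrite ler_pM ?l1 ?l2.
Qed.

Lemma sderX A x n : sder A (fun y => y ^+ n) x (n%:R * x ^+ n.-1).
Proof.
elim: n => [|n IH].
  by rewrite mul0r; under [fun y => _]eq_fun do rewrite expr0; exact: sder_cst.
have := sderM (@sder_id A x) IH.
have -> : 1 * x ^+ n + x * (n%:R * x ^+ n.-1) = n.+1%:R * x ^+ n.+1.-1.
  by case: n {IH} => [|n] /=; rewrite -?natr1 ?exprS; ring.
by under [fun y => _]eq_fun do rewrite -exprS.
Qed.

Lemma sder_comp A B f g x d e : A x -> (forall y, A y -> B (f y)) ->
  sder A f x d -> sder B g (f x) e -> sder A (fun y => g (f y)) x (e * d).
Proof.
move=> Ax fAB sf; have [L1 [s1 [L10 s10 l1]]] := sder_lipat sf.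
move: sf => /sderP[C1 [r1 [C10 r10 _ H1]]] /sderP[C2 [r2 [C20 r20 _ H2]]].
exists (C2 * L1 ^+ 2 + `|e| * C1), (Num.min (Num.min r1 s1) (r2 / (L1 + 1))).
split; first by rewrite !lt_min r10 s10 divr_gt0// ltr_wpDl.
move=> y Ay; rewrite !lt_min => /andP[/andP[yr1 ys1]].
rewrite ltr_pdivlMr ?ltr_wpDl// => yr2.
have fl := l1 y Ay ys1.
have fr : `|f y - f x| < r2.
  apply: le_lt_trans yr2; rewrite mulrDr mulr1 (le_trans fl)// mulrC lerDl//.
have -> : g (f y) - g (f x) - e * d * (y - x) =
  (g (f y) - g (f x) - e * (f y - f x)) + e * (f y - f x - d * (y - x)) by ring.
rewrite (le_trans (ler_normD _ _))// [X in _ <= X]mulrDl lerD//.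
  apply: le_trans (H2 _ (fAB _ Ay) fr) _; rewrite -mulrA ler_wpM2l//.
  rewrite -[(f y - f x) ^+ 2]real_normK ?num_real//.
  rewrite -[(y - x) ^+ 2]real_normK ?num_real// -exprMn lerXn2r ?nnegrE//.
  by rewrite mulr_ge0.
by rewrite normrM -mulrA ler_wpM2l// H1.
Qed.

Lemma within_itv_proper (u v x : R) : u < v -> `[u, v]%classic x ->
  ProperFilter (within `[u, v] x^').
Proof.
move=> uv /= xuv; apply: Build_ProperFilter_ex.
move=> P; rewrite /within /= => /nbhs_ballP[e /= e0 eP].
move: xuv; rewrite in_itv /= => /andP[ux xv].
have [xv'|vx] := ltP x v.
  pose y := x + Num.min (e / 2) (v - x).
  have m0 : 0 < Num.min (e / 2) (v - x) by rewrite lt_min divr_gt0//= subr_gt0.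
  exists y; apply: (eP y).
  - rewrite /ball /= /y opprD addNKr normrN gtr0_norm// gt_min.
    by rewrite ltr_pdivrMr// ltr_pMr// ltr1n.
  - by rewrite /y -subr_eq0 addrAC subrr add0r gt_eqF.
  - rewrite in_itv /= /y (le_trans ux) ?lerDl ?(ltW m0)//=.
    by rewrite -lerBrDl ge_min lexx orbT.
have xE : x = v by apply/eqP; rewrite eq_le xv.
pose y := x - Num.min (e / 2) (v - u).
have m0 : 0 < Num.min (e / 2) (v - u) by rewrite lt_min divr_gt0//= subr_gt0.
exists y; apply: (eP y).
- rewrite /ball /= /y opprB addrCA subrr addr0 gtr0_norm// gt_min.
  by rewrite ltr_pdivrMr// ltr_pMr// ltr1n.
- by rewrite /y -subr_eq0 addrAC subrr add0r oppr_eq0 gt_eqF.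
- rewrite in_itv /= /y {2}xE gerBl ?(ltW m0) andbT// xE.
  by rewrite lerBrDr -lerBrDl ge_min lexx orbT.
Qed.

Lemma cvg_slope (A : set R) f x d :
  (forall e, 0 < e -> exists2 r, 0 < r & forall y, A y -> y != x -> `|y - x| < r ->
     `|d - slope_at f x y| <= e) ->
  slope_at f x y @[y --> within A x^'] --> d.
Proof.
move=> H; apply/cvgrPdist_le => e e0; have [r r0 rH] := H e e0.
rewrite /within /=; apply/nbhs_ballP; exists r => //= y.
rewrite /ball /= distrC => yr yx Ay; exact: rH.
Qed.

Lemma cvg_slope_deriv_in (u v : R) f x d : u < v -> `[u, v]%classic x ->
  slope_at f x y @[y --> within `[u, v] x^'] --> d -> deriv_in `[u, v] f x = d.
Proof.
move=> uv xuv H; have PF := within_itv_proper uv xuv.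
exact: (cvg_lim _ H).
Qed.

Lemma sder_deriv_in (u v : R) f x d : u < v -> `[u, v]%classic x ->
  sder `[u, v] f x d -> deriv_in `[u, v] f x = d.
Proof.
move=> uv xuv /sderP[C [r [C0 r0 _ H]]].
apply: cvg_slope_deriv_in => //; apply: cvg_slope => e e0.
exists (Num.min r (e / (C + 1))); first by rewrite lt_min r0 divr_gt0// ltr_wpDl.
move=> y Ay yx; rewrite lt_min => /andP[yr]; rewrite ltr_pdivlMr ?ltr_wpDl// => ye.
have yx0 : y - x != 0 by rewrite subr_eq0.
have -> : d - slope_at f x y = - ((f y - f x - d * (y - x)) / (y - x)).
  by rewrite /slope_at; field.
rewrite normrN normrM normfV ler_pdivrMr ?normr_gt0//.
apply: le_trans (H y Ay yr) _.
rewrite -[(y - x) ^+ 2]real_normK ?num_real// expr2 mulrA ler_wpM2r//.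
by apply: le_trans (ltW ye); rewrite mulrDr mulr1 mulrC lerDl.
Qed.

Lemma sder_is_derive (u v : R) f x d : u < x < v ->
  sder `[u, v] f x d -> is_derive x 1 f d.
Proof.
move=> /andP[ux xv] /sderP[C [r [C0 r0 _ H]]].
have cv : h^-1 *: (f (h *: 1 + x) - f x) @[h --> (0 : R)^'] --> d.
  apply/cvgrPdist_le => e e0; apply/nbhs_ballP.
  exists (Num.min (Num.min r (e / (C + 1))) (Num.min (x - u) (v - x))).
    by rewrite /= !lt_min r0 !subr_gt0 ux xv divr_gt0// ltr_wpDl.
  move=> h; rewrite /ball /= sub0r normrN !lt_min => /andP[/andP[hr he] /andP[hu hv]] h0.
  rewrite [h *: 1]mulr1.
  have Ay : `[u, v]%classic (h + x).
    rewrite /= in_itv /=; move: hu hv; rewrite !ltr_norml => /andP[h1 _] /andP[_ h2].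
    by apply/andP; split; lra.
  have := H _ Ay; rewrite addrK => /(_ hr) Hh.
  have -> : d - h^-1 *: (f (h + x) - f x) = - ((f (h + x) - f x - d * h) / h).
    by rewrite /GRing.scale /=; field.
  rewrite normrN normrM normfV ler_pdivrMr ?normr_gt0//.
  apply: le_trans Hh _; rewrite -[h ^+ 2]real_normK ?num_real// expr2 mulrA ler_wpM2r//.
  move: he; rewrite ltr_pdivlMr ?ltr_wpDl// => /ltW; apply: le_trans.
  by rewrite mulrDr mulr1 mulrC lerDl.
split; first by apply/cvg_ex; exists d.
exact: (cvg_lim _ cv).
Qed.

Lemma sder_cvg A f x d : sder A f x d -> f @ within A (nbhs x) --> f x.
Proof.
move=> /sder_lipat[L [r [L0 r0 H]]].
apply/cvgrPdist_lt => e e0; rewrite /within /=.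
apply/nbhs_ballP; exists (Num.min r (e / (L + 1))).
  by rewrite /= lt_min r0 divr_gt0// ltr_wpDl.
move=> y; rewrite /ball /= distrC lt_min => /andP[yr].
rewrite ltr_pdivlMr ?ltr_wpDl// => ye Ay.
rewrite distrC; apply: le_lt_trans (H y Ay yr) _.
by apply: le_lt_trans ye; rewrite mulrDr mulr1 mulrC lerDl.
Qed.

Lemma sder_MVT (u v : R) f (d : R -> R) (a b : R) : u <= a -> a < b -> b <= v ->
  (forall x, u <= x <= v -> sder `[u, v] f x (d x)) ->
  exists2 c, a < c < b & f b - f a = d c * (b - a).
Proof.
move=> ua ab bv sf.
have [] := @MVT R f d a b ab.
- move=> x; rewrite in_itv /= => /andP[ax xb].
  apply: (@sder_is_derive u v); last apply: sf.
    by rewrite (le_lt_trans ua ax) (lt_le_trans xb bv).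
  by rewrite (le_trans ua (ltW ax)) (le_trans (ltW xb) bv).
- apply: (@continuous_subspaceW _ _ _ `[u, v]).
    by move=> x /=; rewrite !in_itv /= => /andP[ax xb]; rewrite (le_trans ua) ?(le_trans xb).
  apply/subspace_continuousP => x /=; rewrite in_itv /= => xuv.
  exact: sder_cvg (sf x xuv).
- by move=> c; rewrite in_itv /= => cab E; exists c.
Qed.

Lemma sder_lipschitz (u v : R) f (d : R -> R) L :
  (forall x, u <= x <= v -> sder `[u, v] f x (d x)) ->
  (forall x, u <= x <= v -> `|d x| <= L) ->
  forall a b, u <= a <= v -> u <= b <= v -> `|f b - f a| <= L * `|b - a|.
Proof.
move=> sf dL.
have key a b : u <= a -> a < b -> b <= v -> `|f b - f a| <= L * `|b - a|.
  move=> ua ab bv; have [c /andP[ac cb] ->] := sder_MVT ua ab bv sf.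
  rewrite normrM ler_wpM2r// dL// (le_trans ua (ltW ac))/=.
  exact: le_trans (ltW cb) bv.
move=> a b /andP[ua av] /andP[ub bv]; have [ab|ba|->] := ltgtP a b.
- exact: key.
- by rewrite distrC [X in _ * X]distrC; exact: key.
- by rewrite !subrr normr0 mulr0.
Qed.

End strong_derivative.

Section order_of_vanishing.
Variable R : realType.

(** Otherwise the lowest term of [p], of degree less than [N], would dominate
    near [0]. *)
Lemma poly_small_dvd (K : numFieldType) (p : {poly K}) N :
  (exists (r B : K), 0 < r /\ forall x, 0 < x -> x < r -> `|p.[x]| <= B * x ^+ N) ->
  exists q : {poly K}, p = q * 'X^N.
Proof.
move=> [r [B [r0 H]]].
suff : forall n, (n <= N)%N -> exists q : {poly K}, p = q * 'X^n by exact.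
elim=> [_|n IH nN]; first by exists p; rewrite mulr1.
have [q pE] := IH (ltnW nN).
have [q1 [c qE]] : exists (q1 : {poly K}) (c : K), q = q1 * 'X + c%:P.
  by elim/poly_ind: (q) => [|p' c _]; [exists 0, 0; rewrite mul0r add0r|exists p', c].
suff c0 : c = 0 by exists q1; rewrite pE qE c0 addr0 exprS mulrA.
have [L L0 Lq] : exists2 L : K, 0 <= L & forall t, `|t| <= 1 -> `|q1.[t]| <= L.
  elim/poly_ind: (q1) => [|p' e [L L0 Lp]].
    by exists 0 => // t _; rewrite horner0 normr0.
  exists (L + `|e|); first by rewrite addr_ge0.
  move=> t t1; rewrite !hornerE (le_trans (ler_normD _ _))// lerD2r normrM.
  by rewrite -[L]mulr1 ler_pM// Lp.
have B0 : 0 <= `|B| + L by rewrite addr_ge0.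
apply/eqP; rewrite -normr_le0; apply/ler_addgt0Pr => e e0; rewrite add0r.
pose x := (r^-1 + 1 + e^-1 * (`|B| + L))^-1.
have den : 0 < r^-1 + 1 + e^-1 * (`|B| + L).
  by rewrite ltr_pwDl ?addr_gt0 ?invr_gt0// mulr_ge0// invr_ge0 ltW.
have x0 : 0 < x by rewrite invr_gt0.
have xr : x < r.
  rewrite -[r]invrK ltf_pV2 ?posrE ?invr_gt0// -addrA ltrDl.
  by rewrite ltr_pwDl// mulr_ge0// invr_ge0 ltW.
have x1 : x <= 1.
  rewrite -[1]invr1 lef_pV2 ?posrE// addrAC lerDr addr_ge0 ?invr_ge0 ?(ltW r0)//.
  by rewrite mulr_ge0// invr_ge0 ltW.
have xe : x * (`|B| + L) <= e.
  rewrite mulrC ler_pdivrMr// mulrDr mulrA mulfV ?gt_eqF// mul1r lerDr.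
  by rewrite mulr_ge0 ?addr_ge0 ?invr_ge0 ?ltW.
have hx := H x x0 xr.
have {}hx : `|q.[x]| <= `|B| * x.
  rewrite -(@ler_pM2r _ (x ^+ n)) ?exprn_gt0//.
  move: hx; rewrite pE hornerM hornerXn normrM [`|x ^+ n|]gtr0_norm ?exprn_gt0//.
  move=> /le_trans; apply.
  rewrite -mulrA -exprS.
  apply: (@le_trans _ _ (`|B| * x ^+ N)).
    have hB : 0 <= B * x ^+ N by apply: le_trans (H x x0 xr); exact: normr_ge0.
    by rewrite -[leLHS]ger0_norm// normrM [`|x ^+ N|]gtr0_norm ?exprn_gt0.
  by rewrite ler_wpM2l// ler_wiXn2l// ltW.
have -> : c = q.[x] - q1.[x] * x by rewrite qE !hornerE addrAC subrr add0r.
rewrite (le_trans (ler_normB _ _))// (le_trans _ xe)// mulrDr lerD//.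
  by rewrite mulrC.
by rewrite normrM (gtr0_norm x0) mulrC ler_wpM2l ?(ltW x0)// Lq// gtr0_norm.
Qed.

Lemma is_derive_deriv_in (f S : R -> R) x d r : 0 < r -> I11 x ->
  (forall y, `|y - x| < r -> f y = S y) -> is_derive x 1 S d ->
  deriv_in (@I11 R) f x = d.
Proof.
move=> r0 Ix fS [dS SE].
have {dS SE} cv : h^-1 *: (S (h *: 1 + x) - S x) @[h --> (0 : R)^'] --> d.
  by rewrite -SE; exact: dS.
apply: (@cvg_slope_deriv_in _ (-1) 1) => //.
apply: cvg_slope => e e0.
move/cvgrPdist_le : cv => /(_ e e0) /nbhs_ballP[s /= s0 sP].
exists (Num.min r s); first by rewrite lt_min r0.
move=> y _ yx; rewrite lt_min => /andP[yr ys].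
have := sP (y - x); rewrite /ball /= sub0r normrN ys subr_eq0 => /(_ erefl yx).
rewrite [(y - x) *: 1]mulr1 subrK /slope_at !fS//; last by rewrite subrr normr0.
by rewrite /GRing.scale /= [(y - x)^-1 * _]mulrC.
Qed.

Let coef_bounded (a : nat -> R) := exists r B : R, 0 < r /\ forall n, `|a n| * r ^+ n <= B.

Let coef_bounded_diffs a : coef_bounded a -> coef_bounded (pseries_diffs a).
Proof.
move=> [r [B [r0 aB]]]; exists (r / 2), (B / r); split; first by rewrite divr_gt0.
move=> n; rewrite /pseries_diffs normrM normr_nat expr_div_n ler_pdivlMr//.
apply: le_trans (aB n.+1).
have -> : n.+1%:R * `|a n.+1| * (r ^+ n / 2 ^+ n) * r =
  `|a n.+1| * r ^+ n.+1 * (n.+1%:R / 2 ^+ n) by rewrite exprS; ring.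
rewrite ler_piMr ?mulr_ge0 ?exprn_ge0 ?(ltW r0)//.
by rewrite ler_pdivrMr ?exprn_gt0// mul1r -natrX ler_nat ltn_expl.
Qed.

Let coef_bounded_cvg a : coef_bounded a ->
  exists2 r, 0 < r & forall x, `|x| < r -> cvgn (pseries a x).
Proof.
move=> [r [B [r0 aB]]]; exists r => // x xr.
apply: normed_cvg; apply: (@series_le_cvg _ _ (geometric B (`|x| / r))).
- by move=> n /=.
- by move=> n /=; rewrite mulr_ge0 ?exprn_ge0 ?divr_ge0 ?(ltW r0)//
    (le_trans _ (aB 0%N))// mulr_ge0 ?exprn_ge0 ?(ltW r0).
- move=> n /=; rewrite normrM normrX expr_div_n mulrA.
  by rewrite ler_pdivlMr ?exprn_gt0// mulrAC ler_wpM2r ?exprn_ge0.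
- apply: is_cvg_geometric_series; rewrite ger0_norm ?divr_ge0 ?(ltW r0)//.
  by rewrite ltr_pdivrMr// mul1r.
Qed.

Let iter_deriv_series j : forall a f, coef_bounded a ->
  (exists2 r, 0 < r & forall x, `|x| < r -> f x = limn (pseries a x)) ->
  exists2 r, 0 < r & forall x, `|x| < r ->
    iter j (deriv_in (@I11 R)) f x = limn (pseries (iter j (@pseries_diffs R) a) x).
Proof.
elim: j => [//|j IH] a f ba [r r0 fE].
rewrite [iter j.+1 _ a]iterSr [iter j.+1 _ f]iterSr.
have bd := coef_bounded_diffs ba.
have [r1 r10 c1] := coef_bounded_cvg ba.
have [r2 r20 c2] := coef_bounded_cvg bd.
have [r3 r30 c3] := coef_bounded_cvg (coef_bounded_diffs bd).
apply: IH bd _.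
pose K := Num.min 1 (Num.min r (Num.min r1 (Num.min r2 r3))) / 2.
have K0 : 0 < K by rewrite divr_gt0// !lt_min ltr01 r0 r10 r20.
have : K < Num.min 1 (Num.min r (Num.min r1 (Num.min r2 r3))).
  by rewrite /K ltr_pdivrMr// ltr_pMr ?ltr1n// !lt_min ltr01 r0 r10 r20.
rewrite !lt_min => /and5P[K1 Kr Kr1 Kr2 Kr3].
exists K => // x xK.
apply: (@is_derive_deriv_in _ (fun x => limn (pseries a x)) _ _ (K - `|x|)).
- by rewrite subr_gt0.
- by rewrite /I11 /= in_itv /= -ler_norml (le_trans (ltW xK))// ltW.
- move=> y; rewrite ltrBrDr => yx; apply: fE; apply: le_lt_trans Kr.
  by apply: le_trans (ltW yx); rewrite -[X in `|X| <= _](subrK x) ler_normD.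
- apply: (@pseries_snd_diffs _ _ K).
  + by apply: c1; rewrite gtr0_norm.
  + by apply: c2; rewrite gtr0_norm.
  + by apply: c3; rewrite gtr0_norm.
  + by rewrite [X in _ < X]gtr0_norm.
Qed.

Let iter_diffs_coef j : forall (a : nat -> R) i,
  iter j (@pseries_diffs R) a i * i`!%:R = (i + j)`!%:R * a (i + j)%N.
Proof.
elim: j => [|j IH] a i; first by rewrite addn0 mulrC.
rewrite iterS /pseries_diffs -/pseries_diffs.
rewrite mulrAC -natrM -factS mulrC IH addnS addSn //.
Qed.

(** Iterated [deriv_in] at [0] is computed by differentiating the power series
    term by term; this turns the order of the critical point, given through
    derivatives, into the nonvanishing of a coefficient. *)
Lemma iter_deriv_in_analytic (a : nat -> R) f j :
  (exists2 r : R, 0 < r & forall x, I11 x -> `|x| < r ->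
     series (fun n => a n * x ^+ n) @ \oo --> f x) ->
  iter j (deriv_in (@I11 R)) f 0 = j`!%:R * a j.
Proof.
move=> [r r0 fE].
pose r' := Num.min 1 r.
have r'0 : 0 < r' by rewrite lt_min ltr01.
have fE' x : `|x| < r' -> series (fun n => a n * x ^+ n) @ \oo --> f x.
  rewrite lt_min => /andP[x1 xr]; apply: fE => //.
  by rewrite /I11 /= in_itv /= -ler_norml ltW.
have ba : coef_bounded a.
  have h2 : `|r' / 2| < r'.
    by rewrite gtr0_norm ?divr_gt0// ltr_pdivrMr// ltr_pMr ?ltr1n.
  have [B B0 aB] := cvg_series_terms_bounded (fE' _ h2).
  exists (r' / 2), B; split; first by rewrite divr_gt0.
  move=> n; have := aB n; rewrite normrM normrX [`|r' / 2|]gtr0_norm ?divr_gt0//.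
have [|s s0 sE] := iter_deriv_series j (f := f) ba.
  by exists r' => // x xr; apply/esym; exact: (cvg_lim _ (fE' x xr)).
have := sE 0; rewrite normr0 => /(_ s0) ->.
have := iter_diffs_coef j a 0; rewrite add0n fact0 mulr1 => <-.
set b := iter j _ a; apply: cvg_lim => //.
apply: cvg_near_cst.
exists 1%N => // n /= n1; rewrite /pseries /series /=.
rewrite big_ltn// expr0 mulr1 big1_seq ?addr0// => i.
rewrite mem_index_iota => /andP[_ /andP[i1 _]].
by rewrite expr0n; case: i i1 => // i _; rewrite mulr0.
Qed.

End order_of_vanishing.

(** * Cauchy estimates and contraction of compositions *)

(** Complex counterpart of [sder]. *)
Definition cder (R : realType) (h : Cplx R -> Cplx R) (z d : Cplx R) :=
  exists (C r : R), 0 < r /\ forall w, cmod (w - z) < r ->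
    cmod (h w - h z - d * (w - z)) <= C * cmod (w - z) ^+ 2.

Section complex_derivative.
Variable R : realType.
Implicit Types (z w t d : Cplx R) (h : Cplx R -> Cplx R).

Lemma cderP h z d : cder h z d -> exists (C r : R), [/\ 0 <= C, 0 < r, r <= 1 &
  forall w, cmod (w - z) < r ->
    cmod (h w - h z - d * (w - z)) <= C * cmod (w - z) ^+ 2].
Proof.
move=> [C [r [r0 H]]]; exists `|C|, (Num.min r 1); split => //.
- by rewrite lt_min r0 ltr01.
- by rewrite ge_min lexx orbT.
- move=> y; rewrite lt_min => /andP[yr _]; apply: le_trans (H y yr) _.
  by rewrite ler_wpM2r ?exprn_ge0 ?cmod_ge0 ?ler_norm.
Qed.

Lemma jet_cder m h z : jet m.+2 h z -> exists d, cder h z d.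
Proof.
move=> /jetP[p [K [r [K0 r0 r1 H]]]].
have [p1 [a pE]] := poly_divX p.
have [p2 [b p1E]] := poly_divX p1.
have [B B0 Bp] := poly_bounded p2.
have ha : h z = a.
  have := H z; rewrite subrr cmod0 => /(_ r0).
  rewrite exprS mul0r mulr0 pE !(hornerD, hornerM, hornerX, hornerC) mulr0 add0r => fz.
  by apply/eqP; rewrite -subr_eq0 -cmod_eq0 eq_le fz cmod_ge0.
exists b, (K + B), r; split => // w wr.
have := H w wr; set t := w - z in wr *; rewrite pE p1E => Hw.
have t1 := le_trans (ltW wr) r1.
rewrite !(hornerD, hornerM, hornerX, hornerC) in Hw.
have -> : h w - h z - b * t =
   (h w - ((p2.[t] * t + b) * t + a)) + p2.[t] * t ^+ 2 by rewrite ha; ring.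
apply: le_trans (cmodD _ _) _; rewrite [X in _ <= X]mulrDl lerD//.
  apply: le_trans Hw _; rewrite ler_wpM2l// -addn2 exprD.
  by rewrite ler_piMl ?exprn_ge0 ?cmod_ge0// exprn_ile1 ?cmod_ge0.
by rewrite cmodM cmodX ler_wpM2r ?exprn_ge0 ?cmod_ge0// Bp.
Qed.

Lemma cderB h1 h2 z d1 d2 : cder h1 z d1 -> cder h2 z d2 ->
  cder (fun w => h1 w - h2 w) z (d1 - d2).
Proof.
move=> [C1 [r1 [r10 H1]]] [C2 [r2 [r20 H2]]].
exists (C1 + C2), (Num.min r1 r2); split; first by rewrite lt_min r10.
move=> w; rewrite lt_min => /andP[w1 w2].
have -> : h1 w - h2 w - (h1 z - h2 z) - (d1 - d2) * (w - z) =
  (h1 w - h1 z - d1 * (w - z)) - (h2 w - h2 z - d2 * (w - z)) by ring.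
by apply: le_trans (cmodB _ _) _; rewrite [X in _ <= X]mulrDl lerD ?H1 ?H2.
Qed.

Lemma cder_lipat h z d : cder h z d -> exists (L r : R), [/\ 0 <= L, 0 < r &
  forall w, cmod (w - z) < r -> cmod (h w - h z) <= L * cmod (w - z)].
Proof.
move=> /cderP[C [r [C0 r0 r1 H]]]; exists (C + cmod d), r; split => //.
  by rewrite addr_ge0// cmod_ge0.
move=> w wr; have Hw := H w wr.
rewrite -[h w - h z](subrK (d * (w - z))) (le_trans (cmodD _ _))//.
rewrite [X in _ <= X]mulrDl lerD ?cmodM// (le_trans Hw)// expr2 mulrA ler_piMr ?mulr_ge0 ?cmod_ge0//.
exact: le_trans (ltW wr) r1.
Qed.

Lemma cder_comp f h z d e : cder f z d -> cder h (f z) e ->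
  cder (fun w => h (f w)) z (e * d).
Proof.
move=> sf; have [L1 [s1 [L10 s10 l1]]] := cder_lipat sf.
move: sf => /cderP[C1 [r1 [C10 r10 _ H1]]] /cderP[C2 [r2 [C20 r20 _ H2]]].
exists (C2 * L1 ^+ 2 + cmod e * C1), (Num.min (Num.min r1 s1) (r2 / (L1 + 1))).
split; first by rewrite !lt_min r10 s10 divr_gt0// ltr_wpDl.
move=> w; rewrite !lt_min => /andP[/andP[wr1 ws1]].
rewrite ltr_pdivlMr ?ltr_wpDl// => wr2.
have fl := l1 w ws1.
have fr : cmod (f w - f z) < r2.
  apply: le_lt_trans wr2; rewrite mulrDr mulr1 (le_trans fl)// mulrC lerDl//.
  exact: cmod_ge0.
have -> : h (f w) - h (f z) - e * d * (w - z) =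
  (h (f w) - h (f z) - e * (f w - f z)) + e * (f w - f z - d * (w - z)) by ring.
rewrite (le_trans (cmodD _ _))// [X in _ <= X]mulrDl lerD//.
  apply: le_trans (H2 _ fr) _; rewrite -mulrA ler_wpM2l//.
  by rewrite -exprMn lerXn2r ?nnegrE ?mulr_ge0 ?cmod_ge0.
by rewrite cmodM -mulrA ler_wpM2l ?cmod_ge0// H1.
Qed.

Lemma cder_le h z d (L r : R) : 0 < r ->
  (forall w, cmod (w - z) < r -> cmod (h w - h z) <= L * cmod (w - z)) ->
  cder h z d -> cmod d <= L.
Proof.
move=> r0 hL /cderP[C [s [C0 s0 _ H]]]; apply/ler_addgt0Pr => e e0.
pose t := Num.min (Num.min r s) (e / (C + 1)) / 2.
have m0 : 0 < Num.min (Num.min r s) (e / (C + 1)).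
  by rewrite !lt_min r0 s0 divr_gt0// ltr_wpDl.
have t0 : 0 < t by rewrite divr_gt0.
have : t < Num.min (Num.min r s) (e / (C + 1)).
  by rewrite /t ltr_pdivrMr// ltr_pMr ?ltr1n.
rewrite !lt_min ltr_pdivlMr ?ltr_wpDl// => /andP[/andP[tr ts] te].
have zt : cmod (z + toC t - z) = t by rewrite addrC addKr cmod_toC gtr0_norm.
have := hL (z + toC t); have := H (z + toC t); rewrite zt => /(_ ts) h1 /(_ tr) h2.
have : cmod (d * (z + toC t - z)) <= L * t + C * t ^+ 2.
  have -> : d * (z + toC t - z) = (h (z + toC t) - h z) -
     (h (z + toC t) - h z - d * (z + toC t - z)) by ring.
  by apply: le_trans (cmodB _ _) _; rewrite lerD.
have -> : L * t + C * t ^+ 2 = (L + C * t) * t by ring.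
rewrite cmodM zt ler_pM2r// => /le_trans; apply.
by rewrite lerD2l (le_trans _ (ltW te))// mulrDr mulr1 mulrC lerDl ltW.
Qed.

Lemma cder_sder h x d :
  cder h (toC x) d ->
  sder (@I11 R) (fun y => complex.Re (h (toC y))) x (complex.Re d).
Proof.
move=> [C [r [r0 H]]]; exists C, r; split => // y _ yr.
have := H (toC y); rewrite -toCB cmod_toC => /(_ yr).
rewrite real_normK ?num_real//; apply: le_trans.
apply: le_trans (Re_le_cmod _).
rewrite le_eqVlt; apply/orP; left; apply/eqP; congr (`|_|).
by case: (h (toC y)) => a b; case: (h (toC x)) => a' b'; case: (d) => u v /=; ring.
Qed.

Section cauchy.
Variables (D : set (Cplx R)) (rho : R).
Hypothesis rho0 : 0 < rho.
Hypothesis D3 : forall x w, I11 x -> cmod (w - toC x) <= 3 * rho -> D w.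

Let schwarz_near h M x w w' : (forall v, D v -> jet 4 h v) ->
  (forall v, D v -> cmod (h v) <= M) -> I11 x -> cmod (w - toC x) <= 2 * rho ->
  cmod (w' - w) <= rho -> cmod (h w' - h w) <= 2 * M / rho * cmod (w' - w).
Proof.
move=> jh hM Ix wx w'w.
have Dv v : cmod (v - w) <= rho -> D v.
  move=> vw; apply: (D3 Ix); apply: le_trans (cmod_dist3 _ w _) _.
  by move: vw wx; set a := cmod _; set b := cmod _; lra.
have Dw : D w by apply: Dv; rewrite subrr cmod0 ltW.
have M0 : 0 <= M by apply: le_trans (hM w Dw); exact: cmod_ge0.
apply: schwarz => //.
- by rewrite mulr_ge0.
- by move=> v /Dv/jh.
- move=> v /Dv Dvv; apply: le_trans (cmodB _ _) _.
  by rewrite mulr_natl mulr2n lerD ?hM.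
Qed.

Let self x : cmod (toC x - toC x) <= 2 * rho.
Proof. by rewrite subrr cmod0 mulr_ge0// ltW. Qed.

(** The Schwarz lemma on a disc around [x] bounds difference quotients, hence
    derivatives, by the supremum of [h]: a Cauchy estimate without integrals. *)
Lemma cauchy_bound h M x d : (forall v, D v -> jet 4 h v) ->
  (forall v, D v -> cmod (h v) <= M) -> I11 x -> cder h (toC x) d ->
  cmod d <= 2 * M / rho.
Proof.
move=> jh hM Ix; apply: (cder_le rho0) => w wr.
by apply: (schwarz_near jh hM Ix) => //; exact: ltW.
Qed.

Let D_I x : I11 x -> D (toC x).
Proof. by move=> Ix; apply: (D3 Ix); rewrite subrr cmod0 mulr_ge0// ltW. Qed.

Lemma cauchy_lipschitz h M x y : (forall v, D v -> jet 4 h v) ->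
  (forall v, D v -> cmod (h v) <= M) -> I11 x -> I11 y ->
  cmod (h (toC y) - h (toC x)) <= 2 * M / rho * `|y - x|.
Proof.
move=> jh hM Ix Iy; rewrite -cmod_toC toCB.
have [xy|/ltW xy] := leP (cmod (toC y - toC x)) rho.
  exact: (schwarz_near jh hM Ix).
have M0 : 0 <= M by apply: le_trans (hM _ (D_I Ix)); exact: cmod_ge0.
apply: le_trans (cmodB _ _) _.
apply: (@le_trans _ _ (2 * M)); first by rewrite mulr_natl mulr2n lerD ?hM//; exact: D_I.
rewrite mulrAC -mulrA ler_peMr ?mulr_ge0//.
by rewrite ler_pdivlMr// mul1r.
Qed.

(** A second order Cauchy estimate: the Schwarz lemma bounds the increment
    [w |-> h (w + s) - h w] by a multiple of [s], and a second application to
    this increment bounds its variation between [x] and [y] by a multiple of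
    [s |y - x|]; dividing by [s] and letting it tend to [0] gives the claim.
    Points further apart than [rho] are covered by [cauchy_bound]. *)
Lemma cauchy_deriv_lipschitz h M x y d e : (forall v, D v -> jet 4 h v) ->
  (forall v, D v -> cmod (h v) <= M) -> I11 x -> I11 y ->
  cder h (toC x) d -> cder h (toC y) e ->
  cmod (e - d) <= 4 * M / rho ^+ 2 * `|y - x|.
Proof.
move=> jh hM Ix Iy dx ey.
have M0 : 0 <= M by apply: le_trans (hM _ (D_I Ix)); exact: cmod_ge0.
have [xy|/ltW xy] := leP `|y - x| rho; last first.
  apply: le_trans (cmodB _ _) _.
  apply: (@le_trans _ _ (2 * M / rho + 2 * M / rho)).
    by rewrite lerD ?(cauchy_bound jh hM Iy ey) ?(cauchy_bound jh hM Ix dx).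
  have -> : 4 * M / rho ^+ 2 * `|y - x| = (2 * M / rho + 2 * M / rho) * (`|y - x| / rho).
    by field; rewrite gt_eqF.
  rewrite ler_peMr ?addr_ge0 ?divr_ge0 ?mulr_ge0 ?(ltW rho0)//.
  by rewrite ler_pdivlMr// mul1r.
apply/ler_addgt0Pr => eps eps0.
move: dx ey => /cderP[C1 [r1 [C10 r10 _ H1]]] /cderP[C2 [r2 [C20 r20 _ H2]]].
have C0 : 0 < C1 + C2 + 1 by rewrite ltr_wpDl// addr_ge0.
have m0 : 0 < Num.min (Num.min r1 r2) (Num.min rho (eps / (C1 + C2 + 1))).
  by rewrite !lt_min r10 r20 rho0 divr_gt0.
pose s := Num.min (Num.min r1 r2) (Num.min rho (eps / (C1 + C2 + 1))) / 2.
have s0 : 0 < s by rewrite divr_gt0.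
have : s < Num.min (Num.min r1 r2) (Num.min rho (eps / (C1 + C2 + 1))).
  by rewrite /s ltr_pdivrMr// ltr_pMr ?ltr1n.
rewrite !lt_min ltr_pdivlMr// => /andP[/andP[sr1 sr2] /andP[/ltW srho seps]].
pose t := toC s.
have ts : cmod t = s by rewrite cmod_toC gtr0_norm.
have wt w : w + t - w = t by rewrite addrC addKr.
pose Psi w := h (w + t) - h w.
have DPsi w : cmod (w - toC x) <= rho -> D w /\ D (w + t).
  move=> wx; split; apply: (D3 Ix).
    by move: wx rho0; set a := cmod _; lra.
  rewrite addrAC; apply: le_trans (cmodD _ _) _; rewrite ts.
  by move: wx srho rho0; set a := cmod _; lra.
have jPsi w : cmod (w - toC x) <= rho -> jet 4 Psi w.
  move=> /DPsi[Dw Dwt]; apply: jetB; last exact: jh.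
  apply: (@jet_comp _ _ (fun w => w + t) h); last exact: jh.
  by apply: jetD; [exact: jet_id|exact: jet_cst].
have PsiM w : cmod (w - toC x) <= rho -> cmod (Psi w) <= 2 * M / rho * s.
  move=> wx; rewrite /Psi -[in X in _ <= X]ts -[in X in _ <= X](wt w).
  apply: (schwarz_near jh hM Ix); last by rewrite wt ts.
  by move: wx rho0; set a := cmod _; lra.
have K0 : 0 <= 2 * M / rho * s.
  apply: mulr_ge0; last exact: ltW.
  by rewrite divr_ge0 ?mulr_ge0 ?(ltW rho0).
have xself : cmod (toC x - toC x) <= rho by rewrite subrr cmod0 ltW.
have PsiL : cmod (Psi (toC y) - Psi (toC x)) <= 2 * (2 * M / rho * s) / rho * `|y - x|.
  rewrite -cmod_toC toCB.
  apply: (@schwarz _ Psi (toC x) rho (2 * (2 * M / rho * s))) => //.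
  - by rewrite mulr_ge0.
  - move=> w wx; apply: le_trans (cmodB _ _) _.
    by rewrite mulr_natl mulr2n lerD ?PsiM.
  - by rewrite -toCB cmod_toC.
have := H1 (toC x + t); rewrite wt ts => /(_ sr1) h1.
have := H2 (toC y + t); rewrite wt ts => /(_ sr2) h2.
have : cmod ((e - d) * t) <= (4 * M / rho ^+ 2 * `|y - x| + (C1 + C2) * s) * s.
  have -> : (e - d) * t = (Psi (toC y) - Psi (toC x)) +
     ((h (toC x + t) - h (toC x) - d * t) - (h (toC y + t) - h (toC y) - e * t)).
    by rewrite /Psi; ring.
  apply: le_trans (cmodD _ _) _; rewrite [X in _ <= X]mulrDl lerD//.
    apply: le_trans PsiL _; rewrite le_eqVlt; apply/orP; left; apply/eqP.
    by field; rewrite gt_eqF.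
  apply: le_trans (cmodB _ _) _.
  by rewrite -mulrA -expr2 mulrDl lerD.
rewrite cmodM ts ler_pM2r// => /le_trans; apply; rewrite lerD2l.
by apply: le_trans (ltW seps); rewrite mulrC ler_wpM2l ?(ltW s0)// lerDl.
Qed.

End cauchy.

(** Contraction by expansion: if the maps of [s] send [D] into its
    [2 delta M]-interior, then pushing each of them away from its value at the
    orbit of [z] by the factor [1 + delta] keeps the composition inside the
    bounded set [D], while multiplying its derivative at [z] by
    [(1 + delta) ^ size s]. The Schwarz lemma for the expanded composition thus
    makes the derivative of the original one exponentially small. *)
Lemma composition_expand (D : set (Cplx R)) (delta M eps : R)
    (good : (Cplx R -> Cplx R) -> Prop) :
  0 <= delta -> 2 * delta * M < eps ->
  (forall v, D v -> cmod v <= M) ->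
  (forall F, good F -> forall v, D v -> jet 4 F v) ->
  (forall F, good F -> forall v w, D v -> cmod (w - F v) < eps -> D w) ->
  (forall F, good F -> forall v, D v -> D (F v)) ->
  forall s : seq (Cplx R -> Cplx R), (forall F, List.In F s -> good F) ->
  forall z, D z -> exists Psi d,
    [/\ forall v, D v -> jet 4 Psi v, forall v, D v -> D (Psi v),
        cder (fun v => foldl (fun u F => F u) v s) z d
      & cder Psi z (toC ((1 + delta) ^+ size s) * d)].
Proof.
move=> delta0 dM DM jF marg FD; elim=> [|F s IH] gs z Dz.
  have c1 : cder id z 1.
    by exists 0, 1; split => // w _; rewrite mul1r subrr cmod0 mul0r.
  by exists id, 1; split => //; [move=> v _; exact: jet_id|rewrite expr0 mulr1].
have gF : good F by apply: gs; left.
have [|Psi [d [jPsi PsiD cs cPsi]]] := IH _ (F z) (FD _ gF _ Dz).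
  by move=> F' F's; apply: gs; right.
pose Ft w := F w + toC delta * (F w - F z).
have Ftz : Ft z = F z by rewrite /Ft subrr mulr0 addr0.
have FtD v : D v -> D (Ft v).
  move=> Dv; apply: (marg _ gF v) => //; rewrite /Ft addrC addKr cmodM cmod_toC.
  rewrite ger0_norm//; apply: le_lt_trans dM.
  rewrite [2 * delta]mulrC -mulrA ler_wpM2l//.
  apply: le_trans (cmodB _ _) _.
  by rewrite mulr_natl mulr2n lerD// DM//; exact: FD.
have jFt v : D v -> jet 4 Ft v.
  move=> Dv; have jv := jF _ gF _ Dv; apply: jetD => //.
  by apply: jetM; [exact: jet_cst|apply: jetB => //; exact: jet_cst].
have [a ca] := jet_cder (jF _ gF _ Dz).
have cFt : cder Ft z (toC (1 + delta) * a).
  move: ca => [C [r [r0 H]]]; exists ((1 + delta) * C), r; split => // w wr.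
  have -> : Ft w - Ft z - toC (1 + delta) * a * (w - z) =
    toC (1 + delta) * (F w - F z - a * (w - z)).
    by rewrite Ftz /Ft toCD toC1; ring.
  rewrite cmodM cmod_toC ger0_norm ?addr_ge0// -mulrA ler_wpM2l ?addr_ge0//.
  exact: H.
exists (fun w => Psi (Ft w)), (d * a); split.
- by move=> v Dv; apply: (@jet_comp _ 3 Ft Psi); [exact: jFt|apply: jPsi; exact: FtD].
- by move=> v Dv; apply: PsiD; exact: FtD.
- exact: (cder_comp ca cs).
- rewrite -Ftz in cPsi; have := cder_comp cFt cPsi.
  congr (cder _ _ _); rewrite /= exprS toCM; ring.
Qed.

(** The last step of the argument of [composition_expand]: the expanded
    composition maps a disc into a bounded set, so its derivative is bounded
    independently of [size s]. *)
Lemma composition_contract (D : set (Cplx R)) (delta M eps rho : R)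
    (good : (Cplx R -> Cplx R) -> Prop) :
  0 <= delta -> 2 * delta * M < eps -> 0 < rho ->
  (forall v, D v -> cmod v <= M) ->
  (forall F, good F -> forall v, D v -> jet 4 F v) ->
  (forall F, good F -> forall v w, D v -> cmod (w - F v) < eps -> D w) ->
  (forall F, good F -> forall v, D v -> D (F v)) ->
  forall s : seq (Cplx R -> Cplx R), (forall F, List.In F s -> good F) ->
  forall z, (forall w, cmod (w - z) <= rho -> D w) ->
  exists2 d, cder (fun v => foldl (fun u F => F u) v s) z d &
    cmod d <= 2 * M / rho * (1 + delta)^-1 ^+ size s.
Proof.
move=> delta0 dM rho0 DM jF marg FD s gs z Dz.
have Dzz : D z by apply: Dz; rewrite subrr cmod0 ltW.
have [Psi [d [jPsi PsiD cs cPsi]]] := composition_expand delta0 dM DM jF marg FD gs Dzz.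
have M0 : 0 <= M by apply: le_trans (DM _ Dzz); exact: cmod_ge0.
exists d => //.
have : cmod (toC ((1 + delta) ^+ size s) * d) <= 2 * M / rho.
  apply: (cder_le rho0 _ cPsi) => w wr.
  apply: schwarz => //.
  - by rewrite mulr_ge0.
  - by move=> v /Dz/jPsi.
  - move=> v /Dz Dv; apply: le_trans (cmodB _ _) _.
    by rewrite mulr_natl mulr2n lerD// DM//; exact: PsiD.
  - exact: ltW.
have d1 : 0 < 1 + delta by rewrite ltr_pwDl.
rewrite cmodM cmod_toC gtr0_norm ?exprn_gt0// mulrC -ler_pdivlMr ?exprn_gt0//.
by rewrite exprVn.
Qed.

End complex_derivative.

(** * The fixed point of the doubling operator *)

Section descent.
Variable R : realType.
Implicit Types (F : nat -> R -> R).

(** The two branches by which a renormalization interval contains its two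
    children: the central one, and its image. *)
Definition step F (b : bool) i u := if b then F i (F i 1 * u) else F i 1 * u.

(** Coordinate changes down the renormalization tower: a point with coordinate
    [u] at level [n + j] has coordinate [descend F beta n j u] at level [n]
    after the blocks of lengths [2 ^ i], for the levels [i] between [n] and
    [n + j] with [beta i], have been run. *)
Fixpoint descend F (beta : nat -> bool) n j u :=
  if j is j'.+1 then descend F beta n j' (step F (beta (n + j')%N) (n + j') u)
  else u.

End descent.

Lemma pos_lower_bound (R : realType) (a : nat -> R) N c : 0 < c ->
  (forall n, 0 < a n) -> (forall n, (N <= n)%N -> c <= a n) ->
  exists2 c', 0 < c' & forall n, c' <= a n.
Proof.
move=> c0 a0; elim: N => [|N IH] aN; first by exists c => // n; exact: aN.
elim: N c c0 aN {IH} => [|N IH] c c0 aN.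
  exists (Num.min c (a 0%N)); first by rewrite lt_min c0 a0.
  by case=> [|n]; rewrite ge_min ?lexx ?orbT// aN.
apply: (IH (Num.min c (a N.+1))); first by rewrite lt_min c0 a0.
move=> n; rewrite leq_eqVlt => /orP[/eqP <-|nN]; first by rewrite ge_min lexx orbT.
by rewrite ge_min aN.
Qed.

Section fixed_point.
Variables (R : realType) (k : nat) (g : R -> R) (G : Cplx R -> Cplx R).
Variable (D : set (Cplx R)).
Hypothesis k0 : (0 < k)%N.
Hypothesis fp : doubling_fixed_point k g G D.

Let I0 : @I11 R 0.
Proof. by rewrite /I11 /= in_itv /= lerN10 ler01. Qed.

Let Iabs (x : R) : I11 x <-> `|x| <= 1.
Proof. by rewrite /I11 /= in_itv /= ler_norml. Qed.

Lemma fp_cmod_bounded : exists2 M : R, 0 < M & forall v, D v -> cmod v <= M.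
Proof.
have [M M0 DM] := ex_strict_bound_gt0 (fp_bounded fp).
have [M' M'0 ME] := gt0_toC M0; exists M' => // v Dv.
by apply: ltW; rewrite -ltr_toC -normCE -ME; exact: DM.
Qed.

Lemma fp_closure_bounded M v : (forall v, D v -> cmod v <= M) -> closure D v -> cmod v <= M.
Proof.
move=> DM clv.
have : closed [set w : Cplx R | cmod (w - 0) <= M] by exact: closed_cmod_le.
move=> cl; have := closureS _ clv.
move=> /(_ [set w : Cplx R | cmod (w - 0) <= M]) H.
rewrite -[v]subr0; apply: (cl v); apply: closureS clv => w Dw /=.
by rewrite subr0 DM.
Qed.

Lemma fp_compact : compact (closure D).
Proof.
have [M _ DM] := fp_cmod_bounded.
by apply: (@compact_closed_bounded _ _ M) => [|v]; [exact: closed_closure|exact: fp_closure_bounded].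
Qed.

Lemma continuous_closure_bounded (h : Cplx R -> Cplx R) :
  {within closure D, continuous h} ->
  exists2 M : R, 0 <= M & forall v, closure D v -> cmod (h v) <= M.
Proof.
move=> ch.
have cc : {within closure D, continuous (fun v => cmod (h v))}.
  by move=> x; apply: (@continuous_comp (subspace (closure D)) _ _ h (@cmod R));
    [exact: ch|exact: cmod_continuous].
have [|w _ wM] := compact_EVT_max _ fp_compact cc.
  by exists 0; apply: subset_closure; exact: (fp_I fp I0).
exists (cmod (h w)); first exact: cmod_ge0.
by move=> v Dv; apply: wM; rewrite inE.
Qed.

(** The factor [3] leaves room for the two nested discs of the second order
    Cauchy estimate. *)
Lemma fp_margin_I : exists2 rho : R, 0 < rho &
  forall x w, I11 x -> cmod (w - toC x) <= 3 * rho -> D w.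
Proof.
pose K : set (Cplx R) := [set toC x | x in @I11 R].
have cK : compact K.
  apply: continuous_compact; last exact: segment_compact.
  apply: continuous_subspaceT => x; apply/(cvgC _ _ (nbhs_filter x)) => e e0.
  apply/nbhs_ballP; exists e => // y; rewrite /ball /= distrC => yx.
  by rewrite -toCB cmod_toC.
have [|e e0 eD] := compact_margin cK (fp_open fp).
  by move=> _ [x Ix <-]; exact: (fp_I fp).
exists (e / 4); first by rewrite divr_gt0.
move=> x w Ix wx; apply: (eD (toC x)); first by exists x.
by apply: le_lt_trans wx _; lra.
Qed.

Lemma fp_margin (h : Cplx R -> Cplx R) : closure [set h z | z in D] `<=` D ->
  exists2 e : R, 0 < e & forall z w, D z -> cmod (w - h z) < e -> D w.
Proof.
move=> hD; have [M _ DM] := fp_cmod_bounded.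
have cK : compact (closure [set h z | z in D]).
  apply: (@compact_closed_bounded _ _ M); first exact: closed_closure.
  by move=> z /hD/DM.
have [e e0 eD] := compact_margin cK (fp_open fp) hD.
exists e => // z w Dz; apply: eD; apply: subset_closure; by exists z.
Qed.

(** The even order [2 k] of the critical point is read off from the form
    [g x = phi (x ^ (2 k))] on the real axis, and passes to [G] through its
    Taylor polynomial at [0]. *)
Lemma fp_factor : exists Gh : Cplx R -> Cplx R,
  (forall v, D v -> jet 4 Gh v) /\ forall v, D v -> G v = 1 + v ^+ (2 * k) * Gh v.
Proof.
have D0 : D 0 by exact: (fp_I fp I0).
have [p [K [r [K00 r0 r1 H]]]] := jetP (analytic_jet (2 * k + 4) (fp_open fp) (fp_analytic fp) D0).
have g0 : g 0 = 1 := renorm_crit (fp_renorm fp).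
have G0 : G 0 = 1 by have := fp_extends fp I0; rewrite g0.
have [phi [aphi gphi]] := fp_form fp.
have [|c [s' [s'0 Hs]]] := aphi 0; first by rewrite /= in_itv /= lexx ler01.
pose s := Num.min s' 1 / 2.
have m0 : 0 < Num.min s' 1 by rewrite lt_min s'0 ltr01.
have s0 : 0 < s by rewrite divr_gt0.
have : s < Num.min s' 1 by rewrite /s ltr_pdivrMr// ltr_pMr ?ltr1n.
rewrite lt_min => /andP[ss' s1].
have ser x : 0 <= x -> x <= s -> series (fun n => c n * x ^+ n) @ \oo --> phi x.
  move=> x0 xs; have := Hs x; rewrite subr0; apply.
    by rewrite /= in_itv /= x0 (le_trans xs (ltW s1)).
  by rewrite ger0_norm// (le_lt_trans xs).
have [B B0 HB] := series_taylor 1 (lt0r_neq0 s0) (ser s (ltW s0) (lexx s)).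
have phi0 : phi 0 = 1.
  have k20 : (2 * k)%N != 0%N by rewrite muln_eq0 /= -lt0n.
  by have := gphi 0 I0; rewrite g0 expr0n (negbTE k20).
have phiB x : 0 <= x -> x <= s / 2 -> `|phi x - 1| <= B * x.
  move=> x0 xs; have xss : x <= s by apply: le_trans xs _; rewrite ler_pdivrMr// ler_pMr ?ler1n.
  have := HB 0 (phi 0); have := HB x (phi x).
  rewrite !big_ord1 !expr0 !mulr1 normr0 ger0_norm// (gtr0_norm s0) expr1 => h1.
  move=> /(_ _ (ser 0 (lexx 0) (ltW s0))); rewrite mulr0 divr_ge0 ?(ltW s0)// phi0.
  move=> /(_ erefl); rewrite normr_le0 subr_eq0 => /eqP ->.
  by apply: h1 => //; exact: ser.
have pE : exists q : {poly Cplx R}, p - 1 = q * 'X^(2 * k).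
  apply: poly_small_dvd.
  pose e := Num.min r (s / 2); have e0 : 0 < e by rewrite lt_min r0 divr_gt0.
  exists (toC e), (toC (K + B)); split; first by rewrite -toC0 ltr_toC.
  move=> z /gt0_toC[x x0 ->]; rewrite ltr_toC lt_min => /andP[xr xs].
  have x1 : x <= 1 by rewrite (le_trans (ltW xr)).
  have Ix : I11 x by apply/Iabs; rewrite gtr0_norm.
  have e2 : (2 * k + 4 = 2 * k + 4)%N by [].
  rewrite normCE -toCX -toCM ler_toC hornerD hornerN hornerC.
  have := H (toC x); rewrite subr0 cmod_toC gtr0_norm// => /(_ xr) Hx.
  have -> : p.[toC x] - 1 = - (G (toC x) - p.[toC x]) + (G (toC x) - 1) by ring.
  apply: le_trans (cmodD _ _) _; rewrite cmodN [X in _ <= X]mulrDl lerD//.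
    apply: le_trans Hx _; rewrite ler_wpM2l// exprD ler_piMr ?exprn_ge0 ?(ltW x0)//.
    by rewrite exprn_ile1// ltW.
  rewrite (fp_extends fp Ix) -toC1 -toCB cmod_toC gphi//; apply: phiB.
    by rewrite exprn_ge0// ltW.
  apply: le_trans (ltW xs); rewrite -[X in _ <= X]expr1 ler_wiXn2l ?(ltW x0)//.
  by rewrite muln_gt0.
have [q pq] := pE.
exists (fun z => if z == 0 then q.[0] else (G z - 1) * z^-1 ^+ (2 * k)); split; last first.
  move=> v Dv; case: eqP => [->|/eqP v0].
    by rewrite G0 expr0n muln_eq0 /= eqn0Ngt k0 /= mul0r addr0.
  by rewrite mulrCA exprVn mulfV ?expf_neq0// mulr1 addrC subrK.
move=> v Dv; have [->|v0] := eqVneq v 0.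
  exists q, K, r; split => // w; rewrite subr0 => wr.
  have [->|w0] := eqVneq w 0; first by rewrite subrr !cmod0 expr0n mulr0.
  have := H w; rewrite subr0 => /(_ wr) Hw.
  have qE : q.[w] = (p.[w] - 1) * w^-1 ^+ (2 * k).
    have -> : p.[w] - 1 = (p - 1).[w] by rewrite hornerD hornerN hornerC.
    by rewrite pq hornerM hornerXn -mulrA exprVn mulfV ?expf_neq0// mulr1.
  rewrite qE -mulrBl.
  have -> : G w - 1 - (p.[w] - 1) = G w - p.[w] by ring.
  rewrite cmodM exprVn cmodV cmodX ler_pdivrMr ?exprn_gt0 ?cmod_gt0//.
  by rewrite -mulrA -exprD addnC.
apply: (@jet_near _ _ (fun z => (G z - 1) * z^-1 ^+ (2 * k))).
  apply/nbhsC; exists (cmod v); first by rewrite cmod_gt0.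
  by move=> w; have [->|//] := eqVneq w 0; rewrite sub0r cmodN ltxx.
apply: jetM.
  apply: jetB; last exact: jet_cst.
  exact: (analytic_jet _ (fp_open fp) (fp_analytic fp)).
by apply: jetX; exact: jet_inv.
Qed.

(** Were [gh 0 = 0], the Taylor polynomial of [g - 1] of degree [2 k] would be
    [O(x^(2k+1))], and the derivative of order [2 k] would vanish at [0]. *)
Lemma fp_leading_coef (gh : R -> R) L : (forall x, I11 x -> g x = 1 + x ^+ (2 * k) * gh x) ->
  (forall x, I11 x -> `|gh x - gh 0| <= L * `|x - 0|) -> gh 0 != 0.
Proof.
move=> gE ghL; apply/eqP => gh0.
have [a [r [r0 Ha]]] := renorm_analytic (fp_renorm fp) I0.
have ord := fp_order fp.
have aE : iter (2 * k) (deriv_in (@I11 R)) g 0 = (2 * k)`!%:R * a (2 * k)%N.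
  apply: iter_deriv_in_analytic; exists r => // x Ix xr.
  by have := Ha x Ix; rewrite subr0; apply.
have : a (2 * k)%N != 0 by move: ord; rewrite aE mulf_eq0 negb_or => /andP[].
move/eqP; apply.
pose s := Num.min r 1 / 2.
have m0 : 0 < Num.min r 1 by rewrite lt_min r0 ltr01.
have s0 : 0 < s by rewrite divr_gt0.
have : s < Num.min r 1 by rewrite /s ltr_pdivrMr// ltr_pMr ?ltr1n.
rewrite lt_min => /andP[ss' s1].
have ser x : `|x| <= s -> series (fun n => a n * x ^+ n) @ \oo --> g x.
  move=> xs; have := Ha x; rewrite subr0; apply.
    by apply/Iabs; rewrite (le_trans xs (ltW s1)).
  by rewrite (le_lt_trans xs).
have hs : `|s| <= s by rewrite gtr0_norm.
have [B B0 HB] := series_taylor (2 * k).+1 (lt0r_neq0 s0) (ser s hs).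
have : exists q : {poly R}, \poly_(n < (2 * k).+1) a n - 1 = q * 'X^((2 * k).+1).
  apply: poly_small_dvd; exists (s / 2), (B + L); split; first by rewrite divr_gt0.
  move=> x x0 xs.
  have xss : `|x| <= s.
    by rewrite gtr0_norm// (le_trans (ltW xs))// ler_pdivrMr// ler_pMr ?ler1n.
  have := HB x (g x) _ (ser x xss); rewrite (gtr0_norm s0) (gtr0_norm x0) => /(_ (ltW xs)).
  have Ix : I11 x by apply/Iabs; exact: le_trans xss (ltW s1).
  have := ghL x Ix; rewrite gh0 !subr0 (gtr0_norm x0) => hL hB.
  rewrite hornerD hornerN hornerC horner_poly.
  have -> : \sum_(i < (2 * k).+1) a i * x ^+ i - 1 =
     - (g x - \sum_(i < (2 * k).+1) a i * x ^+ i) + x ^+ (2 * k) * gh x.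
    by rewrite (gE x Ix); ring.
  apply: le_trans (ler_normD _ _) _; rewrite normrN [X in _ <= X]mulrDl lerD//.
  by rewrite normrM (gtr0_norm (exprn_gt0 _ x0)) mulrC exprS mulrA ler_wpM2r// exprn_ge0// ltW.
move=> [q /(congr1 (fun p : {poly R} => p`_(2 * k)))].
rewrite coefB coef_poly ltnSn coef1 muln_eq0 /= eqn0Ngt k0 /= subr0 => ->.
by rewrite coefMXn ltnSn.
Qed.

End fixed_point.

(** * Uniform estimates along the stable manifold *)

Lemma geometric_small (R : realType) (M q e : R) : 0 <= q < 1 -> 0 < e ->
  exists N, forall n, (N <= n)%N -> M * q ^+ n <= e.
Proof.
move=> /andP[q0 q1] e0.
have /cvgrPdist_le/(_ e e0)[N _ NP] : geometric M q @ \oo --> 0.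
  by apply: cvg_geometric; rewrite ger0_norm.
exists N => n Nn; have := NP n Nn; rewrite /= sub0r normrN.
by apply: le_trans; exact: ler_norm.
Qed.

Section stable_manifold_estimates.
Variables (R : realType) (k : nat) (g : R -> R) (G : Cplx R -> Cplx R).
Variables (D : set (Cplx R)) (omega : R) (f : R -> R).
Hypothesis k0 : (0 < k)%N.
Hypothesis fp : doubling_fixed_point k g G D.
Hypothesis omega01 : 0 < omega < 1.
Hypothesis f_Ws : stable_manifold k G D omega f.

Let fn n := iter n (@Tdoubling R) f.

Let Iabs (x : R) : I11 x <-> `|x| <= 1.
Proof. by rewrite /I11 /= in_itv /= ler_norml. Qed.

Let D_I x : I11 x -> D (toC x). Proof. exact: (fp_I fp). Qed.

Lemma stable_continuations : exists (F Fh : nat -> Cplx R -> Cplx R) (M : R),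
  0 <= M /\ forall n, [/\ renormalizable (fn n),
    analytic_on D (Fh n) /\ {within closure D, continuous (Fh n)},
    forall v, closure D v -> F n v = 1 + v ^+ (2 * k) * Fh n v,
    extends (F n) (fn n)
  & forall v, closure D v -> cmod (F n v - G v) <= M * omega ^+ n].
Proof.
have [M HM] := f_Ws.
have om0 : 0 < omega by case/andP: omega01.
have : forall n, exists p : (Cplx R -> Cplx R) * (Cplx R -> Cplx R),
  [/\ analytic_on D p.2 /\ {within closure D, continuous p.2},
    forall v, closure D v -> p.1 v = 1 + v ^+ (2 * k) * p.2 v,
    extends p.1 (fn n)
  & forall v, closure D v -> cmod (p.1 v - G v) <= `|M| * omega ^+ n].
  move=> n; have [_ [F [[Fh [aFh cFh FE]] eF dF]]] := HM n.
  exists (F, Fh); split => // v Dv.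
  rewrite -lee_fin; apply: le_trans (_ : ((M * omega ^+ n)%:E <= _)%E).
    apply: le_trans dF; apply: ereal_sup_ubound; exists v => //.
  by rewrite lee_fin ler_wpM2r ?exprn_ge0 ?(ltW om0)// ler_norm.
move=> /choice[p Hp]; exists (fun n => (p n).1), (fun n => (p n).2), `|M|.
split => // n; have [h1 h2 h3 h4] := Hp n; split => //.
by have [] := HM n.
Qed.

Let cd (h : Cplx R -> Cplx R) (x : R) : Cplx R := xget 0 [set d | cder h (toC x) d].

Let cdP h x : (forall v, D v -> jet 4 h v) -> I11 x -> cder h (toC x) (cd h x).
Proof.
move=> jh /D_I/jh/jet_cder[d hd]; rewrite /cd; case: xgetP => [y _ //|/(_ d)].
by move/(_ hd).
Qed.

Let rh (h : Cplx R -> Cplx R) (x : R) : R := complex.Re (h (toC x)).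
Let rd (h : Cplx R -> Cplx R) (x : R) : R := complex.Re (cd h x).

Let Re_sub (z w : Cplx R) : complex.Re z - complex.Re w = complex.Re (z - w).
Proof. by case: z; case: w. Qed.

Let phi (h : Cplx R -> Cplx R) x := (2 * k)%:R * rh h x + x * rd h x.

Let phi_lipschitz M : exists2 K : R, 0 <= K & forall h,
  (forall v, D v -> jet 4 h v) -> (forall v, D v -> cmod (h v) <= M) ->
  forall x y, I11 x -> I11 y -> `|rh h y - rh h x| <= K * `|y - x| /\
   `|phi h x| <= K /\ `|phi h y - phi h x| <= K * `|y - x|.
Proof.
have [rho rho0 D3] := fp_margin_I fp.
pose a := 2 * `|M| / rho; pose b := 4 * `|M| / rho ^+ 2.
have a0 : 0 <= a by rewrite divr_ge0 ?mulr_ge0 ?(ltW rho0).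
have b0 : 0 <= b by rewrite divr_ge0 ?mulr_ge0 ?exprn_ge0 ?(ltW rho0).
pose m : R := (2 * k)%:R; have m0 : 0 <= m by exact: ler0n.
have ma0 := mulr_ge0 m0 a0; have mM0 := mulr_ge0 m0 (normr_ge0 M).
exists (a + m * `|M| + (m * a + a + b)); first by move: ma0 mM0 a0 b0; lra.
move=> h jh hM x y Ix Iy.
have hM' v : D v -> cmod (h v) <= `|M|.
  by move=> Dv; apply: le_trans (hM v Dv) _; exact: ler_norm.
have hlip : `|rh h y - rh h x| <= a * `|y - x|.
  rewrite /rh Re_sub; apply: le_trans (Re_le_cmod _) _.
  exact: (cauchy_lipschitz rho0 D3 jh hM').
have dlip : `|rd h y - rd h x| <= b * `|y - x|.
  rewrite /rd Re_sub; apply: le_trans (Re_le_cmod _) _.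
  exact: (cauchy_deriv_lipschitz rho0 D3 jh hM' Ix Iy (cdP jh Ix) (cdP jh Iy)).
have hb : `|rh h x| <= `|M|.
  by apply: le_trans (Re_le_cmod _) _; apply: hM'; exact: D_I.
have db z : I11 z -> `|rd h z| <= a.
  move=> Iz; apply: le_trans (Re_le_cmod _) _.
  exact: (cauchy_bound rho0 D3 jh hM' Iz (cdP jh Iz)).
have yx0 := normr_ge0 (y - x).
have M0 := normr_ge0 M.
split; [|split].
- apply: le_trans hlip _; rewrite ler_wpM2r//.
  by move: ma0 mM0 a0 b0; lra.
- apply: le_trans (ler_normD _ _) _; rewrite !normrM normr_nat -/m.
  have h1 : m * `|rh h x| <= m * `|M| by rewrite ler_wpM2l.
  have h2 : `|x| * `|rd h x| <= a.
    by rewrite -[a]mul1r ler_pM//; [apply/Iabs|exact: db].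
  by move: h1 h2 ma0 mM0 a0 b0; set t1 := m * `|rh _ _|; lra.
- have -> : phi h y - phi h x = m * (rh h y - rh h x) +
     ((y - x) * rd h y + x * (rd h y - rd h x)) by rewrite /phi -/m; ring.
  apply: le_trans (ler_normD _ _) _.
  have h1 : `|m * (rh h y - rh h x)| <= m * a * `|y - x|.
    by rewrite normrM normr_nat -/m -mulrA ler_wpM2l.
  have h2 : `|(y - x) * rd h y + x * (rd h y - rd h x)| <= a * `|y - x| + b * `|y - x|.
    apply: le_trans (ler_normD _ _) _; rewrite !normrM lerD//.
      by rewrite mulrC ler_wpM2r// db.
    by rewrite -[X in _ <= X]mul1r ler_pM//; apply/Iabs.
  have h3 := mulr_ge0 a0 yx0; have h4 := mulr_ge0 mM0 yx0.
  by lra.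
Qed.

Let phi_dist : exists2 K : R, 0 <= K & forall h1 h2 e,
  (forall v, D v -> jet 4 h1 v) -> (forall v, D v -> jet 4 h2 v) ->
  (forall v, D v -> cmod (h1 v - h2 v) <= e) ->
  forall x, I11 x -> `|phi h1 x - phi h2 x| <= K * e.
Proof.
have [rho rho0 D3] := fp_margin_I fp.
pose m : R := (2 * k)%:R; have m0 : 0 <= m by exact: ler0n.
exists (m + 2 / rho); first by rewrite addr_ge0// divr_ge0// ltW.
move=> h1 h2 e j1 j2 h12 x Ix.
have jB v : D v -> jet 4 (fun w => h1 w - h2 w) v.
  by move=> Dv; apply: jetB; [exact: j1|exact: j2].
have hb : `|rh h1 x - rh h2 x| <= e.
  rewrite /rh Re_sub; apply: le_trans (Re_le_cmod _) _; apply: h12; exact: D_I.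
have db : `|rd h1 x - rd h2 x| <= 2 / rho * e.
  rewrite /rd Re_sub; apply: le_trans (Re_le_cmod _) _; rewrite mulrAC.
  exact: (cauchy_bound rho0 D3 jB h12 Ix (cderB (cdP j1 Ix) (cdP j2 Ix))).
have -> : phi h1 x - phi h2 x = m * (rh h1 x - rh h2 x) + x * (rd h1 x - rd h2 x).
  by rewrite /phi -/m; ring.
apply: le_trans (ler_normD _ _) _; rewrite !normrM normr_nat -/m mulrDl lerD//.
  by rewrite ler_wpM2l.
by rewrite -[X in _ <= X]mul1r ler_pM//; apply/Iabs.
Qed.

Let factor_sder (q : R -> R) h : (forall v, D v -> jet 4 h v) ->
  (forall x, I11 x -> q x = 1 + x ^+ (2 * k) * rh h x) ->
  forall x, I11 x -> sder (@I11 R) q x (x ^+ (2 * k).-1 * phi h x).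
Proof.
move=> jh qE x Ix.
apply: (@sder_eq _ _ (fun y => 1 + y ^+ (2 * k) * rh h y)) => //.
  by move=> y Iy; rewrite qE.
have s2 := sderM (@sderX R (@I11 R) x (2 * k)) (cder_sder (cdP jh Ix)).
have := sderD (@sder_cst R (@I11 R) 1 x) s2.
congr (sder _ _ _ _); rewrite add0r /phi -/(rh h x) -/(rd h x).
have : (0 < 2 * k)%N by rewrite muln_gt0.
case: (2 * k)%N => // m _; rewrite exprS /=; ring.
Qed.

(** All that the dynamics on the real line needs from complex analysis. Near the
    fixed point the renormalizations share uniform bounds: each [fn n] is [1 +
    x^(2k) fh n x], its derivative is [x^(2k-1) ph n x] with [ph n] uniformly
    Lipschitz and, from some level on, uniformly away from [0], and the branches
    of the renormalization tower contract exponentially. Here [fh n] and [fd n]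
    are the real parts of the holomorphic factor and of its derivative. *)
Lemma stable_estimates : exists (fh fd : nat -> R -> R) (K c A theta lam0 : R) (m0 : nat),
  let ph n x := (2 * k)%:R * fh n x + x * fd n x in
  [/\ [/\ 0 < c, 0 <= A, 0 < theta < 1 & 0 < lam0],
    forall n x, I11 x -> fn n x = 1 + x ^+ (2 * k) * fh n x /\
      sder (@I11 R) (fn n) x (x ^+ (2 * k).-1 * ph n x),
    forall n x y, I11 x -> I11 y ->
      `|ph n x| <= K /\ `|ph n y - ph n x| <= K * `|y - x|
  & [/\ forall n x, (m0 <= n)%N -> I11 x -> c <= `|ph n x|,
      forall n, lam0 <= `|fn n 1|
    & forall beta n j u u', (m0 <= n)%N -> I11 u -> I11 u' ->
      `|descend fn beta n j u - descend fn beta n j u'| <= A * theta ^+ j]].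
Proof.
have [F [Fh [M [M0 HF]]]] := stable_continuations.
have om0 : 0 < omega by case/andP: omega01.
have omn n : omega ^+ n <= 1.
  by rewrite exprn_ile1 ?(ltW om0)//; case/andP: omega01 => _ /ltW.
have om01 : 0 <= omega < 1 by case/andP: omega01 => _ ->; rewrite ltW.
have [Gh [jGh GE]] := fp_factor k0 fp.
have Dcl v : D v -> closure D v by exact: subset_closure.
have jFh n v : D v -> jet 4 (Fh n) v.
  by have [_ [aF _] _ _ _] := HF n; exact: (analytic_jet _ (fp_open fp) aF).
have jF n v : D v -> jet 4 (F n) v.
  move=> Dv; apply: (@jet_near _ _ (fun w => 1 + w ^+ (2 * k) * Fh n w)).
    have : nbhs v D by rewrite nbhsE/=; exists D => //; split => //; exact: (fp_open fp).
    by apply: filterS => w Dw; have [_ _ FE _ _] := HF n; rewrite FE//; exact: Dcl.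
  apply: jetD; first exact: jet_cst.
  by apply: jetM; [apply: jetX; exact: jet_id|exact: jFh].
have [rho rho0 D3] := fp_margin_I fp.
have I0 : @I11 R 0 by apply/Iabs; rewrite normr0.
have I1 : @I11 R 1 by apply/Iabs; rewrite normr1.
(* the factor z^(2k) is divided out by the maximum principle near 0 *)
pose C0 := M / rho ^+ (2 * k).
have C00 : 0 <= C0 by rewrite divr_ge0 ?exprn_ge0 ?(ltW rho0).
have dFG n v : D v -> cmod (Fh n v - Gh v) <= C0 * omega ^+ n.
  have far w : D w -> rho <= cmod w -> cmod (Fh n w - Gh w) <= C0 * omega ^+ n.
    move=> Dw rw; have w0 : 0 < cmod w ^+ (2 * k).
      by rewrite exprn_gt0// (lt_le_trans rho0).
    have [_ _ FE _ dF] := HF n.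
    have := dF w (Dcl _ Dw); rewrite FE ?GE//; last exact: Dcl.
    rewrite opprD addrACA subrr add0r -mulrBr cmodM cmodX mulrC.
    rewrite -ler_pdivlMr// => /le_trans; apply.
    rewrite /C0 -mulrA -mulrA ler_wpM2l// mulrC ler_wpM2r ?exprn_ge0 ?(ltW om0)//.
    rewrite lef_pV2 ?posrE ?exprn_gt0//; first by rewrite lerXn2r ?nnegrE ?(ltW rho0) ?cmod_ge0.
    exact: (lt_le_trans rho0).
  move=> Dv; have [/far|/ltW vr] := leP rho (cmod v); first exact.
  have disc w : cmod (w - 0) <= rho -> D w.
    move=> wr; apply: (D3 0 w I0); apply: le_trans wr _; lra.
  apply: (@max_modulus R (fun w => Fh n w - Gh w) 0 rho) => //.
  - by rewrite mulr_ge0 ?exprn_ge0 ?(ltW om0).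
  - move=> w /disc Dw.
    have [p [K [r [K0 r0 r1 H]]]] := jetP (jetB (jFh n w Dw) (jGh w Dw)).
    exists p, K, r; split=> // x xr; apply: le_trans (H x xr) _.
    rewrite ler_wpM2l// exprSr ler_piMr ?exprn_ge0 ?cmod_ge0//.
    exact: le_trans (ltW xr) _.
  - move=> w wr; apply: far; first by apply: disc; rewrite wr.
    by rewrite -[w]subr0 wr.
  - by rewrite subr0.
have [B0 B00 Fh0B] : exists2 B, 0 <= B & forall v, closure D v -> cmod (Fh 0%N v) <= B.
  by have [_ [_ cF] _ _ _] := HF 0%N; exact: (continuous_closure_bounded fp cF).
have GhB v : D v -> cmod (Gh v) <= B0 + C0.
  move=> Dv; have -> : Gh v = Fh 0%N v - (Fh 0%N v - Gh v) by ring.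
  apply: le_trans (cmodB _ _) _; rewrite lerD ?Fh0B//; first exact: Dcl.
  by apply: le_trans (dFG _ _ Dv) _; rewrite expr0 mulr1.
have FhB n v : D v -> cmod (Fh n v) <= B0 + C0 + C0.
  move=> Dv; rewrite -[Fh n v](subrK (Gh v)) addrC.
  apply: le_trans (cmodD _ _) _; rewrite lerD ?GhB//.
  by apply: le_trans (dFG _ _ Dv) _; rewrite ler_piMr.
have GhB' v : D v -> cmod (Gh v) <= B0 + C0 + C0.
  by move=> Dv; apply: le_trans (GhB v Dv) _; rewrite lerDl.
have [K K0 HK] := phi_lipschitz (B0 + C0 + C0).
have [K' K'0 HK'] := phi_dist.
have fnE n x : I11 x -> fn n x = 1 + x ^+ (2 * k) * rh (Fh n) x.
  move=> Ix; have [_ _ FE eF _] := HF n.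
  have := FE (toC x) (Dcl _ (D_I Ix)); rewrite (eF x Ix) => /(congr1 (@complex.Re R)) /= ->.
  rewrite /rh -toCX; case: (Fh n (toC x)) => p q /=; ring.
have gE x : I11 x -> g x = 1 + x ^+ (2 * k) * rh Gh x.
  move=> Ix; have := GE (toC x) (D_I Ix).
  rewrite (fp_extends fp Ix) => /(congr1 (@complex.Re R)) /= ->.
  rewrite /rh -toCX; case: (Gh (toC x)) => p q /=; ring.
have phiG_neq0 x : I11 x -> phi Gh x != 0.
  move=> Ix; have [->|x0] := eqVneq x 0.
    rewrite /phi mul0r addr0 mulf_neq0 ?pnatr_eq0 ?muln_eq0 /= -?lt0n//.
    apply: (@fp_leading_coef _ _ _ _ _ k0 fp (rh Gh) K gE) => y Iy.
    by have [] := HK Gh jGh GhB' 0 y I0 Iy.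
  have := renorm_mono (fp_renorm fp) Ix x0.
  have -> : deriv_in (@I11 R) g x = x ^+ (2 * k).-1 * phi Gh x.
    apply: (@sder_deriv_in _ (-1) 1) => //.
    exact: factor_sder jGh gE x Ix.
  by apply: contraTneq => ->; rewrite !mulr0 ltxx.
have [c1 c10 phiGc] : exists2 c, 0 < c & forall x, I11 x -> c <= `|phi Gh x|.
  have cphi : {within @I11 R, continuous (fun x => `|phi Gh x|)}.
    apply/subspace_continuousP => x Ix; apply/cvgrPdist_lt => e e0.
    apply/nbhs_ballP; exists (e / (K + 1)); first by rewrite /= divr_gt0// ltr_wpDl.
    move=> y; rewrite /ball /= ltr_pdivlMr ?ltr_wpDl// => yx Iy.
    apply: le_lt_trans yx; apply: le_trans (ler_dist_dist _ _) _.
    have [_ [_]] := HK Gh jGh GhB' y x Iy Ix => /le_trans; apply.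
    by rewrite mulrC ler_wpM2l// lerDl.
  have [|x + xmin] := compact_EVT_min _ (@segment_compact R (-1) 1) cphi.
    by exists 0.
  rewrite inE => Ix; exists `|phi Gh x|; first by rewrite normr_gt0 phiG_neq0.
  by move=> y Iy; apply: xmin; rewrite inE.
(* uniform closeness to [g] gives [ph n] the lower bound of its limit *)
have [m1 Hm1] : exists N, forall n, (N <= n)%N -> K' * C0 * omega ^+ n <= c1 / 2.
  by apply: geometric_small => //; rewrite divr_gt0.
have lamd n : `|fn n 1 - g 1| <= M * omega ^+ n.
  have [_ _ _ eF dF] := HF n; have := dF (toC 1) (Dcl _ (D_I I1)).
  by rewrite (eF 1 I1) (fp_extends fp I1) -toCB cmod_toC.
have lam_gt0 n : 0 < `|fn n 1|.
  by have [[_ _ _ _ _ _ /andP[]]] := HF n.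
have g1_gt0 : 0 < `|g 1| by have [_ _ _ _ _ _ /andP[]] := fp_renorm fp.
have [m2 Hm2] : exists N, forall n, (N <= n)%N -> M * omega ^+ n <= `|g 1| / 2.
  by apply: geometric_small => //; rewrite divr_gt0.
have [lam0 lam00 Hlam0] : exists2 c', 0 < c' & forall n, c' <= `|fn n 1|.
  apply: (@pos_lower_bound _ _ m2 (`|g 1| / 2)) => //; first by rewrite divr_gt0.
  move=> n /Hm2 h; have := lamd n; have := lerB_dist (g 1) (fn n 1); rewrite distrC.
  by move: h; set t1 := M * _; set t2 := `|g 1|; set t3 := `|_ - _|; set t4 := `|_|; lra.
(* [D] is mapped by both branches of [g] to a positive distance [e] from its
   complement; [eta] is so small that this survives, with margin [e / 2], for
   the branches of [fn n] once [fn n] is [eta]-close to [g]. *)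
have [MD MD0 DM] := fp_cmod_bounded fp.
have [MG MG0 GM] := continuous_closure_bounded fp (fp_continuous fp).
have [e1 e10 He1] := fp_margin fp (fp_scale fp).
have [e2 e20 He2] := fp_margin fp (fp_image fp).
pose e := Num.min e1 e2; have e0 : 0 < e by rewrite lt_min e10.
have He1' z w : D z -> cmod (w - toC (g 1) * z) < e -> D w.
  by move=> Dz we; apply: (He1 z) => //; apply: lt_le_trans we _; rewrite ge_min lexx.
have He2' z w : D z -> cmod (w - G (toC (g 1) * z)) < e -> D w.
  by move=> Dz we; apply: (He2 z) => //; apply: lt_le_trans we _; rewrite ge_min lexx orbT.
pose eta := e / 4 / (1 + MD + 4 * MG / e * MD).
have q0 : 0 <= 4 * MG / e * MD.
  by rewrite mulr_ge0 ?(ltW MD0)// divr_ge0 ?(ltW e0)// mulr_ge0.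
have den0 : 0 < 1 + MD + 4 * MG / e * MD by rewrite -addrA ltr_pwDl// addr_ge0// ltW.
have eta0 : 0 < eta by rewrite !divr_gt0.
have [eta1 eta2 eta3] : [/\ eta <= e / 4, eta * MD <= e / 4 & 4 * MG / e * (eta * MD) <= e / 4].
  have E : eta + eta * MD + 4 * MG / e * (eta * MD) = e / 4.
    rewrite -[RHS](divfK (lt0r_neq0 den0)) -/eta; ring.
  have h1 : 0 <= eta * MD by rewrite mulr_ge0 ?ltW.
  have h2 : 0 <= 4 * MG / e * (eta * MD).
    by rewrite mulr_ge0// divr_ge0 ?(ltW e0)// mulr_ge0.
  by move: E h1 h2 eta0; set x1 := eta * MD; set x2 := _ * x1; split; lra.
have [m3 Hm3] : exists N, forall n, (N <= n)%N -> M * omega ^+ n <= eta.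
  exact: geometric_small.
pose stepC b i v := if b then F i (toC (fn i 1) * v) else toC (fn i 1) * v.
have close1 n v : (m3 <= n)%N -> D v ->
    cmod (toC (fn n 1) * v - toC (g 1) * v) <= eta * MD.
  move=> /Hm3 nm Dv; rewrite -mulrBl cmodM -toCB cmod_toC ler_pM ?cmod_ge0 ?DM//.
  exact: le_trans (lamd n) nm.
have D1 n v w : (m3 <= n)%N -> D v -> cmod (w - toC (fn n 1) * v) < e / 2 -> D w.
  move=> nm Dv wv; apply: (He1' v) => //.
  apply: le_lt_trans (cmod_dist3 _ (toC (fn n 1) * v) _) _.
  have := close1 n v nm Dv; move: wv eta2 e0.
  by set x1 := cmod _; set x2 := cmod _; set x3 := eta * MD; lra.
have D1' n v : (m3 <= n)%N -> D v -> D (toC (fn n 1) * v).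
  by move=> nm Dv; apply: (D1 n v) => //; rewrite subrr cmod0 divr_gt0.
have D2 n v w : (m3 <= n)%N -> D v -> cmod (w - F n (toC (fn n 1) * v)) < e / 2 -> D w.
  move=> nm Dv wv; apply: (He2' v) => //.
  have hF : cmod (F n (toC (fn n 1) * v) - G (toC (fn n 1) * v)) <= eta.
    have [_ _ _ _ dF] := HF n; apply: le_trans (dF _ (Dcl _ (D1' n v nm Dv))) _.
    exact: Hm3.
  have hG : cmod (G (toC (fn n 1) * v) - G (toC (g 1) * v)) <= 4 * MG / e * (eta * MD).
    have disc x : cmod (x - toC (g 1) * v) <= e / 2 -> D x.
      by move=> xv; apply: (He1' v) => //; apply: le_lt_trans xv _; lra.
    have Dg : D (toC (g 1) * v) by apply: disc; rewrite subrr cmod0 divr_ge0 ?ltW.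
    have := @schwarz R G (toC (g 1) * v) (e / 2) (2 * MG).
    have e20' : 0 < e / 2 by rewrite divr_gt0.
    have MG20 : 0 <= 2 * MG by rewrite mulr_ge0.
    move=> /(_ e20' MG20) H.
    have {}H := H _ _ (toC (fn n 1) * v).
    have cl := close1 n v nm Dv.
    apply: (le_trans (H _ _ _)).
    - by move=> x /disc Dx; exact: (analytic_jet _ (fp_open fp) (fp_analytic fp)).
    - move=> x /disc Dx; apply: le_trans (cmodB _ _) _.
      by rewrite mulr_natl mulr2n lerD ?GM//; exact: Dcl.
    - apply: le_trans cl _; apply: le_trans eta2 _; lra.
    - have -> : 2 * MG / (e / 2) = 4 * MG / e by field; rewrite gt_eqF.
      by rewrite ler_wpM2l// divr_ge0 ?(ltW e0)// mulr_ge0.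
  apply: le_lt_trans (cmod_dist3 _ (F n (toC (fn n 1) * v)) _) _.
  have := cmod_dist3 (F n (toC (fn n 1) * v)) (G (toC (fn n 1) * v)) (G (toC (g 1) * v)).
  move: wv hF hG eta1 eta3 e0.
  set x1 := cmod _; set x2 := cmod _; set x3 := cmod _; set x4 := cmod _; set x5 := _ * _ * _.
  by move=> *; lra.
pose good H := exists n b, (m3 <= n)%N /\ H = stepC b n.
have good_marg H : good H -> forall v w, D v -> cmod (w - H v) < e / 2 -> D w.
  move=> [n [b [nm ->]]] v w Dv; rewrite /stepC; case: b; [exact: D2|exact: D1].
have good_D H : good H -> forall v, D v -> D (H v).
  by move=> gH v Dv; apply: (good_marg H gH v) => //; rewrite subrr cmod0 divr_gt0.
have good_jet H : good H -> forall v, D v -> jet 4 H v.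
  move=> [n [b [nm ->]]] v Dv.
  have jl : jet 4 (fun w => toC (fn n 1) * w) v.
    by apply: jetM; [exact: jet_cst|exact: jet_id].
  case: b => //.
  apply: (@jet_comp _ 3 (fun w => toC (fn n 1) * w) (F n)) => //.
  by apply: jF; exact: D1'.
pose delta := e / (8 * MD).
have delta0 : 0 < delta by rewrite divr_gt0// mulr_gt0.
have dM : 2 * delta * MD < e / 2.
  have -> : 2 * delta * MD = e / 4 by rewrite /delta; field; rewrite gt_eqF.
  by lra.
exists (fun n => rh (Fh n)), (fun n => rd (Fh n)), K, (c1 / 2).
exists (2 * (2 * MD / rho)), ((1 + delta)^-1), lam0, (maxn m1 m3).
move=> ph.
have fnI n x : I11 x -> I11 (fn n x) by have [rn _ _ _ _] := HF n; exact: renorm_self rn x.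
have lamI n x : I11 x -> I11 (fn n 1 * x).
  move=> /Iabs x1; apply/Iabs; rewrite normrM -[X in _ <= X]mulr1 ler_pM//.
  by apply/Iabs; exact: fnI.
split.
- split => //; first by rewrite divr_gt0.
  + by rewrite mulr_ge0// divr_ge0 ?(ltW rho0)// mulr_ge0// ltW.
  + by rewrite invr_gt0 ltr_pwDl ?(ltW delta0)//= invf_lt1 ?ltrDl// ltr_pwDl// ltW.
- by move=> n x Ix; split; [exact: fnE|apply: factor_sder (jFh n) (@fnE n) x Ix].
- by move=> n x y Ix Iy; have [_] := HK (Fh n) (jFh n) (FhB n) x y Ix Iy.
split.
- move=> n x; rewrite geq_max => /andP[nm1 _] Ix.
  have := HK' (Fh n) Gh _ (jFh n) jGh (dFG n) x Ix; rewrite mulrA.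
  have := phiGc x Ix; have := Hm1 n nm1.
  have := lerB_dist (phi Gh x) (phi (Fh n) x); rewrite distrC.
  rewrite -/(phi (Fh n) x).
  set x1 := `|_ - _|; set x2 := `|phi Gh x|; set x3 := `|phi _ x|; set x4 := _ * _ ^+ n.
  by move=> *; lra.
- exact: Hlam0.
move=> beta n j u u'; rewrite geq_max => /andP[_ nm3] Iu Iu'.
pose fix dl j := if j is j'.+1 then stepC (beta (n + j')%N) (n + j')%N :: dl j' else [::].
have dl_good i H : List.In H (dl i) -> good H.
  elim: i => [//|i IH] /= [<-|/IH//].
  by exists (n + i)%N, (beta (n + i)%N); split => //; rewrite (leq_trans nm3)// leq_addr.
have dl_size i : size (dl i) = i by elim: i => //= i ->.
have dlE i x : I11 x ->
    foldl (fun u F => F u) (toC x) (dl i) = toC (descend fn beta n i x).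
  elim: i x => [//|i IH] x Ix /=.
  have -> : stepC (beta (n + i)%N) (n + i)%N (toC x) = toC (step fn (beta (n + i)%N) (n + i) x).
    rewrite /stepC /step; case: ifP => _; last by rewrite -toCM.
    have [_ _ _ eF _] := HF (n + i)%N.
    by rewrite -toCM; apply: eF; exact: lamI.
  apply: IH; rewrite /step; case: ifP => _; last exact: lamI.
  by apply: fnI; exact: lamI.
pose L := 2 * MD / rho * (1 + delta)^-1 ^+ j.
have : forall x, exists d, -1 <= x <= 1 ->
    sder `[-1, 1] (descend fn beta n j) x d /\ `|d| <= L.
  move=> x; have [Ix|nI] := pselect (-1 <= x <= 1); last by exists 0.
  have Ix' : I11 x by rewrite /I11 /= in_itv.
  have [w|d cd_ dL] := composition_contract (ltW delta0) dM rho0 DM good_jet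
     good_marg good_D (s := dl j) (dl_good j) (z := toC x).
    by move=> wr; apply: (D3 x w Ix'); apply: le_trans wr _; lra.
  rewrite dl_size in dL.
  exists (complex.Re d) => _; split; last exact: le_trans (Re_le_cmod _) dL.
  have := cder_sder cd_; apply: sder_eq => // y Iy.
  by rewrite dlE.
move=> /choice[d Hd].
have := @sder_lipschitz R (-1) 1 (descend fn beta n j) d L
  (fun x Ix => (Hd x Ix).1) (fun x Ix => (Hd x Ix).2) u' u.
move: (Iu) (Iu'); rewrite /I11 /= !in_itv /= => Ju Ju' /(_ Ju' Ju) /le_trans; apply.
have L0 : 0 <= L.
  rewrite mulr_ge0 ?divr_ge0 ?mulr_ge0 ?exprn_ge0 ?invr_ge0 ?(ltW MD0) ?(ltW rho0)//.
  by rewrite addr_ge0// ltW.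
have -> : 2 * (2 * MD / rho) * (1 + delta)^-1 ^+ j = L * 2.
  by rewrite /L; move: (_ ^+ j) (2 * MD / rho) => x y; ring.
rewrite ler_wpM2l//.
move/Iabs : Iu; move/Iabs : Iu' => h1 h2; apply: le_trans (ler_normB _ _) _.
by move: h1 h2; set t1 := `|u|; set t2 := `|u'|; lra.
Qed.

End stable_manifold_estimates.

(** * The derivative cocycle under renormalization *)

Section central_interval.
Variables (R : realType) (q d : R -> R).
Hypothesis rq : renormalizable q.
Hypothesis sq : forall x, I11 x -> sder (@I11 R) q x (d x).

Lemma renorm_decreasing a b : 0 <= a -> a < b -> b <= 1 -> q b < q a.
Proof.
move=> a0 ab b1.
have [||c /andP[ac cb] E] := @sder_MVT R (-1) 1 q d a b _ ab b1.
- by lra.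
- by move=> x xI; apply: sq; rewrite /I11 /= in_itv.
have c0 : 0 < c by exact: le_lt_trans ac.
have Ic : I11 c.
  by rewrite /I11 /= in_itv /= (le_trans _ (ltW c0))//= (le_trans (ltW cb)).
have := renorm_mono rq Ic (lt0r_neq0 c0).
rewrite (@sder_deriv_in R (-1) 1 q c (d c))//; last exact: sq.
rewrite pmulr_rlt0// => dc.
by rewrite -subr_lt0 E nmulr_rlt0// subr_gt0.
Qed.

(** The central interval is mapped above [|q 1|], hence away from the critical
    point. *)
Lemma renorm_central v : `|v| <= `|q 1| -> `|q 1| < q v.
Proof.
have I1 : I11 (1 : R) by rewrite /I11 /= in_itv /= lexx; lra.
have qabs x : I11 x -> q x = q `|x|.
  move=> Ix; have [x0|x0] := leP 0 x; first by rewrite ger0_norm.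
  by rewrite ltr0_norm// renorm_even.
have q1I := renorm_self rq I1.
have q11 : `|q 1| <= 1 by move: q1I; rewrite /I11 /= in_itv /= ler_norml.
move=> vq; have Iv : I11 v by rewrite /I11 /= in_itv /= -ler_norml (le_trans vq).
have /andP[_ h] := renorm_nested rq; apply: lt_le_trans h _.
rewrite (qabs _ q1I) (qabs _ Iv); move: vq; rewrite le_eqVlt => /orP[/eqP->//|vq].
by apply: ltW; apply: renorm_decreasing.
Qed.

End central_interval.

Section lipschitz_on_I.
Variable R : realType.
Implicit Types p q : R -> R.

Definition lipI p := exists2 L : R, 0 <= L &
  forall x y, I11 x -> I11 y -> `|p y - p x| <= L * `|y - x|.

Let I0 : @I11 R 0.
Proof. by rewrite /I11 /= in_itv /=; lra. Qed.

Let Iabs (x : R) : I11 x <-> `|x| <= 1.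
Proof. by rewrite /I11 /= in_itv /= ler_norml. Qed.

Lemma lipI_bounded p : lipI p -> exists2 B : R, 0 <= B & forall x, I11 x -> `|p x| <= B.
Proof.
move=> [L L0 H]; exists (`|p 0| + L); first by rewrite addr_ge0.
move=> x Ix; rewrite -[p x](subrK (p 0)) addrC (le_trans (ler_normD _ _))// lerD2l.
apply: le_trans (H 0 x I0 Ix) _; rewrite subr0 ler_piMr//; exact/Iabs.
Qed.

Lemma lipI_cst c : lipI (fun=> c).
Proof. by exists 0 => // x y _ _; rewrite subrr normr0 mul0r. Qed.

Lemma lipI_id : lipI id.
Proof. by exists 1 => // x y _ _; rewrite mul1r. Qed.

Lemma lipI_mul p q : lipI p -> lipI q -> lipI (fun x => p x * q x).
Proof.
move=> lp lq; have [B B0 pB] := lipI_bounded lp; have [C C0 qC] := lipI_bounded lq.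
move: lp lq => [L L0 pL] [M M0 qM].
exists (L * C + B * M); first by rewrite addr_ge0 ?mulr_ge0.
move=> x y Ix Iy.
have -> : p y * q y - p x * q x = (p y - p x) * q y + p x * (q y - q x) by ring.
rewrite (le_trans (ler_normD _ _))// !normrM [X in _ <= X]mulrDl lerD//.
  by rewrite mulrAC ler_pM ?pL ?qC.
by rewrite -mulrA ler_pM ?pB ?qM.
Qed.

Lemma lipI_exp p n : lipI p -> lipI (fun x => p x ^+ n).
Proof.
move=> lp; elim: n => [|n IH]; first exact: lipI_cst.
by under eq_fun do rewrite exprS; exact: lipI_mul.
Qed.

Lemma lipI_abs p : lipI p -> lipI (fun x => `|p x|).
Proof.
move=> [L L0 H]; exists L => // x y Ix Iy.
exact: le_trans (ler_dist_dist _ _) (H x y Ix Iy).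
Qed.

Lemma lipI_comp p q : (forall x, I11 x -> I11 (p x)) -> lipI p -> lipI q ->
  lipI (fun x => q (p x)).
Proof.
move=> pI [L L0 pL] [M M0 qM]; exists (M * L); first by rewrite mulr_ge0.
move=> x y Ix Iy; apply: le_trans (qM _ _ (pI _ Ix) (pI _ Iy)) _.
by rewrite -mulrA ler_wpM2l// pL.
Qed.

(** Lets identities between Lipschitz functions, obtained by dividing by a power
    of [x], be used at the critical point. *)
Lemma lipI_eq0 p q : lipI p -> lipI q -> (forall x, I11 x -> x != 0 -> p x = q x) -> p 0 = q 0.
Proof.
move=> [L L0 pL] [M M0 qM] pq; apply/eqP; rewrite -subr_eq0 -normr_le0.
apply/ler_addgt0Pr => e e0; rewrite add0r.
pose x := Num.min 1 (e / (L + M + 1)).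
have d0 : 0 < L + M + 1 by rewrite ltr_wpDl// addr_ge0.
have x0 : 0 < x by rewrite lt_min ltr01 divr_gt0.
have x1 : x <= 1 by rewrite ge_min lexx.
have xe : x * (L + M + 1) <= e by rewrite -ler_pdivlMr// ge_min lexx orbT.
have Ix : I11 x by apply/Iabs; rewrite gtr0_norm.
have := pL 0 x I0 Ix; have := qM 0 x I0 Ix.
rewrite subr0 (gtr0_norm x0) => h1 h2.
have -> : p 0 - q 0 = (q x - q 0) - (p x - p 0).
  by rewrite (pq x Ix (lt0r_neq0 x0)); ring.
rewrite (le_trans (ler_normB _ _))//.
by move: h1 h2 xe x0; set a := `|_|; set b := `|_|; lra.
Qed.

Lemma lipI_min p : lipI p -> (forall x, I11 x -> 0 < p x) ->
  exists2 c, 0 < c & forall x, I11 x -> c <= p x.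
Proof.
move=> [K K0 pK] p0.
have cp : {within @I11 R, continuous p}.
  apply/subspace_continuousP => x Ix; apply/cvgrPdist_lt => e e0.
  apply/nbhs_ballP; exists (e / (K + 1)); first by rewrite /= divr_gt0// ltr_wpDl.
  move=> y; rewrite /ball /= ltr_pdivlMr ?ltr_wpDl// => yx Iy.
  apply: le_lt_trans yx; apply: le_trans (pK _ _ Iy Ix) _.
  by rewrite mulrC ler_wpM2l// lerDl.
have [|x + xmin] := compact_EVT_min _ (@segment_compact R (-1) 1) cp; first by exists 0.
rewrite inE => Ix; exists (p x); first exact: p0.
by move=> y Iy; apply: xmin; rewrite inE.
Qed.

End lipschitz_on_I.

Section cocycle.
Variables (R : realType) (f : R -> R) (fn : nat -> R -> R) (m : nat).
Variables (ph : nat -> R -> R) (K c0 Ac theta lam0 : R) (m0 : nat).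
Let lam n := fn n 1.
Hypothesis fn0 : fn 0%N = f.
Hypothesis fn_step : forall n, fn n.+1 = Tdoubling (fn n).
Hypothesis c00 : 0 < c0.
Hypothesis Ac0 : 0 <= Ac.
Hypothesis theta01 : 0 < theta < 1.
Hypothesis lam00 : 0 < lam0.
Hypothesis fn_renorm : forall n, renormalizable (fn n).
Hypothesis fn_der : forall n x, I11 x -> sder (@I11 R) (fn n) x (x ^+ m * ph n x).
Hypothesis phK : forall n x y, I11 x -> I11 y ->
  `|ph n x| <= K /\ `|ph n y - ph n x| <= K * `|y - x|.
Hypothesis ph_low : forall n x, (m0 <= n)%N -> I11 x -> c0 <= `|ph n x|.
Hypothesis lam_low : forall n, lam0 <= `|lam n|.
Hypothesis contract : forall beta n j u u', (m0 <= n)%N -> I11 u -> I11 u' ->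
  `|descend fn beta n j u - descend fn beta n j u'| <= Ac * theta ^+ j.

Let Iabs (x : R) : I11 x <-> `|x| <= 1.
Proof. by rewrite /I11 /= in_itv /= ler_norml. Qed.

Let I0 : @I11 R 0. Proof. by apply/Iabs; rewrite normr0. Qed.
Let I1 : @I11 R 1. Proof. by apply/Iabs; rewrite normr1. Qed.

Let fnI n x : I11 x -> I11 (fn n x).
Proof. exact: renorm_self (fn_renorm n) x. Qed.

Let lam1 n : `|lam n| <= 1. Proof. by apply/Iabs; exact: fnI. Qed.

Let lamI n x : I11 x -> I11 (lam n * x).
Proof. by move=> /Iabs x1; apply/Iabs; rewrite normrM mulr_ile1. Qed.

Let lam_neq0 n : lam n != 0.
Proof. by rewrite -normr_gt0 (lt_le_trans lam00). Qed.

Let fnS n x : lam n * fn n.+1 x = fn n (fn n (lam n * x)).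
Proof. by rewrite fn_step /Tdoubling -/(lam n) mulrA mulfV// mul1r. Qed.

Let K0 : 0 <= K.
Proof. by have [h _] := phK 0 I0 I0; exact: le_trans (normr_ge0 _) h. Qed.

Let lip_fn n : lipI (fn n).
Proof.
exists K => // x y Ix Iy.
apply: (@sder_lipschitz R (-1) 1 (fn n) (fun x => x ^+ m * ph n x)).
- by move=> z zI; apply: fn_der; rewrite /I11 /= in_itv.
- move=> z zI; have Iz : I11 z by rewrite /I11 /= in_itv.
  rewrite normrM -[K]mul1r ler_pM//; last by have [] := phK n Iz Iz.
  by rewrite normrX exprn_ile1//; apply/Iabs.
- by move: Ix; rewrite /I11 /= in_itv.
- by move: Iy; rewrite /I11 /= in_itv.
Qed.

Let lip_ph n : lipI (ph n).
Proof. by exists K => // x y Ix Iy; have [] := phK n Ix Iy. Qed.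

Let lip_lam n : lipI (fun x => lam n * x).
Proof. by apply: lipI_mul; [exact: lipI_cst|exact: lipI_id]. Qed.

(** The chain rule for one renormalization, with the power of [x] divided out;
    at the critical point it holds by continuity. *)
Let phS n x : I11 x ->
  ph n.+1 x = lam n ^+ m * fn n (lam n * x) ^+ m * ph n (lam n * x) * ph n (fn n (lam n * x)).
Proof.
have ne0 y : I11 y -> y != 0 ->
  ph n.+1 y = lam n ^+ m * fn n (lam n * y) ^+ m * ph n (lam n * y) * ph n (fn n (lam n * y)).
  move=> Iy y0; set z := lam n * y; set w := fn n z.
  have Iz : I11 z by exact: lamI.
  have Iw : I11 w by exact: fnI.
  have s1 : sder (@I11 R) (fun x => lam n * x) y (0 * y + lam n * 1).
    by apply: sderM; [exact: sder_cst|exact: sder_id].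
  have s2 := sder_comp Iy (@lamI n) s1 (fn_der n Iz).
  have s3 := sder_comp Iy (fun x Ix => fnI n (lamI n Ix)) s2 (fn_der n Iw).
  have s4 := sderM (@sder_cst R (@I11 R) (lam n)^-1 y) s3.
  have e1 := sder_deriv_in _ Iy s4.
  have s5 := fn_der n.+1 Iy; have e2 := sder_deriv_in _ Iy s5.
  have lt11 : (-1 : R) < 1 by lra.
  have : y ^+ m * ph n.+1 y = 0 * fn n w +
    (lam n)^-1 * (w ^+ m * ph n w * (z ^+ m * ph n z * (0 * y + lam n * 1))).
    by rewrite -(e1 lt11) -(e2 lt11) fn_step.
  rewrite mul0r add0r mul0r add0r mulr1 => E.
  apply: (mulfI (expf_neq0 m y0)); rewrite E /z exprMn.
  move: (lam_neq0 n) (w ^+ m) (ph n w) (ph n _) (lam n ^+ m) (y ^+ m) => l0 a b c d e.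
  by field.
move=> Ix; have [->|] := eqVneq x 0; last exact: ne0.
apply: (@lipI_eq0 _ (ph n.+1) (fun x => lam n ^+ m * fn n (lam n * x) ^+ m *
   ph n (lam n * x) * ph n (fn n (lam n * x)))) => //.
have lf : lipI (fun x => fn n (lam n * x)) by apply: lipI_comp; [exact: lamI| |].
apply: lipI_mul; last by apply: lipI_comp lf (lip_ph n) => y Iy; exact/fnI/lamI.
apply: lipI_mul; last by apply: lipI_comp (lip_lam n) (lip_ph n); exact: lamI.
by apply: lipI_mul; [exact: lipI_cst|exact: lipI_exp].
Qed.

(** Away from the critical point this is monotonicity; at the critical point it
    is inherited from high levels, because by the chain rule a zero at one level
    propagates to all later ones. *)
Let ph_neq0 n x : I11 x -> ph n x != 0.
Proof.
have far y j : I11 y -> y != 0 -> ph j y != 0.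
  move=> Iy y0; have := renorm_mono (fn_renorm j) Iy y0.
  rewrite (@sder_deriv_in R (-1) 1 _ _ (y ^+ m * ph j y))//; last exact: fn_der.
  by apply: contraTneq => ->; rewrite !mulr0 ltxx.
have zero j : ph j 0 != 0.
  have hi i : (m0 <= i)%N -> ph i 0 != 0.
    by move=> im; rewrite -normr_gt0 (lt_le_trans c00)// ph_low.
  have back i : ph i.+1 0 != 0 -> ph i 0 != 0.
    apply: contra_neq => p0; rewrite (phS i I0) mulr0 p0.
    by rewrite !(mulr0, mul0r).
  have : forall i, ph (j + i)%N 0 != 0 -> ph j 0 != 0.
    elim=> [|i IH]; first by rewrite addn0.
    by rewrite addnS => /back/IH.
  by apply; apply: (hi (j + m0)%N); rewrite leq_addl.
by move=> Ix; have [->|] := eqVneq x 0; [exact: zero|exact: far].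
Qed.

(** The derivative of [fn n] in the coordinate that straightens its critical
    point; it turns renormalization into composition, see [cocS]. *)
Let coc n v := `|ph n v| * `|fn n v| ^+ m.

Let cocS n v : I11 v -> coc n.+1 v = coc n (lam n * v) * coc n (fn n (lam n * v)).
Proof.
move=> Iv; rewrite /coc (phS n Iv) -fnS !normrM !normrX.
rewrite exprMn; ring.
Qed.

Let coc_lipschitz : exists2 L : R, 0 <= L & forall n x y, I11 x -> I11 y ->
  `|coc n y - coc n x| <= L * `|y - x|.
Proof.
exists (K + K * (m%:R * K)); first by rewrite addr_ge0// !mulr_ge0.
move=> n x y Ix Iy.
have fl : `|fn n y - fn n x| <= K * `|y - x|.
  apply: (@sder_lipschitz R (-1) 1 (fn n) (fun x => x ^+ m * ph n x)).
  - by move=> z zI; apply: fn_der; rewrite /I11 /= in_itv.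
  - move=> z zI; have Iz : I11 z by rewrite /I11 /= in_itv.
    rewrite normrM -[K]mul1r ler_pM//; last by have [] := phK n Iz Iz.
    by rewrite normrX exprn_ile1//; apply/Iabs.
  - by move: Ix; rewrite /I11 /= in_itv.
  - by move: Iy; rewrite /I11 /= in_itv.
have [pKx _] := phK n Ix Ix; have [_ pl] := phK n Ix Iy.
have fy1 : `|fn n y| <= 1 by apply/Iabs; exact: fnI.
have fx1 : `|fn n x| <= 1 by apply/Iabs; exact: fnI.
have powl i : `| `|fn n y| ^+ i - `|fn n x| ^+ i| <= i%:R * (K * `|y - x|).
  elim: i => [|i IH]; first by rewrite subrr normr0 mul0r.
  have -> : `|fn n y| ^+ i.+1 - `|fn n x| ^+ i.+1 =
    `|fn n y| * (`|fn n y| ^+ i - `|fn n x| ^+ i) + (`|fn n y| - `|fn n x|) * `|fn n x| ^+ i.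
    by rewrite !exprS; ring.
  rewrite -natr1 [X in _ <= X]mulrDl mul1r (le_trans (ler_normD _ _))// !normrM lerD//.
    by rewrite normr_id -[X in _ <= X]mul1r ler_pM.
  rewrite -[X in _ <= X]mulr1 ler_pM//; first exact: le_trans (ler_dist_dist _ _) fl.
  by rewrite normrX normr_id exprn_ile1.
have -> : coc n y - coc n x = (`|ph n y| - `|ph n x|) * `|fn n y| ^+ m +
   `|ph n x| * (`|fn n y| ^+ m - `|fn n x| ^+ m) by rewrite /coc; ring.
rewrite (le_trans (ler_normD _ _))// !normrM [X in _ <= X]mulrDl lerD//.
  rewrite -[X in _ <= X]mulr1 ler_pM//; first exact: le_trans (ler_dist_dist _ _) pl.
  by rewrite normrX normr_id exprn_ile1.
by rewrite normr_id -!mulrA ler_pM// powl.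
Qed.

Let coc_le n v : I11 v -> coc n v <= K.
Proof.
move=> Iv; rewrite /coc -[K]mulr1 ler_pM// ?exprn_ge0//; first by have [] := phK n Iv Iv.
by rewrite exprn_ile1//; apply/Iabs; exact: fnI.
Qed.

Let coc_central_gt0 n u : I11 u -> lam0 <= `|fn n (lam n * u)|.
Proof.
move=> Iu; apply: le_trans (lam_low n) _; apply: le_trans (ler_norm _).
apply: ltW; apply: (renorm_central (fn_renorm n) (d := fun x => x ^+ m * ph n x)).
  exact: fn_der.
by rewrite -/(lam n) normrM ler_piMr//; apply/Iabs.
Qed.

Let coc_low : exists2 kap : R, 0 < kap & forall n u, I11 u -> kap <= coc n (lam n * u).
Proof.
have loc n : exists2 b, 0 < b & forall u, I11 u -> b <= `|ph n u|.
  by apply: lipI_min; [exact: lipI_abs|move=> u Iu; rewrite normr_gt0 ph_neq0].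
pose bs n := xget 0 [set b : R | 0 < b /\ (b <= c0 \/ (n < m0)%N) /\
   forall u, I11 u -> b <= `|ph n u|].
have : forall n, exists b : R, 0 < b /\ ((m0 <= n)%N -> c0 <= b) /\
   forall u, I11 u -> b <= `|ph n u|.
  move=> n; have [nm|mn] := ltnP n m0.
    by have [b b0 bP] := loc n; exists b; split => //; split.
  by exists c0; split => //; split => // u Iu; exact: ph_low.
move=> /choice[b Hb].
have [b' b'0 b'P] := pos_lower_bound c00 (fun n => (Hb n).1) (fun n => (Hb n).2.1).
exists (b' * lam0 ^+ m); first by rewrite mulr_gt0// exprn_gt0.
move=> n u Iu; rewrite /coc ler_pM ?exprn_ge0 ?(ltW b'0) ?(ltW lam00)//.
  by apply: le_trans (b'P n) _; apply: (Hb n).2.2; exact: lamI.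
by rewrite lerXn2r ?nnegrE ?(ltW lam00)// coc_central_gt0.
Qed.

Let Lam n : R := \prod_(i < n) lam i.

Let LamS n : Lam n.+1 = Lam n * lam n.
Proof. by rewrite /Lam big_ord_recr. Qed.

(** [fn n] is [f^(2^n)] rescaled from the interval [Lam n * I] to [I]. *)
Let iter_pow n v : I11 v -> iter (2 ^ n) f (Lam n * v) = Lam n * fn n v.
Proof.
elim: n v => [|n IH] v Iv; first by rewrite /Lam big_ord0 !mul1r fn0.
have Ilv := lamI n Iv.
rewrite expnS mul2n -addnn iterD LamS -[_ * _ * v]mulrA (IH _ Ilv) (IH _ (fnI n Ilv)).
by rewrite -fnS mulrA.
Qed.

Let iter_pow_mul n q v : I11 v -> iter (2 ^ n * q) f (Lam n * v) = Lam n * iter q (fn n) v /\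
  I11 (iter q (fn n) v).
Proof.
move=> Iv; elim: q => [|q [IH IHI]]; first by rewrite muln0.
by split; [rewrite mulnS iterD IH iter_pow|rewrite iterS; exact: fnI].
Qed.

(** Up to factors that are bounded above and below, the derivative of [f^t] at
    [f y]; in this form it is positive also along the critical orbit. *)
Let A t y := \prod_(i < t) coc 0 (iter i f y).

Let A_add s t y : A (s + t) y = A s y * A t (iter s f y).
Proof.
elim: t => [|t IH]; first by rewrite addn0 /A big_ord0 mulr1.
by rewrite addnS /A !big_ord_recr /= -/(A (s + t) y) IH -/(A t _) addnC iterD mulrA.
Qed.

Let A_pow n v : I11 v -> A (2 ^ n) (Lam n * v) = coc n v.
Proof.
elim: n v => [|n IH] v Iv; first by rewrite /A /Lam big_ord1 big_ord0 mul1r.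
have Ilv := lamI n Iv.
rewrite expnS mul2n -addnn A_add LamS -[_ * _ * v]mulrA (IH _ Ilv) (iter_pow n Ilv).
by rewrite (IH _ (fnI n Ilv)) cocS.
Qed.

(** The time with binary digits [beta i], [i < n]. *)
Let val (beta : nat -> bool) n : nat := (\sum_(i < n) beta i * 2 ^ i)%N.

Let weight n (b : bool) u := if b then coc n (lam n * u) else 1.

Let stepI n b u : I11 u -> I11 (step fn b n u).
Proof. by move=> Iu; rewrite /step; case: b; [exact: fnI (lamI n Iu)|exact: lamI]. Qed.

(** Running the blocks of steps from the top digit down, the block of length
    [2 ^ i] starts in the central interval of level [i], where [coc i] measures
    its derivative. *)
Let A_digits beta n u : I11 u -> A (val beta n) (Lam n * u) =
  \prod_(i < n) weight i (beta i) (descend fn beta i.+1 (n - i.+1) u).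
Proof.
elim: n u => [|n IH] u Iu; first by rewrite /val !big_ord0 /A big_ord0.
rewrite big_ord_recr /= subnn /=.
have -> : A (val beta n.+1) (Lam n.+1 * u) =
    weight n (beta n) u * A (val beta n) (Lam n * step fn (beta n) n u).
  rewrite /val big_ord_recr /= -/(val beta n) LamS -mulrA addnC /weight /step.
  case: (beta n); last by rewrite mul0n add0n mul1r.
  by rewrite mul1n A_add (A_pow n (lamI n Iu)) (iter_pow n (lamI n Iu)).
rewrite (IH _ (stepI n (beta n) Iu)) mulrC; congr (_ * _); apply: eq_bigr => i _.
have -> : (n.+1 - i.+1 = (n - i.+1).+1)%N by rewrite subSS -subSn.
by rewrite /= subnKC.
Qed.

Let descendI beta n j u : I11 u -> I11 (descend fn beta n j u).
Proof. by elim: j u => [//|j IH] u Iu /=; apply: IH; exact: stepI. Qed.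

Let weight_gt0 : exists2 kap : R, 0 < kap <= 1 & forall n b u, I11 u -> kap <= weight n b u.
Proof.
have [kap kap0 H] := coc_low; exists (Num.min kap 1).
  by rewrite lt_min kap0 ltr01 ge_min lexx orbT.
by move=> n b u Iu; rewrite /weight; case: b; rewrite ge_min ?lexx ?orbT// H.
Qed.

(** Bounded distortion: moving the starting point inside the interval of
    level [n] changes the derivative along at most [2 ^ n] steps by a bounded
    factor, because the errors made at the successive levels decay
    geometrically. *)
Let distortion : exists2 C : R, 1 <= C & forall beta n u u', I11 u -> I11 u' ->
  A (val beta n) (Lam n * u) <= C * A (val beta n) (Lam n * u').
Proof.
have [kap /andP[kap0 kap1] Hkap] := weight_gt0.
have [L L0 HL] := coc_lipschitz.
have /andP[th0 th1] := theta01.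
pose Kw := Num.max K 1.
have Kw1 : 1 <= Kw by rewrite le_max lexx orbT.
have w_le n b u : I11 u -> weight n b u <= Kw.
  move=> Iu; rewrite /weight; case: b; rewrite le_max ?lexx ?orbT//.
  by rewrite coc_le//; exact: lamI.
pose q := Kw / kap.
have q1 : 1 <= q by rewrite ler_pdivlMr// mul1r (le_trans kap1).
pose s := L * Ac / kap.
have s0 : 0 <= s by rewrite divr_ge0 ?mulr_ge0// ltW.
pose fac n i := (if (i < m0)%N then q else 1) * expR (s * theta ^+ (n - i.+1)).
have e1 j : 1 <= expR (s * theta ^+ j).
  by rewrite -expR0 ler_expR mulr_ge0 ?exprn_ge0 ?(ltW th0).
have fac0 n i : 0 <= fac n i.
  by rewrite mulr_ge0 ?expR_ge0//; case: ifP => _//; rewrite (le_trans _ q1).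
have one (beta : nat -> bool) n u u' (i : 'I_n) : I11 u -> I11 u' ->
    weight i (beta i) (descend fn beta i.+1 (n - i.+1) u) <=
    fac n i * weight i (beta i) (descend fn beta i.+1 (n - i.+1) u').
  move=> Iu Iu'; set v := descend _ _ _ _ u; set v' := descend _ _ _ _ u'.
  have Iv : I11 v by exact: descendI.
  have Iv' : I11 v' by exact: descendI.
  rewrite /fac; case: ifPn => [_|]; last rewrite -leqNgt => mi.
    apply: le_trans (w_le _ _ _ Iv) _.
    have -> : Kw = q * kap by rewrite /q divfK ?gt_eqF.
    have wk := Hkap i (beta i) v' Iv'.
    rewrite -mulrA ler_wpM2l ?(le_trans _ q1)// (le_trans wk)// ler_peMl//.
    exact: le_trans (ltW kap0) wk.
  rewrite mul1r /weight; case: (beta i); last by rewrite mulr1.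
  have dv : `|v - v'| <= Ac * theta ^+ (n - i.+1).
    by apply: contract => //; exact: leqW.
  have := HL i (lam i * v') (lam i * v) (lamI i Iv') (lamI i Iv).
  rewrite -mulrBr normrM => h.
  have {}h : coc i (lam i * v) - coc i (lam i * v') <= L * (Ac * theta ^+ (n - i.+1)).
    apply: le_trans (ler_norm _) _; apply: le_trans h _; rewrite ler_wpM2l//.
    by apply: le_trans dv; rewrite ler_piMl.
  have kc : kap <= coc i (lam i * v') by have := Hkap i true v' Iv'.
  have th_ge0 : 0 <= theta ^+ (n - i.+1) by rewrite exprn_ge0// ltW.
  apply: (@le_trans _ _ ((1 + s * theta ^+ (n - i.+1)) * coc i (lam i * v'))).
    rewrite mulrDl mul1r -lerBlDl (le_trans h)// /s.
    have -> : L * (Ac * theta ^+ (n - i.+1)) = L * Ac / kap * theta ^+ (n - i.+1) * kap.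
      by move: (theta ^+ _) => t; field; rewrite gt_eqF.
    by rewrite ler_wpM2l// mulr_ge0// divr_ge0 ?mulr_ge0// ltW.
  rewrite ler_wpM2r ?expR_ge1Dx//.
  exact: le_trans (ltW kap0) kc.
have facC n : \prod_(i < n) fac n i <= q ^+ m0 * expR (s / (1 - theta)).
  rewrite big_split /=.
  have -> : \prod_(i < n) (if (i < m0)%N then q else 1) = q ^+ minn n m0.
    elim: n => [|n IH]; first by rewrite big_ord0 min0n.
    rewrite big_ord_recr /= IH; case: ltnP => nm.
      by rewrite -exprSr (minn_idPl nm).
    by rewrite mulr1 (minn_idPr (leqW nm)).
  rewrite -expR_sum -mulr_sumr.
  have -> : \sum_(i < n) theta ^+ (n - i.+1) = \sum_(i < n) theta ^+ i.
    rewrite -[RHS](big_mkord xpredT (fun i => theta ^+ i)) big_nat_rev /= big_mkord.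
    by apply: eq_bigr => i _; rewrite add0n.
  rewrite ler_pM ?expR_ge0 ?exprn_ge0 ?(le_trans _ q1)//.
    by rewrite ler_weXn2l// geq_minr.
  rewrite ler_expR ler_wpM2l// -[X in _ <= X]mul1r ler_pdivlMr ?subr_gt0//.
  have -> : (\sum_(i < n) theta ^+ i) * (1 - theta) = 1 - theta ^+ n.
    have := subrX1 theta n; set S := \sum_(i < n) _ => E.
    have -> : S * (1 - theta) = - ((theta - 1) * S) by ring.
    by rewrite -E opprB.
  by rewrite lerBlDr lerDl exprn_ge0// ltW.
exists (q ^+ m0 * expR (s / (1 - theta))).
  apply: mulr_ege1; first exact: exprn_ege1.
  by rewrite -[X in X <= _]expR0 ler_expR divr_ge0// subr_ge0 ltW.
move=> beta n u u' Iu Iu'; rewrite !A_digits//.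
apply: (@le_trans _ _ ((\prod_(i < n) fac n i) *
    \prod_(i < n) weight i (beta i) (descend fn beta i.+1 (n - i.+1) u'))).
  rewrite -big_split /=; apply: ler_prod => i _; rewrite one// andbT.
  apply: le_trans (Hkap i (beta i) _ _); first exact: ltW.
  exact: descendI.
rewrite ler_wpM2r ?facC// prodr_ge0// => i _.
by apply: le_trans (Hkap i (beta i) _ (descendI _ _ _ Iu')); exact: ltW.
Qed.

Let bits r i := odd (r %/ 2 ^ i).

Let val_bits r n : val (bits r) n = (r %% 2 ^ n)%N.
Proof.
elim: n => [|n IH]; first by rewrite /val big_ord0 modn1.
rewrite /val big_ord_recr /= -/(val _ n) IH /bits.
have e := divn_eq r (2 ^ n); have e2 := odd_double_half (r %/ 2 ^ n).
have hl : (r %% 2 ^ n < 2 ^ n)%N by rewrite ltn_mod expn_gt0.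
set o := odd _ in e2 *; set h := (_./2) in e2 *; set rr := (r %% 2 ^ n)%N in e hl *.
have -> : r = (h * 2 ^ n.+1 + (rr + o * 2 ^ n))%N.
  by rewrite {1}e -e2 expnS -muln2; ring.
rewrite modnMDl modn_small// expnS.
by case: (o); lia.
Qed.

Let A_gt0 r n u : (r < 2 ^ n)%N -> I11 u -> 0 < A r (Lam n * u).
Proof.
move=> rn Iu; have := A_digits (bits r) n Iu; rewrite val_bits modn_small// => ->.
have [kap /andP[kap0 _] H] := weight_gt0.
apply: prodr_gt0 => i _; apply: lt_le_trans kap0 _; apply: H; exact: descendI.
Qed.

Let E t := A t 0.

Let E_gt0 t : 0 < E t.
Proof.
by have := A_gt0 (ltn_expl t (ltnSn 1)) I0; rewrite mulr0.
Qed.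

(** Up to time [2 ^ n.+1 * q] nothing changes, and the orbit then lies in the
    central interval of level [n.+1]. Switching on digit [n] inserts one
    application of [fn n] there, at bounded cost, and makes the remaining [r]
    steps start from another point of the interval of level [n], which is
    harmless by [distortion]. *)
Let E_flip : exists2 C : R, 1 <= C & forall n q r, (r < 2 ^ n)%N ->
  let t := (2 ^ n.+1 * q + r)%N in E (t + 2 ^ n) <= C * E t /\ E t <= C * E (t + 2 ^ n).
Proof.
have [C C1 HC] := distortion; have [kap /andP[kap0 kap1] Hkap] := weight_gt0.
pose Kw := Num.max K 1.
have Kw1 : 1 <= Kw by rewrite le_max lexx orbT.
have C0 : 0 < C by rewrite (lt_le_trans _ C1).
exists (Num.max (Kw * C) (C / kap)).
  by rewrite le_max mulr_ege1.
move=> n q r rn t.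
pose v := iter q (fn n.+1) 0.
have Iv : I11 v by have [] := iter_pow_mul n.+1 q I0.
have yE : iter (2 ^ n.+1 * q) f 0 = Lam n * (lam n * v).
  by have [h _] := iter_pow_mul n.+1 q I0; rewrite mulr0 LamS -mulrA in h.
have Ilv : I11 (lam n * v) by exact: lamI.
have tE : E t = E (2 ^ n.+1 * q) * A r (Lam n * (lam n * v)).
  by rewrite /t /E A_add yE.
have tnE : E (t + 2 ^ n) = E (2 ^ n.+1 * q) *
    (coc n (lam n * v) * A r (Lam n * fn n (lam n * v))).
  rewrite /t -addnA [(r + _)%N]addnC /E A_add yE A_add A_pow//.
  by rewrite iter_pow.
have d1 := HC (bits r) n _ _ Ilv (fnI n Ilv).
have d2 := HC (bits r) n _ _ (fnI n Ilv) Ilv.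
rewrite val_bits modn_small// in d1 d2.
have cK : coc n (lam n * v) <= Kw by rewrite le_max coc_le.
have ck : kap <= coc n (lam n * v) by have := Hkap n true v Iv.
have Eq := E_gt0 (2 ^ n.+1 * q).
have a1 := A_gt0 rn Ilv; have a2 := A_gt0 rn (fnI n Ilv).
rewrite tE tnE; split.
  rewrite [X in _ <= X]mulrCA ler_wpM2l ?(ltW Eq)//.
  apply: (@le_trans _ _ ((Kw * C) * A r (Lam n * (lam n * v)))).
    by rewrite -mulrA ler_pM ?(ltW a2)// (le_trans (ltW kap0)).
  by rewrite ler_wpM2r ?(ltW a1)// le_max lexx.
rewrite [X in _ <= X]mulrCA ler_wpM2l ?(ltW Eq)//.
apply: (@le_trans _ _ ((C / kap) * (coc n (lam n * v) * A r (Lam n * fn n (lam n * v))))).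
  rewrite [X in _ <= X]mulrA; apply: le_trans d1 _; rewrite ler_wpM2r ?(ltW a2)//.
  by rewrite -mulrA ler_peMr ?(ltW C0)// mulrC ler_pdivlMr// mul1r.
rewrite ler_wpM2r ?le_max ?lexx ?orbT//.
by rewrite mulr_ge0 ?(ltW a2)// (le_trans (ltW kap0)).
Qed.

Let orbit_I x i : I11 x -> I11 (iter i f x).
Proof.
have fI y : I11 y -> I11 (f y) by rewrite -fn0; exact: fnI.
by move=> Ix; elim: i => [//|i IH]; exact: fI.
Qed.

Lemma sder_iter s x : I11 x -> sder (@I11 R) (iter s f) x
  (\prod_(i < s) (iter i f x ^+ m * ph 0%N (iter i f x))).
Proof.
move=> Ix; elim: s => [|s IH]; first by rewrite big_ord0; exact: sder_id.
rewrite big_ord_recr /= mulrC.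
apply: (sder_comp Ix _ IH); first by move=> y; exact: orbit_I.
by have := fn_der 0 (orbit_I s Ix); rewrite fn0.
Qed.

(** Pairing, in the chain rule, the power of [f^(t+1) 0] with the value of [ph 0]
    at [f^t 0] turns the derivative into a quotient of values of the sequence
    [E t * |ph 0 (f^t 0)|], to which [E_flip] applies. *)
Lemma critical_orbit_derivatives : exists (a : nat -> R) (C : R),
  [/\ 1 <= C, forall t, 0 < a t,
    forall n q r, (r < 2 ^ n)%N -> let t := (2 ^ n.+1 * q + r)%N in
      a (t + 2 ^ n)%N <= C * a t /\ a t <= C * a (t + 2 ^ n)%N
  & forall i s, `|deriv_in (@I11 R) (iter s f) (iter i.+1 f 0)| = a (i + s)%N / a i].
Proof.
have [kp kp0 kpP] : exists2 b, 0 < b & forall u, I11 u -> b <= `|ph 0%N u|.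
  by apply: lipI_min; [exact: lipI_abs|move=> u Iu; rewrite normr_gt0 ph_neq0].
have [C C1 HC] := E_flip.
pose x t := iter t f 0; have Ix t : I11 (x t) by exact: orbit_I.
pose a t := E t * `|ph 0%N (x t)|.
have a0 t : 0 < a t by rewrite mulr_gt0// (lt_le_trans kp0)// kpP.
have pK t : `|ph 0%N (x t)| <= K by have [] := phK 0 (Ix t) (Ix t).
have kK : 1 <= K / kp by rewrite ler_pdivlMr// mul1r (le_trans (kpP _ I0))//; have [] := phK 0 I0 I0.
have cmp s t : E s <= C * E t -> a s <= C * (K / kp) * a t.
  move=> st; rewrite /a.
  have -> : C * (K / kp) * (E t * `|ph 0%N (x t)|) = (C * E t) * (K / kp * `|ph 0%N (x t)|).
    by ring.
  rewrite ler_pM ?(ltW (E_gt0 s))//; apply: le_trans (pK s) _.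
  by rewrite -mulrA ler_peMr// mulrC ler_pdivlMr// mul1r kpP.
exists a, (C * (K / kp)); split => //.
- exact: mulr_ege1.
- by move=> n q r rn t; have [h1 h2] := HC n q r rn; split; exact: cmp.
move=> i s; have lt11 : (-1 : R) < 1 by lra.
rewrite (sder_deriv_in lt11 (Ix i.+1) (sder_iter s (Ix i.+1))) normr_prod.
apply: (mulIf (lt0r_neq0 (a0 i))); rewrite divfK ?lt0r_neq0//.
elim: s => [|s IH]; first by rewrite big_ord0 mul1r addn0.
have xE : iter s f (x i.+1) = x (i + s).+1.
  by rewrite /x -iterD -addSn addnC.
rewrite big_ord_recr /= mulrAC IH xE addnS /a /E /A big_ord_recr /= -/(A _ _) -/(E _).
by rewrite /coc fn0 normrM normrX -/(x _) -[f (x _)]/(x (i + s).+1); ring.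
Qed.

End cocycle.

(** * Sequences quasi-invariant under binary digit flips *)

Section digit_flips.
Variables (R : realType) (e : nat -> R) (C : R).
Hypothesis C1 : 1 <= C.
Hypothesis e0 : forall t, 0 < e t.
Hypothesis flip : forall n q r, (r < 2 ^ n)%N -> let t := (2 ^ n.+1 * q + r)%N in
  e (t + 2 ^ n)%N <= C * e t /\ e t <= C * e (t + 2 ^ n)%N.

Let C0 : 0 < C. Proof. exact: lt_le_trans C1. Qed.

Let log2 N : (0 < N)%N -> exists2 m, (2 ^ m <= N)%N & (N < 2 ^ m.+1)%N.
Proof. by move=> N0; exists (trunc_log 2 N); [rewrite trunc_logP|rewrite trunc_log_ltn]. Qed.

(** A time below [2 ^ m] is reached from [0] by at most [m] flips. *)
Let clear_digits m t : (t < 2 ^ m)%N -> e t <= C ^+ m * e 0%N /\ e 0%N <= C ^+ m * e t.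
Proof.
elim: m t => [|m IH] t; first by rewrite ltnS leqn0 => /eqP->; rewrite !mul1r.
have [tm _|mt tm] := ltnP t (2 ^ m).
  have [h1 h2] := IH t tm.
  split; [apply: le_trans h1 _|apply: le_trans h2 _];
    by rewrite ler_wpM2r ?(ltW (e0 _))// exprS ler_peMl ?exprn_ge0 ?(ltW C0).
have rm : (t - 2 ^ m < 2 ^ m)%N by rewrite ltn_subLR// addnn -mul2n -expnS.
have := flip 0 rm; rewrite /= muln0 add0n subnK// => -[h1 h2].
have [h3 h4] := IH _ rm; split.
  by rewrite exprS -mulrA (le_trans h1)// ler_wpM2l// ltW.
by rewrite exprSr -mulrA (le_trans h4)// ler_wpM2l ?exprn_ge0// ltW.
Qed.

Lemma flips_polynomial : exists (K : R) (B : nat), 0 < K /\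
  forall N i j, (i < N)%N -> (j < N)%N -> e i <= K * N%:R ^+ B * e j.
Proof.
have [b Cb] : exists b, C <= 2 ^+ b.
  exists (Num.bound C); apply: le_trans (ltW (archi_boundP (ltW C0))) _.
  by rewrite -natrX ler_nat ltnW// ltn_expl.
exists ((2 ^+ b) ^+ 2), (b + b)%N; split; first by rewrite !exprn_gt0.
move=> N i j iN jN; have N0 : (0 < N)%N by exact: leq_ltn_trans iN.
have [m mN Nm] := log2 N0.
have [h1 _] := clear_digits (ltn_trans iN Nm).
have [_ h2] := clear_digits (ltn_trans jN Nm).
have CN : C ^+ m.+1 <= 2 ^+ b * N%:R ^+ b.
  apply: (@le_trans _ _ ((2 ^+ b) ^+ m.+1)); first by rewrite lerXn2r ?nnegrE ?(ltW C0) ?exprn_ge0.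
  rewrite -exprM mulnC exprM -exprMn lerXn2r ?nnegrE ?exprn_ge0 ?mulr_ge0//.
  by rewrite exprS ler_pM2l// -natrX ler_nat.
apply: le_trans h1 _.
have -> : (2 ^+ b) ^+ 2 * N%:R ^+ (b + b) * e j =
  2 ^+ b * N%:R ^+ b * (2 ^+ b * N%:R ^+ b * e j) by rewrite exprD expr2; ring.
rewrite ler_pM ?exprn_ge0 ?(ltW C0) ?(ltW (e0 _))//.
by apply: le_trans h2 _; rewrite ler_wpM2r ?(ltW (e0 _)).
Qed.

(** Each doubling of a block of consecutive times adds a sibling block of
    comparable mass, so a single time carries an exponentially small proportion
    of its block of length [2 ^ m]. *)
Let block m q r : (r < 2 ^ m)%N ->
  (1 + C^-1) ^+ m * e (2 ^ m * q + r) <= \sum_(i < 2 ^ m) e (2 ^ m * q + i)%N.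
Proof.
elim: m q r => [|m IH] q r rm.
  by move: rm; rewrite ltnS leqn0 => /eqP->; rewrite big_ord1 mul1r.
rewrite -(big_mkord xpredT (fun i => e (2 ^ m.+1 * q + i)%N)).
rewrite (@big_cat_nat _ _ _ (2 ^ m) 0 (2 ^ m.+1))//=; last by rewrite leq_pexp2l.
rewrite -{2}[(2 ^ m)%N]add0n big_addn big_mkord.
have -> : (2 ^ m.+1 - 2 ^ m = 2 ^ m)%N by rewrite expnS; lia.
rewrite big_mkord.
set S1 := \sum_(i < 2 ^ m) e (2 ^ m.+1 * q + i)%N.
set S2 := \sum_(i < 2 ^ m) _.
have S21 : S2 <= C * S1.
  by rewrite /S1 mulr_sumr; apply: ler_sum => i _; rewrite addnA; have [] := flip q (ltn_ord i).
have S12 : S1 <= C * S2.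
  by rewrite /S2 mulr_sumr; apply: ler_sum => i _; rewrite addnA; have [] := flip q (ltn_ord i).
have i0 : 0 < C^-1 by rewrite invr_gt0.
have b0 : 0 <= 1 + C^-1 by rewrite addr_ge0// ltW.
rewrite exprS -mulrA; have [rm'|mr] := ltnP r (2 ^ m).
  have := IH (2 * q)%N r rm'; rewrite mulnA -expnSr -/S1 => h.
  apply: le_trans (ler_wpM2l b0 h) _.
  by rewrite mulrDl mul1r lerD2l mulrC ler_pdivrMr// mulrC.
have rm' : (r - 2 ^ m < 2 ^ m)%N by rewrite ltn_subLR// addnn -mul2n -expnS.
have := IH (2 * q).+1 (r - 2 ^ m)%N rm'.
have E i : (2 ^ m * (2 * q).+1 + i = 2 ^ m.+1 * q + (i + 2 ^ m))%N by rewrite expnS; ring.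
rewrite E subnK// (eq_bigr (fun i : 'I_(2 ^ m) => e (2 ^ m.+1 * q + (i + 2 ^ m))%N)); last first.
  by move=> i _; rewrite E.
rewrite -/S2 => h; apply: le_trans (ler_wpM2l b0 h) _.
rewrite mulrDl mul1r [S1 + S2]addrC lerD2l.
by rewrite mulrC ler_pdivrMr// mulrC.
Qed.

Lemma flips_no_dominant_term : exists (K al : R), [/\ 0 < K, 0 < al &
  forall N t, (t < N)%N -> e t <= K * N%:R `^ (- al) * \sum_(i < N) e i].
Proof.
pose q : R := 1 + C^-1.
have i0 : 0 < C^-1 by rewrite invr_gt0.
have q1 : 1 < q by rewrite ltrDl.
have q0 : 0 < q by exact: lt_trans q1.
have [s s0 qs] : exists2 s, (0 < s)%N & 2 <= q ^+ s.
  pose n := Num.bound C; exists n.+1 => //.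
  have bern j : 1 + j%:R * C^-1 <= q ^+ j.
    elim: j => [|j IH]; first by rewrite mul0r addr0.
    rewrite exprS; apply: le_trans (ler_wpM2l (ltW q0) IH).
    rewrite /q -natr1; have := mulr_ge0 (ltW i0) (mulr_ge0 (ler0n R j) (ltW i0)); lra.
  apply: le_trans (bern n.+1); rewrite -[2]/(1 + 1) lerD2l ler_pdivlMr// mul1r.
  by apply: le_trans (ltW (archi_boundP (ltW C0))) _; rewrite ler_nat leqnSn.
pose al : R := s%:R^-1.
have al0 : 0 < al by rewrite invr_gt0 ltr0n.
exists (C * 2 `^ al), al; split => //; first by rewrite mulr_gt0// powR_gt0.
move=> N t tN; have N0 : (0 < N)%N by exact: leq_ltn_trans tN.
have [m mN Nm] := log2 N0.
have NR0 : 0 < N%:R :> R by rewrite ltr0n.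
have qm : (N%:R / 2) `^ al <= q ^+ m.
  have -> : q ^+ m = (q ^+ (m * s)) `^ al.
    rewrite exprM -[X in _ = X `^ _]powR_mulrn ?exprn_ge0 ?(ltW q0)// -powRrM mulfV ?powRr1 ?exprn_ge0 ?(ltW q0)//.
    by rewrite pnatr_eq0 -lt0n.
  apply: ge0_ler_powR; rewrite ?nnegrE ?divr_ge0 ?exprn_ge0 ?(ltW q0) ?(ltW al0) ?(ltW NR0)//.
  rewrite mulnC exprM; apply: (@le_trans _ _ (2 ^+ m)); last by rewrite lerXn2r ?nnegrE ?exprn_ge0 ?(ltW q0).
  by rewrite ler_pdivrMr// -exprSr -natrX ler_nat ltnW.
have SN : \sum_(i < 2 ^ m) e i <= \sum_(i < N) e i.
  rewrite -!(big_mkord xpredT e) (@big_cat_nat _ _ _ (2 ^ m) 0 N)//= lerDl.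
  by apply: sumr_ge0 => i _; exact: ltW.
have mass r : (r < 2 ^ m)%N -> q ^+ m * e r <= \sum_(i < N) e i.
  move=> rm; apply: le_trans SN; have := block 0 rm; rewrite muln0 add0n.
  by under eq_bigr do rewrite add0n.
have SN0 : 0 <= \sum_(i < N) e i by apply: sumr_ge0 => i _; exact: ltW.
have {mass} key : q ^+ m * e t <= C * \sum_(i < N) e i.
  have [tm|mt] := ltnP t (2 ^ m); first by apply: le_trans (mass t tm) _; rewrite ler_peMl.
  have rm : (t - 2 ^ m < 2 ^ m)%N.
    by rewrite ltn_subLR// addnn -mul2n -expnS (ltn_trans tN).
  have := flip 0 rm; rewrite /= muln0 add0n subnK// => -[h1 _].
  apply: le_trans (ler_wpM2l (exprn_ge0 _ (ltW q0)) h1) _.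
  by rewrite mulrCA ler_wpM2l ?(ltW C0)// mass.
have p0 : 0 < (N%:R / 2) `^ al by rewrite powR_gt0// divr_gt0.
have -> : C * 2 `^ al * N%:R `^ (- al) * \sum_(i < N) e i =
    C * (\sum_(i < N) e i) / (N%:R / 2) `^ al.
  rewrite powRM ?invr_ge0 ?(ltW NR0)// -[2^-1]powR_inv1// -powRrM mulN1r !powRN invfM invrK.
  by ring.
rewrite ler_pdivlMr// mulrC; apply: le_trans key.
by rewrite ler_wpM2r ?(ltW (e0 _)).
Qed.

End digit_flips.

(** * Growth of the derivatives along the critical orbit *)

(** The derivative of [f^(n - j)] at [f^j x], by which a perturbation at time
    [j] is multiplied until time [n]. *)
Definition sens (R : realType) (f : R -> R) (x : R) (n j : nat) : R :=
  deriv_in (@I11 R) (iter (n - j) f) (iter j f x).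

Lemma pred_addn_lt i l n : (0 < i <= n)%N -> ((i + l).-1 < n + l)%N.
Proof. by case: i => // i /= i_n; rewrite ltn_add2r. Qed.

Section critical_orbits.
Variables (R : realType) (k : nat) (g : R -> R) (G : Cplx R -> Cplx R).
Variables (D : set (Cplx R)) (omega : R) (f : R -> R).
Hypothesis k0 : (0 < k)%N.
Hypothesis fp : doubling_fixed_point k g G D.
Hypothesis omega01 : 0 < omega < 1.
Hypothesis f_Ws : stable_manifold k G D omega f.

Let lt11 : (-1 : R) < 1. Proof. by lra. Qed.

Lemma stable_self x : I11 x -> I11 (f x).
Proof. by have [M H] := f_Ws; have [rf _] := H 0%N; exact: renorm_self rf x. Qed.

Lemma stable_orbit x i : I11 x -> I11 (iter i f x).
Proof. by move=> Ix; elim: i => [//|i IH]; exact: stable_self. Qed.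

Lemma I11_0 : @I11 R 0.
Proof. by rewrite /I11 /= in_itv /=; lra. Qed.

Lemma sens_critical : exists (a : nat -> R) (C : R),
  [/\ 1 <= C, forall t, 0 < a t,
    forall n q r, (r < 2 ^ n)%N -> let t := (2 ^ n.+1 * q + r)%N in
      a (t + 2 ^ n)%N <= C * a t /\ a t <= C * a (t + 2 ^ n)%N
  & forall l n j, (0 < j <= n)%N ->
      `|sens f (iter l f 0) n j| = a (n + l).-1 / a (j + l).-1].
Proof.
have [fh [fd [K [c [A [theta [lam0 [m0 /= [[c0 A0 th01 lam00] Hf HK [Hlow Hlam Hcon]]]]]]]]]] :=
  stable_estimates k0 fp omega01 f_Ws.
have fn_renorm n : renormalizable (iter n (@Tdoubling R) f).
  by have [M H] := f_Ws; have [] := H n.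
have [a [C [C1 a0 fl aE]]] := @critical_orbit_derivatives R f (fun n => iter n (@Tdoubling R) f)
  (2 * k).-1 (fun n x => (2 * k)%:R * fh n x + x * fd n x) K c A theta lam0 m0
  erefl (fun=> erefl) c0 A0 th01 lam00 fn_renorm (fun n x Ix => (Hf n x Ix).2) HK Hlow Hlam Hcon.
exists a, C; split => // l n j /andP[j0 jn].
have E : iter j f (iter l f 0) = iter (j + l).-1.+1 f 0.
  by rewrite -iterD prednK// addn_gt0 j0.
rewrite /sens E aE; congr (a _ / _).
by case: j j0 jn {E} => // j _ jn /=; lia.
Qed.

Lemma sens_self x n : I11 x -> sens f x n n = 1.
Proof.
move=> Ix; rewrite /sens subnn; apply: sder_deriv_in lt11 _ _; first exact: stable_orbit.
exact: sder_id.
Qed.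

Lemma sens_step x n j : I11 x -> (j <= n)%N ->
  sens f x n.+1 j = deriv_in (@I11 R) f (iter n f x) * sens f x n j.
Proof.
move=> Ix jn.
have [fh [fd [K [c [A [theta [lam0 [m0 /= [_ Hf _ _]]]]]]]]] :=
  stable_estimates k0 fp omega01 f_Ws.
pose d y := y ^+ (2 * k).-1 * ((2 * k)%:R * fh 0%N y + y * fd 0%N y).
have sf y : I11 y -> sder (@I11 R) f y (d y) by move=> Iy; have [_] := Hf 0%N y Iy.
have sit s z : I11 z -> sder (@I11 R) (iter s f) z (\prod_(i < s) d (iter i f z)).
  move=> Iz; elim: s => [|s IH]; first by rewrite big_ord0; exact: sder_id.
  rewrite big_ord_recr /= mulrC.
  by apply: (sder_comp Iz _ IH); [move=> y; exact: stable_orbit|exact/sf/stable_orbit].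
have Ij := stable_orbit j Ix.
rewrite /sens subSn// (sder_deriv_in lt11 Ij (sit _ _ Ij)) (sder_deriv_in lt11 Ij (sit _ _ Ij)).
rewrite (sder_deriv_in lt11 (stable_orbit n Ix) (sf _ (stable_orbit n Ix))).
by rewrite big_ord_recr /= mulrC -iterD subnK.
Qed.

(** The squared derivatives are proportional to the inverse squares of the
    sequence [a] of [sens_critical], and these are as invariant under digit flips
    as [a] itself. The constant depends on [l] because the sums over the times
    after [l] must make up for the [l] missing first terms. *)
Lemma sens_growth : exists (al : R) (B : nat), 0 < al /\ forall l,
  exists2 C : R, 0 < C &
  forall n, (0 < n)%N -> let x := iter l f 0 in
   (forall j, (0 < j <= n)%N ->
     sens f x n j ^+ 2 <= C * n%:R `^ (- al) * \sum_(1 <= i < n.+1) sens f x n i ^+ 2) /\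
   (forall i j, (0 < j <= i)%N -> (i <= n)%N -> `|sens f x i j| <= C * n%:R ^+ B).
Proof.
have [a [C [C1 a0 fl aE]]] := sens_critical.
pose e t := (a t ^+ 2)^-1.
have e0 t : 0 < e t by rewrite invr_gt0 exprn_gt0.
have C0 : 0 < C by exact: lt_le_trans C1.
have C21 : 1 <= C ^+ 2 by rewrite exprn_ege1.
have efl n q r : (r < 2 ^ n)%N -> let t := (2 ^ n.+1 * q + r)%N in
    e (t + 2 ^ n)%N <= C ^+ 2 * e t /\ e t <= C ^+ 2 * e (t + 2 ^ n)%N.
  have cmp s t : a s <= C * a t -> e t <= C ^+ 2 * e s.
    move=> st; rewrite /e -ler_pdivrMr ?invr_gt0 ?exprn_gt0// invrK mulrC.
    rewrite ler_pdivrMr ?exprn_gt0// -exprMn lerXn2r ?nnegrE ?(ltW (a0 _))//.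
    by rewrite mulr_ge0 ?(ltW C0) ?(ltW (a0 _)).
  by move=> rn t; have [h1 h2] := fl n q r rn; split; exact: cmp.
have [Kp [B [Kp0 HB]]] := flips_polynomial C21 e0 efl.
have [Kd [al [Kd0 al0 Hd]]] := flips_no_dominant_term C21 e0 efl.
exists al, B; split => // l.
pose Ml := (\sum_(i < l) e i) / e l.
have Ml0 : 0 <= Ml by rewrite divr_ge0 ?(ltW (e0 l))// sumr_ge0// => i _; exact: ltW.
pose L : R := l.+1%:R.
have L1 : 1 <= L by rewrite ler1n.
exists (Kd * (1 + Ml) + (1 + Kp * L ^+ B)).
  have h1 : 0 < Kd * (1 + Ml) by rewrite mulr_gt0// ltr_pwDl.
  have h2 : 0 < Kp * L ^+ B by rewrite mulr_gt0// exprn_gt0// (lt_le_trans _ L1).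
  by lra.
move=> n n0 x.
have n1 : 1 <= n%:R :> R by rewrite ler1n.
have nR0 : 0 < n%:R :> R by rewrite ltr0n.
have nl : (n + l)%:R <= L * n%:R :> R.
  by rewrite /L -natrM ler_nat mulSn leq_add2l leq_pmulr.
have sq j : (0 < j <= n)%N -> sens f x n j ^+ 2 = a (n + l).-1 ^+ 2 * e (j + l).-1.
  by move=> jn; rewrite -[LHS]real_normK ?num_real// aE// expr_div_n.
split.
  move=> j jn; rewrite (sq j jn).
  have -> : \sum_(1 <= i < n.+1) sens f x n i ^+ 2 =
      a (n + l).-1 ^+ 2 * \sum_(l <= i < n + l) e i.
    rewrite mulr_sumr -{1}[l]add0n big_addn addnK big_add1 /= !big_mkord.
    by apply: eq_bigr => i _; rewrite sq ?ltn_ord.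
  rewrite mulrCA ler_pM2l ?exprn_gt0//.
  have jl := pred_addn_lt l jn.
  apply: le_trans (Hd _ _ jl) _.
  have lnl : (l <= n + l)%N by exact: leq_addl.
  have sumE : \sum_(i < n + l) e i <= (1 + Ml) * \sum_(l <= i < n + l) e i.
    rewrite -(big_mkord xpredT e) (@big_cat_nat _ _ _ l 0 (n + l))//= big_mkord.
    rewrite mulrDl mul1r addrC lerD2l /Ml -mulrA ler_peMr ?sumr_ge0//.
      by move=> i _; exact: ltW.
    rewrite mulrC ler_pdivlMr// mul1r big_ltn -1?[X in (X < _)%N]add0n ?ltn_add2r//.
    by rewrite lerDl sumr_ge0// => i _; exact: ltW.
  have S0 : 0 <= \sum_(l <= i < n + l) e i by apply: sumr_ge0 => i _; exact: ltW.
  have pw : (n + l)%:R `^ (- al) <= n%:R `^ (- al).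
    rewrite !powRN lef_pV2 ?posrE ?powR_gt0// ?ltr0n ?addn_gt0 ?n0//.
    by apply: ge0_ler_powR; rewrite ?nnegrE ?(ltW al0) ?ler_nat ?leq_addr.
  apply: (@le_trans _ _ (Kd * n%:R `^ (- al) * ((1 + Ml) * \sum_(l <= i < n + l) e i))).
    rewrite ler_pM ?mulr_ge0 ?powR_ge0 ?(ltW Kd0) ?sumr_ge0//; last by rewrite ler_wpM2l ?(ltW Kd0).
    by move=> i _; exact: ltW.
  rewrite mulrA ler_wpM2r// mulrAC ler_wpM2r ?powR_ge0// lerDl.
  by rewrite addr_ge0// mulr_ge0 ?(ltW Kp0) ?exprn_ge0// (le_trans _ L1).
move=> i j ji i_n; rewrite aE//.
have i0 : (0 < i)%N by case/andP: ji => h1 h2; exact: leq_trans h2.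
set s := (i + l).-1; set t := (j + l).-1.
have sn : (s < n + l)%N by apply: pred_addn_lt; rewrite i0.
have tn : (t < n + l)%N by case/andP: ji => j0 ji; apply: pred_addn_lt; rewrite j0 (leq_trans ji).
have r0 : 0 < a s / a t by rewrite divr_gt0.
have : (a s / a t) ^+ 2 <= Kp * L ^+ B * n%:R ^+ B.
  have -> : (a s / a t) ^+ 2 = e t / e s by rewrite /e expr_div_n invrK mulrC.
  rewrite ler_pdivrMr//; apply: le_trans (HB _ _ _ tn sn) _.
  rewrite ler_wpM2r ?(ltW (e0 _))// -mulrA ler_wpM2l ?(ltW Kp0)//.
  by rewrite -exprMn lerXn2r ?nnegrE ?ler0n// mulr_ge0// (le_trans _ L1).
have : 1 <= n%:R ^+ B :> R by rewrite exprn_ege1.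
have : 0 <= Kd * (1 + Ml) * n%:R ^+ B.
  by rewrite !mulr_ge0 ?exprn_ge0 ?(ltW Kd0) ?addr_ge0.
have : 2 * (a s / a t) <= 1 + (a s / a t) ^+ 2.
  by rewrite -subr_ge0; have := sqr_ge0 (a s / a t - 1); congr (_ <= _); ring.
set y := a s / a t in r0 *; set z := n%:R ^+ B; set w := Kd * (1 + Ml) * z.
have -> : (Kd * (1 + Ml) + (1 + Kp * L ^+ B)) * z = w + z + Kp * L ^+ B * z by rewrite /w; ring.
by set v := Kp * _ * z; set y2 := y ^+ 2; lra.
Qed.

(** [|x|^q = x^2 (x^2)^((q-2)/2)], and the second factor is uniformly small
    compared with the sum of squares by [sens_growth]. *)
Lemma sens_ratio : exists2 al : R, 0 < al & forall l, exists2 C : R, 0 < C &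
  forall n (q : R), (0 < n)%N -> 2 <= q ->
  \sum_(1 <= j < n.+1) `|sens f (iter l f 0) n j| `^ q <=
  (C * n%:R `^ (- al)) `^ ((q - 2) / 2) *
  (\sum_(1 <= j < n.+1) sens f (iter l f 0) n j ^+ 2) `^ (q / 2).
Proof.
have [al [B [al0 H]]] := sens_growth.
exists al => // l; have [C C0 HC] := H l; exists C => // n q n0 q2.
have [/= Hd _] := HC n n0.
set x := iter l f 0 in Hd *.
set S := \sum_(1 <= j < n.+1) sens f x n j ^+ 2 in Hd *.
have S0 : 0 < S.
  rewrite /S big_nat_recr//= sens_self; last exact/stable_orbit/I11_0.
  by rewrite expr1n ltr_wpDl// sumr_ge0// => i _; exact: sqr_ge0.
set eps := C * n%:R `^ (- al) in Hd *.
have eps0 : 0 <= eps by rewrite mulr_ge0 ?powR_ge0 ?(ltW C0).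
have -> : S `^ (q / 2) = S * S `^ ((q - 2) / 2).
  have -> : q / 2 = 1 + (q - 2) / 2 by field.
  by rewrite powRD ?(gt_eqF S0) ?implybT// powRr1// ltW.
rewrite mulrCA -powRM ?(ltW S0)// {1}/S mulr_suml.
rewrite big_nat_cond [X in _ <= X]big_nat_cond; apply: ler_sum => j; rewrite andbT => j1n.
rewrite ltnS in j1n; set y := sens f x n j.
have E : `|y| `^ q = y ^+ 2 * (y ^+ 2) `^ ((q - 2) / 2).
  rewrite -[y ^+ 2]real_normK ?num_real// -powR_mulrn// -powRrM.
  have [y0|y0] := eqVneq `|y| 0.
    have q0 : q != 0 by rewrite gt_eqF// (lt_le_trans _ q2).
    by rewrite y0 (powR0 q0) (@powR0 R 2) ?mul0r ?pnatr_eq0.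
  by rewrite -powRD ?y0 ?implybT//; congr (_ `^ _); field.
rewrite E ler_wpM2l ?sqr_ge0//; apply: ge0_ler_powR.
- by rewrite divr_ge0// subr_ge0.
- by rewrite nnegrE sqr_ge0.
- by rewrite nnegrE mulr_ge0// ltW.
- exact: Hd.
Qed.

Lemma sens_sum_gt0 l n : (0 < n)%N -> 1 <= \sum_(1 <= j < n.+1) sens f (iter l f 0) n j ^+ 2.
Proof.
case: n => // n _; rewrite big_nat_recr//= sens_self; last exact/stable_orbit/I11_0.
by rewrite expr1n lerDr sumr_ge0// => i _; exact: sqr_ge0.
Qed.

Lemma powR_small (s : R) : 0 < s -> (n.+1%:R : R) `^ (- s) @[n --> \oo] --> 0.
Proof.
move=> s0; apply/cvgrPdist_lt => e e0.
pose M := (e^-1) `^ s^-1.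
exists (Num.bound M) => // n /= Mn; rewrite sub0r normrN ger0_norm ?powR_ge0//.
have nR : 0 < n.+1%:R :> R by rewrite ltr0n.
rewrite powRN -[e]invrK ltf_pV2 ?posrE ?powR_gt0 ?invr_gt0//.
have -> : e^-1 = M `^ s by rewrite /M -powRrM mulVf ?gt_eqF// powRr1// invr_ge0 ltW.
rewrite gt0_ltr_powR ?nnegrE ?powR_ge0 ?(ltW nR)//.
apply: lt_le_trans (archi_boundP (powR_ge0 _ _)) _.
by rewrite ler_nat (leq_trans Mn).
Qed.

Lemma Lam_ratio_cvg l p : 2 < p ->
  Lam p f (iter l f 0) n / Lam 2 f (iter l f 0) n `^ (p / 2) @[n --> \oo] --> (0 : R).
Proof.
move=> p2; have [al al0 Hal] := sens_ratio; have [C C0 H] := Hal l.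
have Lam2 n : Lam 2 f (iter l f 0) n = \sum_(1 <= j < n.+1) sens f (iter l f 0) n j ^+ 2.
  by apply: eq_bigr => j _; rewrite powR_mulrn// real_normK ?num_real.
pose u n := C `^ ((p - 2) / 2) * (n.+1%:R : R) `^ (- (al * ((p - 2) / 2))).
have r0 : 0 < (p - 2) / 2 by rewrite divr_gt0// subr_gt0.
rewrite -cvg_shiftS /=; apply: (@squeeze_cvgr _ _ _ _ (fun=> 0) u).
- near=> n; have S1 := sens_sum_gt0 l (ltn0Sn n); rewrite Lam2.
  set S := \sum_(1 <= j < n.+2) sens f (iter l f 0) n.+1 j ^+ 2 in S1 *.
  have Sp : 0 < S `^ (p / 2) by rewrite powR_gt0// (lt_le_trans _ S1).
  have L0 : 0 <= Lam p f (iter l f 0) n.+1 by apply: sumr_ge0 => j _; exact: powR_ge0.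
  rewrite divr_ge0 ?(ltW Sp)//=.
  rewrite ler_pdivrMr//; apply: le_trans (H n.+1 p _ (ltW p2)) _ => //.
  rewrite ler_wpM2r ?(ltW Sp)// /u powRM ?(ltW C0) ?powR_ge0//.
  by rewrite -powRrM mulNr.
- exact: cvg_cst.
- rewrite -[0](mulr0 (C `^ ((p - 2) / 2))); apply: cvgM; first exact: cvg_cst.
  by apply: powR_small; rewrite mulr_gt0.
Unshelve. all: by end_near. Qed.

End critical_orbits.

(** * The Gaussian density and Stein's equation *)

Section gaussian.
Variable R : realType.
Notation mu := (@lebesgue_measure R).

Definition gauss (x : R) : R := normal_pdf 0 1 x.

Lemma gaussE x : gauss x = (Num.sqrt (2 * pi))^-1 * expR (- (x ^+ 2) / 2).
Proof.
rewrite /gauss normal_pdfE ?oner_eq0// /normal_peak /normal_fun subr0 expr1n.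
by rewrite mul1r mulr_natl.
Qed.

Lemma gauss_gt0 x : 0 < gauss x.
Proof. by rewrite gaussE mulr_gt0 ?expR_gt0// invr_gt0 sqrtr_gt0 mulr_gt0 ?pi_gt0. Qed.

Lemma gauss_ge0 x : 0 <= gauss x. Proof. exact/ltW/gauss_gt0. Qed.

Lemma gauss_sym x : gauss (- x) = gauss x.
Proof. by rewrite !gaussE sqrrN. Qed.

Lemma gauss_le_expR x : gauss x <= expR (- (x ^+ 2) / 2).
Proof.
rewrite gaussE ler_piMl ?expR_ge0// invf_le1 ?sqrtr_gt0 ?mulr_gt0 ?pi_gt0//.
rewrite -[X in X <= _]sqrtr1 ler_sqrt; last by rewrite mulr_ge0// pi_ge0.
by have := pi_ge2 R; lra.
Qed.

Lemma gauss_le1 x : gauss x <= 1.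
Proof.
apply: le_trans (gauss_le_expR x) _.
by rewrite -[X in _ <= X]expR0 ler_expR mulNr oppr_le0 divr_ge0// sqr_ge0.
Qed.

Lemma continuous_gauss : continuous gauss.
Proof. by apply: continuous_normal_pdf; rewrite oner_eq0. Qed.

Lemma measurable_gauss : measurable_fun setT gauss.
Proof. exact: measurable_normal_pdf. Qed.

Lemma integrable_gauss D : measurable D -> mu.-integrable D (EFin \o gauss).
Proof.
by move=> mD; apply: (integrableS measurableT mD (@subsetT _ _)); exact: integrable_normal_pdf.
Qed.

Lemma Rintegral_gauss : \int[mu]_x gauss x = 1.
Proof. by rewrite /Rintegral integral_normal_pdf. Qed.

Lemma is_derive_expR_sqr (c x : R) :
  is_derive x 1 (fun y => expR (c * y ^+ 2)) (2 * c * x * expR (c * x ^+ 2)).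
Proof.
have dq : is_derive x 1 (fun y : R => c * y ^+ 2) (2 * c * x).
  apply: is_derive_eq; by rewrite /GRing.scale /=; ring.
have := @is_derive1_comp _ expR (fun y => c * y ^+ 2) x _ _ (is_derive_expR _) dq.
by rewrite mulrC.
Qed.

Lemma is_derive_gauss (x : R) : is_derive x 1 gauss (- x * gauss x).
Proof.
have -> : gauss = fun y => (Num.sqrt (2 * pi))^-1 * expR (- 2^-1 * y ^+ 2).
  by apply/funext => y; rewrite gaussE; congr (_ * expR _); field.
have h := @is_deriveZ _ _ _ _ (Num.sqrt (2 * pi))^-1 _ _ _ (is_derive_expR_sqr (- 2^-1) x).
apply: (is_derive_eq h); rewrite /GRing.scale /=.
by move: (Num.sqrt _)^-1 (expR _) => u v; field.
Qed.

Lemma gauss_tail (a : R) : 0 < a -> \int[mu]_(x in `[a, +oo[) gauss x <= gauss a / a.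
Proof.
move=> a0.
have cf : continuous (fun x : R => x * gauss x).
  by move=> x; apply: cvgM; [exact: cvg_id|exact: continuous_gauss].
have lim0 : (- gauss x) @[x --> +oo%R] --> (0 : R).
  rewrite -[0]oppr0; apply: cvgN.
  apply: (@squeeze_cvgr _ _ _ _ (fun=> 0) (fun x => expR (- x))).
  - near=> x; rewrite gauss_ge0 /=; apply: le_trans (gauss_le_expR x) _.
    have x2 : 2 <= x by near: x; apply: nbhs_pinfty_ge; rewrite num_real.
    rewrite ler_expR; have : 0 <= x * (x - 2) by rewrite mulr_ge0; lra.
    by rewrite expr2; lra.
  - exact: cvg_cst.
  - exact: cvgr_expR.
have dg (x : R) : is_derive x 1 (fun x => - gauss x) (x * gauss x).
  have := @is_deriveN _ _ _ _ _ _ _ (is_derive_gauss x).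
  by rewrite mulNr opprK.
have E : (\int[mu]_(x in `[a, +oo[) (x * gauss x)%:E = (gauss a)%:E)%E.
  rewrite (@ge0_continuous_FTC2y _ _ (fun x => - gauss x) a 0).
  - by rewrite -EFinB sub0r opprK.
  - by move=> x ax; rewrite mulr_ge0 ?gauss_ge0// (le_trans (ltW a0)).
  - by apply: continuous_subspaceT => x; exact: cf.
  - exact: lim0.
  - by move=> x _; exact: ex_derive.
  - apply: cvg_at_right_filter; apply: cvgN; exact: continuous_gauss.
  - by move=> x _; rewrite derive1E derive_val.
rewrite -lee_fin /Rintegral fineK; last first.
  by apply: integrable_fin_num => //; exact: integrable_gauss.
apply: (@le_trans _ _ (\int[mu]_(x in `[a, +oo[) (a^-1 * (x * gauss x))%:E)%E).
  apply: ge0_le_integral => //.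
  - by move=> x _; rewrite lee_fin gauss_ge0.
  - by apply/measurable_EFinP; apply: measurable_funTS; exact: measurable_gauss.
  - apply/measurable_EFinP; apply: measurable_funTS; apply: measurable_funM => //.
    exact: continuous_measurable_fun.
  - move=> x; rewrite /= in_itv /= andbT => ax; rewrite lee_fin mulrA ler_peMl ?gauss_ge0//.
    by rewrite mulrC ler_pdivlMr// mul1r.
under eq_integral do rewrite EFinM.
rewrite ge0_integralZl//.
- by rewrite E -EFinM mulrC.
- by apply/measurable_EFinP; apply: measurable_funTS; exact: continuous_measurable_fun.
- move=> x; rewrite /= in_itv /= andbT => ax; rewrite lee_fin.
  by rewrite mulr_ge0 ?gauss_ge0// (le_trans (ltW a0)).
- by rewrite lee_fin invr_ge0 ltW.
Unshelve. all: by end_near. Qed.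

Lemma gauss_tailN (a : R) : 0 < a -> \int[mu]_(x in `]-oo, (- a)]) gauss x <= gauss a / a.
Proof.
move=> a0; apply: le_trans (gauss_tail a0).
rewrite /Rintegral ge0_integration_by_substitutionNy//.
- rewrite le_eqVlt; apply/orP; left; apply/eqP; congr fine.
  by apply: eq_integral => x _ /=; rewrite gauss_sym.
- by apply: continuous_subspaceT => x; exact: continuous_gauss.
- by move=> x _; exact: gauss_ge0.
Qed.

(** Stein's equation for a test function [psi]. Up to the factor [gauss], its
    solution is the integral of [psi - N] against the Gaussian over a half line;
    as the total integral vanishes, either half line may be used, whence the
    decay of the solution at both ends. *)
Lemma stein_solution : exists2 A : R, 0 < A & forall psi : R -> R, continuous psi ->
  (forall x, 0 <= psi x <= 1) ->
  let N := \int[mu]_x (psi x * gauss x) in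
  exists f : R -> R, (forall x : R, is_derive x 1 f (x * f x + psi x - N)) /\
    forall x, `|f x| <= A /\ `|x * f x| <= A.
Proof.
exists ((gauss 1)^-1); first by rewrite invr_gt0 gauss_gt0.
move=> psi cpsi psi01 N.
have mpsi : measurable_fun setT psi by exact: continuous_measurable_fun.
have ipsi : mu.-integrable setT (EFin \o (fun x => psi x * gauss x)).
  apply: (le_integrable measurableT _ _ (integrable_gauss measurableT)).
  - by apply/measurable_EFinP; apply: measurable_funM => //; exact: measurable_gauss.
  - move=> x _ /=; rewrite lee_fin normrM ler_piMl//.
    by have /andP[p0 p1] := psi01 x; rewrite ger0_norm.
have iN : mu.-integrable setT (EFin \o (fun x => N * gauss x)).
  by apply: (integrableZl measurableT N (integrable_gauss measurableT)).
pose hg (x : R) := psi x * gauss x - N * gauss x.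
have ihg : mu.-integrable setT (EFin \o hg).
  by apply: (integrableB measurableT ipsi iN).
have N0 : 0 <= N.
  by apply: Rintegral_ge0 => x _; rewrite mulr_ge0 ?gauss_ge0//; case/andP: (psi01 x).
have N1 : N <= 1.
  rewrite -Rintegral_gauss; apply: le_Rintegral => //; first exact: integrable_gauss.
  by move=> x _; rewrite ler_piMl ?gauss_ge0//; case/andP: (psi01 x).
have hg_le x : `|hg x| <= gauss x.
  rewrite /hg -mulrBl normrM (ger0_norm (gauss_ge0 x)) ler_piMl ?gauss_ge0//.
  by have /andP[p0 p1] := psi01 x; rewrite ler_norml; apply/andP; split; lra.
have chg : continuous hg.
  by move=> x; apply: cvgB; apply: cvgM => //;
    [exact: cpsi|exact: continuous_gauss|exact: cvg_cst|exact: continuous_gauss].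
have int0 : \int[mu]_x hg x = 0.
  rewrite RintegralB// RintegralZl//; last exact: integrable_gauss.
  by rewrite Rintegral_gauss mulr1 subrr.
pose U (x : R) := \int[mu]_(t in `]-oo, x]) hg t.
have iS D : measurable D -> mu.-integrable D (EFin \o hg).
  by move=> mD; exact: (integrableS measurableT mD (@subsetT _ _)).
have dU (x : R) : is_derive x 1 U (hg x).
  have [] := @continuous_FTC1 R hg -oo%O x (x + 1) _ (iS _ _) _ (chg x).
  - by rewrite ltrDl.
  - exact: measurable_itv.
  - by rewrite ltNyr.
  by move=> dU UE; split; [exact: dU|rewrite -derive1E; exact: UE].
have Ule D : measurable D -> `|\int[mu]_(t in D) hg t| <= \int[mu]_(t in D) gauss t.
  move=> mD; apply: le_trans (le_normr_Rintegral mD (iS D mD)) _.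
  apply: le_Rintegral => //; [|exact: integrable_gauss].
  by have := integrable_norm (iS D mD).
have Uneg x : U x = - \int[mu]_(t in `]x, +oo[) hg t.
  have := @Rintegral_itvB R hg -oo%O +oo%O x; rewrite set_itvNyy int0 sub0r => <- //.
    by rewrite opprK.
pose ginv (x : R) := Num.sqrt (2 * pi) * expR (2^-1 * x ^+ 2) : R.
have ginvE x : ginv x = (gauss x)^-1.
  rewrite gaussE invfM invrK -expRN /ginv; congr (_ * expR _).
  by field.
exists (fun x => U x * ginv x); split.
  move=> x.
  have h := @is_deriveM _ _ _ _ _ _ _ _ (dU x)
    (@is_deriveZ _ _ _ _ (Num.sqrt (2 * pi)) _ _ _ (is_derive_expR_sqr 2^-1 x)).
  apply: (is_derive_eq h); rewrite /GRing.scale /= -/(ginv x) /hg.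
  have E : gauss x * ginv x = 1 by rewrite ginvE mulfV// gt_eqF// gauss_gt0.
  have -> : Num.sqrt (2 * pi) * (2 / 2 * x * expR (2^-1 * x ^+ 2)) = x * ginv x.
    by rewrite /ginv; field.
  have -> : ginv x * (psi x * gauss x - N * gauss x) = (psi x - N) * (gauss x * ginv x) by ring.
  by rewrite E; ring.
have g10 := gauss_gt0 1.
have key x : `|U x| <= gauss x / gauss 1 /\ `|x| * `|U x| <= gauss x / gauss 1.
  have gx0 := gauss_gt0 x.
  have ginv1 : 1 <= (gauss 1)^-1 by rewrite -[X in X <= _]invr1 lef_pV2 ?posrE// gauss_le1.
  have far : 1 <= `|x| -> `|x| * `|U x| <= gauss x.
    move=> x1; have x0 : 0 < `|x| by exact: lt_le_trans x1.
    rewrite mulrC -ler_pdivlMr//.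
    have [xp|xn] := leP 0 x.
      rewrite (ger0_norm xp) in x0 *; rewrite Uneg normrN.
      apply: le_trans (Ule _ (measurable_itv _)) _.
      rewrite Rintegral_itv_obnd_cbnd; last exact: integrable_gauss.
      exact: gauss_tail.
    rewrite (ltr0_norm xn) in x0 *.
    apply: le_trans (Ule _ (measurable_itv _)) _.
    by rewrite -{1}[x]opprK -[gauss x]gauss_sym; exact: gauss_tailN.
  have [x1|x1] := leP 1 `|x|.
    have h := far x1; have h2 : `|x| * `|U x| <= gauss x / gauss 1.
      by apply: le_trans h _; rewrite ler_peMr// ltW.
    by split => //; apply: le_trans h2; rewrite ler_peMl.
  have g1x : gauss 1 <= gauss x.
    rewrite !gaussE ler_pM2l ?invr_gt0 ?sqrtr_gt0 ?mulr_gt0 ?pi_gt0//.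
    rewrite ler_expR !mulNr lerN2 ler_pM2r ?invr_gt0// -[x ^+ 2]real_normK ?num_real//.
    by rewrite lerXn2r ?nnegrE// ltW.
  have U1 : `|U x| <= 1.
    apply: le_trans (Ule _ (measurable_itv _)) _; rewrite -Rintegral_gauss.
    rewrite /Rintegral fine_le//.
    - by apply: integrable_fin_num => //; exact: integrable_gauss.
    - by apply: integrable_fin_num => //; exact: integrable_gauss.
    - apply: ge0_subset_integral => //.
        by apply/measurable_EFinP; exact: measurable_gauss.
      by move=> y _; rewrite lee_fin gauss_ge0.
  have h2 : `|U x| <= gauss x / gauss 1.
    by apply: le_trans U1 _; rewrite ler_pdivlMr// mul1r.
  by split => //; apply: le_trans h2; rewrite ler_piMl// ltW.
move=> x; have [h1 h2] := key x.
have gi : `|ginv x| = (gauss x)^-1 by rewrite ginvE ger0_norm// invr_ge0 gauss_ge0.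
have gx0 := gauss_gt0 x.
split; first by rewrite normrM gi ler_pdivrMr// mulrC.
by rewrite mulrA normrM gi normrM ler_pdivrMr// [X in _ <= X]mulrC.
Qed.

End gaussian.

(** * Independence of partial sums *)

(** Rectangles generate the product sigma-algebra and are stable under
    intersection. *)
Lemma rectangles_unique (R : realType) d1 d2 (T1 : measurableType d1) (T2 : measurableType d2)
    (m1 m2 : {measure set (T1 * T2) -> \bar R}) :
  (m1 setT < +oo)%E ->
  (forall A B, measurable A -> measurable B -> m1 (A `*` B) = m2 (A `*` B)) ->
  forall Z, measurable Z -> m1 Z = m2 Z.
Proof.
move=> fin m12 Z mZ.
pose C : set (set (T1 * T2)) :=
  [set C | exists A, measurable A /\ exists B, measurable B /\ C = A `*` B].
have CI : setI_closed C.
  move=> /= _ _ [X1 [mX1 [X2 [mX2 ->]]]] [Y1 [mY1 [Y2 [mY2 ->]]]].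
  rewrite -setXI; exists (X1 `&` Y1); split; first exact: measurableI.
  by exists (X2 `&` Y2); split => //; exact: measurableI.
apply: (measure_unique C (fun=> setT)) => //.
- rewrite measurable_prod_measurableType //; congr (<<s _ >>).
  rewrite predeqE; split => [[A mA [B mB <-]]|[A [mA [B [mB ->]]]]].
    by exists A; split => //; exists B.
  by exists A => //; exists B.
- by move=> n; exists setT; split => //; exists setT; split => //; rewrite setXTT.
- by rewrite bigcup_const//; exists 0%N.
- by move=> _ [A1 [mA1 [A2 [mA2 ->]]]]; rewrite m12.
Qed.

Section pair_of_random_variables.
Context {d : measure_display} {Omega : measurableType d} {R : realType}.
Variables (X Y : {mfun Omega >-> R}).

Definition pairRV (w : Omega) : R * R := (X w, Y w).

Let measurable_pairRV : measurable_fun setT pairRV.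
Proof. by apply: measurable_fun_pair; [exact: (measurable_funPT X)|exact: (measurable_funPT Y)]. Qed.

HB.instance Definition _ := isMeasurableFun.Build _ _ _ _ pairRV measurable_pairRV.

End pair_of_random_variables.

Section independence.
Local Open Scope ereal_scope.
Context {d : measure_display} {Omega : measurableType d} {R : realType}.
Variable P : probability Omega R.

(** Independence of a pair from an event need only be checked on rectangles;
    this is what lets functions of both variables, such as partial sums, inherit
    independence. *)
Lemma indep_event (X Y : {RV P >-> R}) (E : set Omega) : measurable E ->
  (forall A B : set R, measurable A -> measurable B ->
    P (X @^-1` A `&` Y @^-1` B `&` E) = P (X @^-1` A `&` Y @^-1` B) * P E) ->
  forall Z : set (R * R), measurable Z ->
    P (pairRV X Y @^-1` Z `&` E) = P (pairRV X Y @^-1` Z) * P E.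
Proof.
move=> mE H Z mZ.
have PE0 : (0 <= fine (P E))%R by apply: fine_ge0.
have mXY : measurable_fun setT (pairRV X Y) by exact: measurable_funPT.
pose m1 : {measure set (R * R) -> \bar R} :=
  pushforward (mrestr P mE) (pairRV X Y).
pose m2 : {measure set (R * R) -> \bar R} :=
  mscale (NngNum PE0) (distribution P (pairRV X Y)).
have m2E A : m2 A = P (pairRV X Y @^-1` A) * P E.
  by rewrite muleC -[in RHS](fineK (fin_num_measure P _ mE)).
rewrite -m2E; apply: (@rectangles_unique R _ _ _ _ (m1 mXY) m2) => //.
  by rewrite /m1 /= /pushforward /mrestr preimage_setT setTI (le_lt_trans (probability_le1 _ mE))// ltry.
by move=> A B mA mB; rewrite m2E; exact: H.
Qed.

Definition indep (X Y : {RV P >-> R}) := forall A B : set R, measurable A -> measurable B ->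
  P (X @^-1` A `&` Y @^-1` B) = P (X @^-1` A) * P (Y @^-1` B).

Section expectation_of_product.
Variables (X Y : {RV P >-> R}) (XY : indep X Y).

Let law_pair (h : R * R -> \bar R) :
  \int[distribution P (pairRV X Y)]_z h z = \int[distribution P X \x distribution P Y]_z h z.
Proof.
apply: eq_measure_integral => A mA _.
apply: (@rectangles_unique _ _ _ _ _ (distribution P (pairRV X Y))
  (distribution P X \x distribution P Y)) => //.
  by rewrite /= /distribution /pushforward preimage_setT probability_setT ltry.
move=> B C mB mC; rewrite -[RHS]/((distribution P X \x distribution P Y) (B `*` C)).
by rewrite product_measure1E//; exact: XY.
Qed.

Let mprod (u v : R -> R) : measurable_fun setT u -> measurable_fun setT v ->
  measurable_fun setT (fun z : R * R => (u z.1 * v z.2)%:E).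
Proof.
move=> mu mv; apply/measurable_EFinP; apply: measurable_funM.
  exact: (measurableT_comp mu measurable_fst).
exact: (measurableT_comp mv measurable_snd).
Qed.

Let law1 (Z : {RV P >-> R}) (u : R -> R) : measurable_fun setT u ->
  P.-integrable setT (EFin \o (u \o Z)) ->
  \int[distribution P Z]_x (u x)%:E = \int[P]_w (u (Z w))%:E.
Proof.
move=> mu iu; rewrite integral_distribution//; first exact/measurable_EFinP.
Qed.

Let absM (u v : R -> R) : measurable_fun setT u -> measurable_fun setT v ->
  \int[distribution P X \x distribution P Y]_z `|(u z.1 * v z.2)%:E|
  = (\int[P]_w `|u (X w)|%:E) * (\int[P]_w `|v (Y w)|%:E).
Proof.
move=> mu mv.
have mau : measurable_fun setT (fun x => `|u x|%R) by exact: measurableT_comp.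
have mav : measurable_fun setT (fun x => `|v x|%R) by exact: measurableT_comp.
under eq_integral do rewrite /= normrM.
rewrite fubini_tonelli1//; last exact: (mprod mau mav).
rewrite /fubini_F /=.
under eq_integral => x _.
  under eq_integral do rewrite EFinM.
  rewrite ge0_integralZl//=; last exact/measurable_EFinP.
  over.
rewrite ge0_integralZr//=; last 2 first.
- exact/measurable_EFinP.
- exact: integral_ge0.
rewrite !ge0_integral_distribution//; try exact/measurable_EFinP.
Qed.

Lemma indep_integrable (u v : R -> R) : measurable_fun setT u -> measurable_fun setT v ->
  P.-integrable setT (EFin \o (u \o X)) -> P.-integrable setT (EFin \o (v \o Y)) ->
  P.-integrable setT (EFin \o (fun w => u (X w) * v (Y w))%R).
Proof.
move=> mu mv iu iv; apply/integrableP; split.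
  by apply/measurable_EFinP; apply: measurable_funM; exact: measurableT_comp.
rewrite -(ge0_integral_distribution (pairRV X Y)
  (f := fun z => `|(u z.1 * v z.2)%:E|)); last 2 first.
- by apply: measurableT_comp => //; exact: mprod.
- by move=> z.
rewrite law_pair absM//; apply: lte_mul_pinfty.
- exact: integral_ge0.
- by move/integrableP : iu => [miu]; rewrite ge0_fin_numE//; exact: integral_ge0.
- by move/integrableP : iv => [].
Qed.

Lemma indep_expectation (u v : R -> R) : measurable_fun setT u -> measurable_fun setT v ->
  P.-integrable setT (EFin \o (u \o X)) -> P.-integrable setT (EFin \o (v \o Y)) ->
  \int[P]_w (u (X w) * v (Y w))%:E = (\int[P]_w (u (X w))%:E) * (\int[P]_w (v (Y w))%:E).
Proof.
move=> mu mv iu iv.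
have ip := indep_integrable mu mv iu iv.
have ip2 : (distribution P X \x distribution P Y).-integrable setT
    (fun z : R * R => (u z.1 * v z.2)%:E).
  apply/integrableP; split; first exact: mprod.
  rewrite absM//; apply: lte_mul_pinfty.
  - exact: integral_ge0.
  - by move/integrableP : iu => [miu]; rewrite ge0_fin_numE//; exact: integral_ge0.
  - by move/integrableP : iv => [].
have := @integral_distribution _ _ _ _ _ P (pairRV X Y) _ (mprod mu mv) ip.
rewrite /= => <-.
rewrite law_pair -integral12_prod_meas1//.
have iY : (distribution P Y).-integrable setT (fun y => (v y)%:E).
  by apply: (integrable_pushforward (phi := Y)) => //; exact/measurable_EFinP.
have iX : (distribution P X).-integrable setT (fun y => (u y)%:E).
  by apply: (integrable_pushforward (phi := X)) => //; exact/measurable_EFinP.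
have [fv vE] : exists fv, \int[distribution P Y]_y (v y)%:E = fv%:E.
  by exists (fine (\int[distribution P Y]_y (v y)%:E)); rewrite fineK//; exact: integrable_fin_num.
transitivity (\int[distribution P X]_x ((u x)%:E * fv%:E)).
  apply: eq_integral => x _; rewrite -vE -integralZl//=.
rewrite integralZr// law1// -vE law1//.
Qed.

End expectation_of_product.

Section weighted_sums.
Variables (X : nat -> {RV P >-> R}) (c : nat -> R).

Fixpoint wsum (J : seq nat) : {RV P >-> R} :=
  if J is j :: J' then (c j \o* X j \+ wsum J')%R else cst 0%R.

Lemma wsumE J w : wsum J w = (\sum_(j <- J) c j * X j w)%R.
Proof.
by elim: J => [|j J IH] /=; rewrite ?big_nil// big_cons -IH mulrC.
Qed.

Hypothesis indX : mutually_independent X.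

Let mX j (B : set R) : measurable B -> measurable (X j @^-1` B).
Proof. by move=> mB; rewrite -[X in measurable X]setTI; exact: measurable_funPT. Qed.

Let cyl (B : nat -> set R) (K : seq nat) := \bigcap_(j in [set` K]) (X j @^-1` B j).

Let mcyl B K : (forall j, measurable (B j)) -> measurable (cyl B K).
Proof. by move=> mB; apply: bigcap_measurableType => j _; exact: mX. Qed.

Let cyl_cons B j K : cyl B (j :: K) = X j @^-1` B j `&` cyl B K.
Proof.
rewrite /cyl; apply/seteqP; split => w.
  move=> H; split; first by apply: H; rewrite /= inE eqxx.
  by move=> i iK; apply: H; rewrite /= inE iK orbT.
by move=> [h1 h2] i /=; rewrite inE => /orP[/eqP->//|iK]; exact: h2.
Qed.

(** By induction on [J]: for disjoint lists the sum over [j :: J] is a function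
    of [X j] and of the sum over [J], and the pair of these is independent from
    the cylinder over [K], by the induction hypothesis for [j :: K] and for
    [[:: j]]. *)
Lemma wsum_indep_cylinder (J K : seq nat) (A : set R) (B : nat -> set R) :
  uniq (J ++ K) -> measurable A -> (forall j, measurable (B j)) ->
  P (wsum J @^-1` A `&` \bigcap_(j in [set` K]) (X j @^-1` B j)) =
  P (wsum J @^-1` A) * P (\bigcap_(j in [set` K]) (X j @^-1` B j)).
Proof.
elim: J K A B => [|j J IH] K A B.
  move=> _ mA mB /=; rewrite preimage_cst; case: ifPn => _.
    by rewrite setTI probability_setT mul1e.
  by rewrite set0I measure0 mul0e.
rewrite -cat1s -catA => /= /andP[jJK uJK] mA mB.
have uJjK : uniq (J ++ j :: K).
  by rewrite -cat1s uniq_catCA /= jJK.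
have uK : uniq K by move: uJK; rewrite cat_uniq => /and3P[].
have jK : j \notin K by move: jJK; rewrite mem_cat negb_or => /andP[].
have uJ1 : uniq (J ++ [:: j]).
  by rewrite cats1 rcons_uniq; move: jJK uJK; rewrite mem_cat negb_or cat_uniq => /andP[-> _] /and3P[].
have setB (A1 : set R) i : i \in K -> (fun i => if i == j then A1 else B i) i = B i.
  by move=> iK; rewrite ifF//; apply: contraNF jK => /eqP<-.
have cylB (A1 : set R) : cyl (fun i => if i == j then A1 else B i) K = cyl B K.
  by apply: eq_bigcapr => i iK; rewrite setB.
have mB' (A1 : set R) : measurable A1 -> forall i, measurable ((fun i => if i == j then A1 else B i) i).
  by move=> mA1 i /=; case: ifP.
have cyl1 A1 : P (cyl (fun i => if i == j then A1 else B i) [:: j]) = P (X j @^-1` A1).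
  by congr (P _); rewrite cyl_cons /cyl /= eqxx set_nil bigcap_set0 setIT.
have key := @indep_event (X j) (wsum J) (cyl B K) (mcyl K mB) _
  [set z | A (z.1 * c j + z.2)%R].
apply: key; last first.
  rewrite -[X in measurable X]setTI.
  apply: (_ : measurable_fun setT (fun z : R * R => z.1 * c j + z.2)%R) => //.
  apply: measurable_funD; last exact: measurable_snd.
  by apply: measurable_funM; [exact: measurable_fst|exact: measurable_cst].
move=> A1 A2 mA1 mA2.
pose B1 := fun i => if i == j then A1 else B i.
have E1 : P (wsum J @^-1` A2 `&` cyl B1 (j :: K)) = P (wsum J @^-1` A2) * P (cyl B1 (j :: K)).
  by apply: IH => //; exact: mB'.
have E2 : P (wsum J @^-1` A2 `&` cyl B1 [:: j]) = P (wsum J @^-1` A2) * P (cyl B1 [:: j]).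
  by apply: IH => //; exact: mB'.
have E3 : P (cyl B1 (j :: K)) = P (X j @^-1` A1) * P (cyl B K).
  rewrite /cyl indX//; [|by rewrite /= jK|exact: mB'].
  rewrite big_cons /B1 eqxx; congr (_ * _); rewrite indX//.
  by apply: eq_big_seq => i iK; rewrite setB.
have C1 : cyl B1 [:: j] = X j @^-1` A1.
  by rewrite cyl_cons /cyl /B1 eqxx set_nil bigcap_set0 setIT.
have CK : cyl B1 (j :: K) = X j @^-1` A1 `&` cyl B K.
  by rewrite cyl_cons /B1 eqxx cylB.
rewrite C1 in E2; rewrite E3 CK in E1.
by rewrite setIC (setIC (X j @^-1` _)) E2 -muleA -E1 setIC -setIA.
Qed.

Lemma indep_wsum (i : nat) (J : seq nat) : uniq J -> i \notin J -> indep (X i) (wsum J).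
Proof.
move=> uJ iJ A B mA mB.
have := @wsum_indep_cylinder J [:: i] B (fun=> A) _ mB (fun=> mA).
rewrite set_cons1 bigcap_set1 setIC muleC; apply.
by rewrite cats1 rcons_uniq iJ.
Qed.

End weighted_sums.

End independence.

(** * Regularity of the solution of Stein's equation *)

Section stein_regularity.
Variable R : realType.
Implicit Types (f g psi : R -> R).

Lemma mean_value f g (u v : R) : (forall x : R, is_derive x 1 f (g x)) ->
  exists2 c, `|c - u| <= `|v - u| & f v - f u = g c * (v - u).
Proof.
move=> df.
have cf : continuous f by move=> x; apply: differentiable_continuous; exact/derivable1_diffP.
have [uv|vu] := leP u v.
  have [c cuv E] := @MVT_segment R f g u v uv (fun x _ => df x) (continuous_subspaceT cf).
  exists c => //; move: cuv; rewrite in_itv /= => /andP[uc cv].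
  by rewrite !ger0_norm ?subr_ge0// lerD2r.
have [c cuv E] := @MVT_segment R f g v u (ltW vu) (fun x _ => df x) (continuous_subspaceT cf).
exists c; last by rewrite -opprB E -mulrN opprB.
move: cuv; rewrite in_itv /= => /andP[vc cu].
by rewrite !ler0_norm ?subr_le0 ?(ltW vu)// lerN2 lerD2r.
Qed.

(** Interpolates between a bounded and a Lipschitz estimate, so that moments of
    order [r + 2 <= 3] suffice. *)
Lemma min1_le_powR (t r : R) : 0 <= t -> 0 < r <= 1 -> Num.min 1 t <= t `^ r.
Proof.
move=> t0 /andP[r0 r1]; have [->|tn0] := eqVneq t 0.
  by rewrite powR0 ?gt_eqF//.
have tp : 0 < t by rewrite lt_def tn0.
have [t1|t1] := leP t 1.
  by rewrite -[X in X <= _](powRr1 t0) ger_powR ?tp.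
by rewrite -[X in X <= _](powRr0 t) ler_powR// ltW.
Qed.

Variables (f psi : R -> R) (N A delta r : R).
Let g x := x * f x + psi x - N.
Hypotheses (df : forall x : R, is_derive x 1 f (g x)) (A0 : 0 < A) (d0 : 0 < delta)
  (r01 : 0 < r <= 1).
Hypotheses (f_le : forall x, `|f x| <= A /\ `|x * f x| <= A)
  (psi01 : forall x, 0 <= psi x <= 1) (N01 : 0 <= N <= 1)
  (psi_lip : forall x y, `|psi x - psi y| <= `|x - y| / delta).

Lemma stein_derivative_bounded x : `|g x| <= A + 1.
Proof.
have [_ h] := f_le x; have /andP[p0 p1] := psi01 x; case/andP: N01 => n0 n1.
move: h; rewrite /g !ler_norml => /andP[h1 h2]; apply/andP; split; lra.
Qed.

(** Of the two summands of [x * f x], one increment is [t * f (y + t)] and the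
    other is [y] times an increment of [f]: hence the factor [1 + |y|]. *)
Lemma stein_derivative_holder (y t : R) :
  `|g (y + t) - g y| <= (2 * A + 2) * (1 + delta^-1 + `|y|) * `|t| `^ r.
Proof.
have di : 0 < delta^-1 by rewrite invr_gt0.
apply: (@le_trans _ _ ((2 * A + 2) * (1 + delta^-1 + `|y|) * Num.min 1 `|t|)); last first.
  apply: ler_wpM2l; last exact: min1_le_powR.
  by rewrite mulr_ge0// ?addr_ge0// ltW// mulr_gt0.
have [_|_] := leP 1 `|t|.
  have h1 := stein_derivative_bounded (y + t); have h2 := stein_derivative_bounded y.
  apply: (le_trans (ler_normB _ _)); rewrite mulr1.
  apply: (@le_trans _ _ (2 * A + 2)); first lra.
  have A2 : 0 <= 2 * A + 2 by have := A0; lra.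
  by rewrite ler_peMr// -addrA lerDl addr_ge0// ltW.
have [c _ E] := mean_value y (y + t) df.
have fl : `|f (y + t) - f y| <= (A + 1) * `|t|.
  rewrite E normrM addrAC subrr add0r ler_wpM2r//.
  exact: stein_derivative_bounded.
have -> : g (y + t) - g y = t * f (y + t) + y * (f (y + t) - f y) + (psi (y + t) - psi y).
  by rewrite /g; ring.
have h1 : `|t * f (y + t)| <= A * `|t|.
  by rewrite normrM mulrC ler_wpM2r//; case: (f_le (y + t)).
have h2 : `|y * (f (y + t) - f y)| <= (A + 1) * `|y| * `|t|.
  by rewrite normrM mulrC -mulrA (mulrC `|y|) mulrA ler_wpM2r.
have h3 : `|psi (y + t) - psi y| <= delta^-1 * `|t|.
  by have := psi_lip (y + t) y; rewrite addrAC subrr add0r mulrC.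
apply: (le_trans (ler_normD _ _)); apply: (le_trans (lerD (ler_normD _ _) (lexx _))).
apply: (le_trans (lerD (lerD h1 h2) h3)).
rewrite -!mulrDl ler_wpM2r//.
have : 0 <= A * `|y| by rewrite mulr_ge0// ltW.
have : 0 <= A * delta^-1 by rewrite mulr_ge0// ltW.
have := normr_ge0 y; have := A0; have := di.
by move=> ? ? ? ? ?; nra.
Qed.

Lemma stein_taylor (y t : R) :
  `|t * (f (y + t) - f y) - t ^+ 2 * g y|
    <= (2 * A + 2) * (1 + delta^-1 + `|y|) * `|t| `^ (r + 2).
Proof.
have [c ct E] := mean_value y (y + t) df.
have {}ct : `|c - y| <= `|t| by move: ct; rewrite [y + t - y]addrAC subrr add0r.
have -> : t * (f (y + t) - f y) - t ^+ 2 * g y = t ^+ 2 * (g c - g y).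
  by rewrite E; ring.
have -> : `|t| `^ (r + 2) = `|t| ^+ 2 * `|t| `^ r.
  rewrite powRD; last first.
    by case/andP: r01 => r0 _; rewrite (gt_eqF (_ : 0 < r + 2)) ?addr_gt0.
  by rewrite mulrC -powR_mulrn.
rewrite normrM normrX mulrCA; apply: ler_wpM2l; first exact: exprn_ge0.
have := stein_derivative_holder y (c - y); rewrite [y + _]addrC subrK => h.
apply: le_trans h _; apply: ler_wpM2l.
  by rewrite mulr_ge0// ?addr_ge0// ltW// ?mulr_gt0// invr_gt0.
by apply: ge0_ler_powR; rewrite ?nnegrE//; case/andP: r01 => /ltW.
Qed.

End stein_regularity.

(** * Stein's method for sums of independent variables *)

Section real_expectation.
Context {d : measure_display} {Omega : measurableType d} {R : realType}.
Variable P : probability Omega R.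
Implicit Types (f g : Omega -> R).
Notation I f := (P.-integrable setT (EFin \o f)).
Notation E f := (Rintegral P setT f).

Lemma integrable_dominated f g : measurable_fun setT f -> I g -> (forall w, `|f w| <= g w) -> I f.
Proof.
move=> mf Ig fg; apply: (le_integrable measurableT _ _ Ig); first exact/measurable_EFinP.
by move=> w _ /=; rewrite lee_fin; apply: le_trans (ler_norm _).
Qed.

Lemma integrable_cst_prob (c : R) : I (fun _ : Omega => c).
Proof. exact: finite_measure_integrable_cst. Qed.

Lemma integrable_bounded f (c : R) : measurable_fun setT f -> (forall w, `|f w| <= c) -> I f.
Proof. by move=> mf fc; exact: (integrable_dominated mf (integrable_cst_prob c) fc). Qed.

Lemma Rintegral_cst_prob (c : R) : E (fun _ : Omega => c) = c.
Proof. by rewrite /Rintegral integral_cst//= (probability_setT P) mule1. Qed.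

Lemma indep_Rintegral (X Y : {RV P >-> R}) (u v : R -> R) : indep X Y ->
  measurable_fun setT u -> measurable_fun setT v -> I (fun w => u (X w)) -> I (fun w => v (Y w)) ->
  I (fun w => u (X w) * v (Y w)) /\
  E (fun w => u (X w) * v (Y w)) = E (fun w => u (X w)) * E (fun w => v (Y w)).
Proof.
move=> XY mu mv iu iv; split; first exact: indep_integrable.
rewrite /Rintegral (indep_expectation XY mu mv iu iv) fineM//; exact: integrable_fin_num.
Qed.

Lemma expectD f g : I f -> I g -> I (fun w => f w + g w) /\ E (fun w => f w + g w) = E f + E g.
Proof. by move=> If Ig; split; [exact: (integrableD measurableT If Ig)|rewrite RintegralD]. Qed.

Lemma expectB f g : I f -> I g -> I (fun w => f w - g w) /\ E (fun w => f w - g w) = E f - E g.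
Proof. by move=> If Ig; split; [exact: (integrableB measurableT If Ig)|rewrite RintegralB]. Qed.

Lemma expectZ c f : I f -> I (fun w => c * f w) /\ E (fun w => c * f w) = c * E f.
Proof. by move=> If; split; [exact: (integrableZl measurableT c If)|rewrite RintegralZl]. Qed.

Lemma expect_sum (f : nat -> Omega -> R) (J : seq nat) : (forall j, j \in J -> I (f j)) ->
  I (fun w => \sum_(j <- J) f j w) /\
  E (fun w => \sum_(j <- J) f j w) = \sum_(j <- J) E (f j).
Proof.
elim: J => [_|j J IH If].
  rewrite big_nil (_ : (fun w => _) = fun=> 0); last by apply/funext => w; rewrite big_nil.
  by split; [exact: integrable_cst_prob|rewrite Rintegral_cst_prob].
have [|IJ EJ] := IH; first by move=> i iJ; apply: If; rewrite inE iJ orbT.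
have [||IjJ EjJ] := @expectD (f j) (fun w => \sum_(j <- J) f j w) => //.
  by apply: If; rewrite inE eqxx.
rewrite big_cons -EJ -EjJ (_ : (fun w => _) = fun w => f j w + \sum_(j <- J) f j w) //.
by apply/funext => w; rewrite big_cons.
Qed.

Lemma expect_le_dominated f g : measurable_fun setT f -> I g -> (forall w, `|f w| <= g w) ->
  `|E f| <= E g.
Proof.
move=> mf Ig fg; have If := integrable_dominated mf Ig fg.
apply: le_trans (le_normr_Rintegral measurableT If) _.
apply: le_Rintegral => //; first exact: (integrable_norm If).
Qed.

End real_expectation.

Section lyapunov.
Context {d : measure_display} {Omega : measurableType d} {R : realType}.
Variable P : probability Omega R.
Notation I f := (P.-integrable setT (EFin \o f)).
Notation E f := (Rintegral P setT f).
Variables (X : nat -> {RV P >-> R}) (c : nat -> R) (r Q : R).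
Hypotheses (indX : mutually_independent X) (r01 : 0 < r <= 1).
Hypotheses (EX : forall i, E (X i) = 0) (IX : forall i, I (fun w => `|X i w| `^ (r + 2)))
  (EQ : forall i, E (fun w => `|X i w| `^ (r + 2)) <= Q).

Let mX i : measurable_fun setT (X i). Proof. exact: measurable_funPT. Qed.

Let powR_le (x s : R) : 0 <= s <= r + 2 -> `|x| `^ s <= 1 + `|x| `^ (r + 2).
Proof.
move=> /andP[s0 sr]; have [x1|x1] := leP 1 `|x|.
  by rewrite -[X in X <= _]add0r lerD// ler_powR.
rewrite -[X in X <= _]addr0 lerD ?powR_ge0//.
have : `|x| `^ s <= 1 `^ s by apply: ge0_ler_powR; rewrite ?nnegrE// ltW.
by rewrite powR1.
Qed.

Let mpow (s : R) i : measurable_fun setT (fun w => `|X i w| `^ s).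
Proof.
apply: (measurableT_comp (f := fun x : R => x `^ s)); first exact: measurable_powR.
by apply: measurableT_comp.
Qed.

Let moment (s : R) i : 0 <= s <= r + 2 ->
  I (fun w => `|X i w| `^ s) /\ E (fun w => `|X i w| `^ s) <= 1 + Q.
Proof.
move=> sr.
have I1 : I (fun w => 1 + `|X i w| `^ (r + 2)).
  exact: (integrableD measurableT (integrable_cst_prob P 1) (IX i)).
have Is : I (fun w => `|X i w| `^ s).
  apply: (integrable_dominated (mpow s i) I1) => w.
  by rewrite ger0_norm ?powR_ge0// powR_le.
split => //; apply: (@le_trans _ _ (E (fun w => 1 + `|X i w| `^ (r + 2)))).
  by apply: le_Rintegral => // w _; exact: powR_le.
rewrite RintegralD//; last exact: integrable_cst_prob.
by rewrite Rintegral_cst_prob lerD2l.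
Qed.

Let sqrI i : I (fun w => X i w ^+ 2).
Proof.
have -> : (fun w => X i w ^+ 2) = (fun w => `|X i w| `^ 2).
  by apply/funext => w; rewrite powR_mulrn// real_normK// num_real.
by have [] := @moment 2 i _ => //; case/andP: r01 => r0 _; lra.
Qed.

Let varE i : 0 <= E (fun w => X i w ^+ 2) <= 1 + Q.
Proof.
have -> : (fun w => X i w ^+ 2) = (fun w => `|X i w| `^ 2).
  by apply/funext => w; rewrite powR_mulrn// real_normK// num_real.
have [] := @moment 2 i _; first by case/andP: r01 => r0 _; lra.
move=> _ ->; rewrite andbT; apply: Rintegral_ge0 => // w _; exact: powR_ge0.
Qed.

Let IX1 i : I (X i).
Proof.
have h1 : 0 <= (1 : R) <= r + 2 by case/andP: r01 => r0 _; lra.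
have [h _] := moment i h1.
by apply: (integrable_dominated (mX i) h) => w; rewrite powRr1.
Qed.

Let S := wsum X c.

Lemma wsum_moments J : uniq J -> [/\ I (S J), I (fun w => S J w ^+ 2), E (S J) = 0 &
  E (fun w => S J w ^+ 2) = \sum_(j <- J) c j ^+ 2 * E (fun w => X j w ^+ 2)].
Proof.
elim: J => [|j J IH].
  move=> _; rewrite /S /=; split.
  - exact: integrable_cst_prob.
  - by under [X in _.-integrable _ (_ \o X)]eq_fun do rewrite expr0n; exact: integrable_cst_prob.
  - by rewrite Rintegral_cst_prob.
  - by rewrite big_nil; under eq_Rintegral do rewrite expr0n; rewrite Rintegral_cst_prob.
move=> /= /andP[jJ uJ]; have [I1 I2 E1 E2] := IH uJ.
have XS : indep (X j) (S J) by exact: (indep_wsum c indX uJ jJ).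
have mid : measurable_fun setT (idfun : R -> R) by exact: measurable_id.
have [Ip Ep] := indep_Rintegral XS mid mid (IX1 j) I1.
have Ic : I (fun w => X j w * c j) by exact: (integrableZr measurableT (c j) (IX1 j)).
have Ic2 : I (fun w => c j ^+ 2 * X j w ^+ 2) by exact: (integrableZl measurableT _ (sqrI j)).
have Ip2 : I (fun w => (2 * c j) * (X j w * S J w)) by exact: (integrableZl measurableT _ Ip).
have sqE w : (X j w * c j + S J w) ^+ 2 =
   c j ^+ 2 * X j w ^+ 2 + ((2 * c j) * (X j w * S J w) + S J w ^+ 2) by ring.
have Iin : I (fun w => (2 * c j) * (X j w * S J w) + S J w ^+ 2).
  exact: (integrableD measurableT Ip2 I2).
split.
- exact: (integrableD measurableT Ic I1).
- rewrite (_ : (fun w => _) = (fun w => c j ^+ 2 * X j w ^+ 2 + ((2 * c j) * (X j w * S J w) + S J w ^+ 2))).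
    exact: (integrableD measurableT Ic2 Iin).
  by apply/funext => w; rewrite -sqE.
- rewrite RintegralD// RintegralZr// EX E1 mul0r addr0//.
- rewrite big_cons; under eq_Rintegral do rewrite sqE.
  by rewrite !RintegralD// !RintegralZl// Ep EX E2 !mul0r mulr0 add0r.
Qed.


Section normalised.
Variable J : seq nat.
Hypotheses (uJ : uniq J) (var1 : \sum_(j <- J) c j ^+ 2 * E (fun w => X j w ^+ 2) = 1).
Variables (f psi : R -> R) (N A delta : R).
Let g x := x * f x + psi x - N.
Hypotheses (df : forall x : R, is_derive x 1 f (g x)) (A0 : 0 < A) (d0 : 0 < delta).
Hypotheses (f_le : forall x, `|f x| <= A /\ `|x * f x| <= A) (cpsi : continuous psi)
  (psi01 : forall x, 0 <= psi x <= 1) (N01 : 0 <= N <= 1)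
  (psi_lip : forall x y, `|psi x - psi y| <= `|x - y| / delta).

Let K := 2 * A + 2.
Let M := K * (3 + delta^-1).

Let mf : measurable_fun setT f.
Proof.
apply: continuous_measurable_fun => x; apply: differentiable_continuous.
exact/derivable1_diffP.
Qed.

Let mg : measurable_fun setT g.
Proof.
apply: measurable_funB; last exact: measurable_cst.
apply: measurable_funD; last exact: continuous_measurable_fun.
by apply: measurable_funM => //; exact: measurable_id.
Qed.

Let mS L : measurable_fun setT (S L). Proof. exact: measurable_funPT. Qed.

Let g_le x : `|g x| <= A + 1.
Proof. exact: (stein_derivative_bounded f_le). Qed.

(** The exchange at the heart of Stein's method. Writing [S = Y + W] with
    [W = c i * X i] independent of [Y], a first order expansion of [f] at [Y]
    turns [E (W f S)] into [E (W^2) E (g Y)], since [E (W f Y) = 0]; replacing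
    [g Y] by [g S] costs another error of the same order. *)
Lemma stein_summand i : i \in J ->
  I (fun w => c i * X i w * f (S J w)) /\
  `|E (fun w => c i * X i w * f (S J w)) -
    c i ^+ 2 * E (fun w => X i w ^+ 2) * E (fun w => g (S J w))|
  <= M * (2 * (1 + Q) ^+ 2) * `|c i| `^ (r + 2).
Proof.
move=> iJ; have [r0 r1] := andP r01.
pose Y := S (rem i J).
have SY w : S J w = Y w + c i * X i w.
  by rewrite /Y /S !wsumE (big_rem i)//= addrC.
have uJ' : uniq (rem i J) by exact: rem_uniq.
have XY : indep (X i) Y.
  by apply: (indep_wsum c indX uJ'); rewrite mem_rem_uniq// inE eqxx.
have [IY IY2 _ EY2] := wsum_moments uJ'.
have Q0 : 0 <= Q by apply: le_trans (EQ i); apply: Rintegral_ge0 => // w _; exact: powR_ge0.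
have {}EY2 : E (fun w => Y w ^+ 2) <= 1.
  rewrite EY2 -var1 [X in _ <= X](big_rem i)//= lerDr mulr_ge0 ?sqr_ge0//.
  by case/andP: (varE i).
pose v (y : R) := K * (1 + delta^-1 + `|y|).
have K0 : 0 <= K by rewrite addr_ge0 ?mulr_ge0// ltW.
have di : 0 < delta^-1 by rewrite invr_gt0.
have v0 y : 0 <= v y by rewrite mulr_ge0// addr_ge0// ltW// addr_gt0.
have mabs : measurable_fun setT (fun y : R => `|y|) by exact: measurableT_comp.
have mv : measurable_fun setT v.
  by apply: measurable_funM => //; apply: measurable_funD.
have [IaY EaY] : I (fun w => `|Y w|) /\ E (fun w => `|Y w|) <= 2.
  have Ia : I (fun w => `|Y w|) by exact: integrable_norm.
  have [I1 E1] := expectD (integrable_cst_prob P 1) IY2.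
  split => //; apply: (@le_trans _ _ (E (fun w => 1 + Y w ^+ 2))).
    apply: le_Rintegral => // w _; rewrite -[Y w ^+ 2]real_normK ?num_real//.
    by have := sqr_ge0 (`|Y w| - 1); rewrite sqrrB1 mulr2n; have := normr_ge0 (Y w); nra.
  by rewrite E1 Rintegral_cst_prob; lra.
have [IvY EvY] : I (fun w => v (Y w)) /\ E (fun w => v (Y w)) <= M.
  have [I1 E1] := expectD (integrable_cst_prob P (1 + delta^-1)) IaY.
  have [I2 E2] := expectZ K I1.
  split; first exact: I2.
  rewrite [X in X <= _]E2 ler_wpM2l// E1 Rintegral_cst_prob; lra.
have mp s : measurable_fun setT (fun x : R => `|x| `^ s).
  apply: (measurableT_comp (f := fun x : R => x `^ s)); first exact: measurable_powR.
  exact: mabs.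
have dom s : 0 <= s <= r + 2 -> I (fun w => `|c i| `^ s * (`|X i w| `^ s * v (Y w))) /\
    E (fun w => `|c i| `^ s * (`|X i w| `^ s * v (Y w))) <= `|c i| `^ s * ((1 + Q) * M).
  move=> sr; have [Is Es] := moment i sr.
  have [I1 E1] := indep_Rintegral XY (mp s) mv Is IvY.
  have [I2 E2] := expectZ (`|c i| `^ s) I1.
  split => //; rewrite E2 ler_wpM2l ?powR_ge0// E1 ler_pM//.
  - by apply: Rintegral_ge0 => // w _; exact: powR_ge0.
  - by apply: Rintegral_ge0 => // w _; exact: v0.
have [Iq Eq] : I (fun w => `|c i| `^ (r + 2) * (`|X i w| `^ (r + 2) * v (Y w))) /\
    E (fun w => `|c i| `^ (r + 2) * (`|X i w| `^ (r + 2) * v (Y w))) <= `|c i| `^ (r + 2) * ((1 + Q) * M).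
  by apply: dom; rewrite lexx andbT; lra.
have [Ir Er] : I (fun w => `|c i| `^ r * (`|X i w| `^ r * v (Y w))) /\
    E (fun w => `|c i| `^ r * (`|X i w| `^ r * v (Y w))) <= `|c i| `^ r * ((1 + Q) * M).
  by apply: dom; rewrite lerDl; lra.
have absW w s : `|c i * X i w| `^ s = `|c i| `^ s * `|X i w| `^ s by rewrite normrM powRM.
(* the errors of the expansion of [f] at [Y] and of passing from [Y] to [S] *)
pose D1 w := c i * X i w * (f (S J w) - f (Y w)) - (c i * X i w) ^+ 2 * g (Y w).
pose D2 w := g (S J w) - g (Y w).
have mfS L : measurable_fun setT (fun w => f (S L w)) by exact: (measurableT_comp mf).
have mgS L : measurable_fun setT (fun w => g (S L w)) by exact: (measurableT_comp mg).
have mW : measurable_fun setT (fun w => c i * X i w) by exact: measurable_funM.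
have mD1 : measurable_fun setT D1.
  apply: measurable_funB; apply: measurable_funM.
  - exact: mW.
  - exact: (measurable_funB (mfS J) (mfS (rem i J))).
  - exact: (measurable_funX 2 mW).
  - exact: mgS.
have mD2 : measurable_fun setT D2 by exact: (measurable_funB (mgS J) (mgS (rem i J))).
have D1_le w : `|D1 w| <= `|c i| `^ (r + 2) * (`|X i w| `^ (r + 2) * v (Y w)).
  rewrite /D1 SY; apply: le_trans (stein_taylor df A0 d0 r01 f_le psi01 N01 psi_lip _ _) _.
  by rewrite absW mulrC mulrA.
have D2_le w : `|D2 w| <= `|c i| `^ r * (`|X i w| `^ r * v (Y w)).
  rewrite /D2 SY; apply: le_trans (stein_derivative_holder df A0 d0 r01 f_le psi01 N01 psi_lip _ _) _.
  by rewrite absW mulrC mulrA.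
have ED1 := expect_le_dominated mD1 Iq D1_le.
have ED2 := expect_le_dominated mD2 Ir D2_le.
have ID1 := integrable_dominated mD1 Iq D1_le.
have IgS L : I (fun w => g (S L w)) by apply: (integrable_bounded P (mgS L)) => w; exact: g_le.
have IfS L : I (fun w => f (S L w)).
  by apply: (@integrable_bounded _ _ _ _ _ A (mfS L)) => w; case: (f_le (S L w)).
have mid : measurable_fun setT (idfun : R -> R) by exact: measurable_id.
have msq : measurable_fun setT (fun x : R => x ^+ 2) by exact: measurable_funX.
have [Ia Ea] := indep_Rintegral XY mid mf (IX1 i) (IfS _).
have [Ib Eb] := indep_Rintegral XY msq mg (sqrI i) (IgS _).
have [Ia' Ea'] := expectZ (c i) Ia.
have [Ib' Eb'] := expectZ (c i ^+ 2) Ib.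
have [I1 E1] := expectD Ia' Ib'.
have [I2 E2] := expectD I1 ID1.
have [I3 E3] := expectB (IgS J) (IgS (rem i J)).
rewrite (_ : (fun w => c i * X i w * f (S J w)) = (fun w => c i * (idfun (X i w) * f (Y w)) +
  c i ^+ 2 * (X i w ^+ 2 * g (Y w)) + D1 w)); last first.
  by apply/funext => w; rewrite /D1 /=; ring.
split => //; rewrite E2 E1 Ea' Ea EX mul0r mulr0 add0r Eb' Eb.
set s2 := E (fun w => X i w ^+ 2) in Eb *.
have -> : E (fun w => g (S J w)) = E D2 + E (fun w => g (Y w)) by rewrite E3 subrK.
have -> : c i ^+ 2 * (s2 * E (fun w => g (Y w))) + E D1 -
  c i ^+ 2 * s2 * (E D2 + E (fun w => g (Y w))) = E D1 - c i ^+ 2 * s2 * E D2 by ring.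
apply: (le_trans (ler_normB _ _)).
have /andP[s20 s2Q] := varE i; rewrite -/s2 in s20 s2Q.
have cs0 : 0 <= c i ^+ 2 * s2 by rewrite mulr_ge0// sqr_ge0.
have M0 : 0 <= M by apply: le_trans EvY; apply: Rintegral_ge0 => // w _; exact: v0.
have h1 : `|E D1| <= `|c i| `^ (r + 2) * ((1 + Q) * M) by exact: le_trans ED1 Eq.
have h2 : `|c i ^+ 2 * s2 * E D2| <= `|c i| `^ (r + 2) * ((1 + Q) ^+ 2 * M).
  have -> : `|c i| `^ (r + 2) = c i ^+ 2 * `|c i| `^ r.
    rewrite powRD; last by rewrite (gt_eqF (_ : 0 < r + 2)) ?addr_gt0.
    by rewrite mulrC powR_mulrn// real_normK ?num_real.
  rewrite normrM (ger0_norm cs0).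
  have := sqr_ge0 (c i); move: (c i ^+ 2) => cc cc0.
  rewrite -(mulrA cc s2) -(mulrA cc (_ `^ _)) ler_wpM2l//.
  apply: (@le_trans _ _ (s2 * (`|c i| `^ r * ((1 + Q) * M)))).
    by rewrite ler_wpM2l// (le_trans ED2).
  rewrite mulrCA ler_wpM2l ?powR_ge0// expr2 -[X in _ <= X]mulrA ler_wpM2r// mulr_ge0//.
  by rewrite addr_ge0.
apply: (le_trans (lerD h1 h2)); rewrite -mulrDr mulrC ler_wpM2r ?powR_ge0//.
rewrite -mulrDl mulrC ler_wpM2l//.
by rewrite [X in _ <= X]mulr_natl mulr2n lerD2r expr2 ler_peMr ?lerDl// addr_ge0.
Qed.

(** By Stein's equation [psi S - N = g S - S f S]; the summands of [S f S] are
    compared with the shares [c i^2 E (X i^2)] of [E (g S)], which add up to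
    one. *)
Lemma stein_bound : `|E (fun w => psi (S J w)) - N|
  <= M * (2 * (1 + Q) ^+ 2) * \sum_(j <- J) `|c j| `^ (r + 2).
Proof.
have H i (iJ : i \in J) := stein_summand iJ.
have [Is Es] := @expect_sum _ _ _ P (fun j w => c j * X j w * f (S J w)) J (fun i iJ => (H i iJ).1).
have IgS : I (fun w => g (S J w)).
  by apply: (integrable_bounded P (measurableT_comp mg (mS J))) => w; exact: g_le.
have [I1 E1] := expectB IgS Is.
have [I2 E2] := expectD I1 (integrable_cst_prob P N).
have psiE w : psi (S J w) = g (S J w) - \sum_(j <- J) c j * X j w * f (S J w) + N.
  by rewrite -mulr_suml /S -wsumE -/S /g; ring.
have -> : E (fun w => psi (S J w)) = E (fun w => g (S J w)) - \sum_(j <- J) E (fun w => c j * X j w * f (S J w)) + N.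
  rewrite -Es -E1 -[X in _ = _ + X](Rintegral_cst_prob P N) -E2.
  by congr (Rintegral _ _ _); apply/funext => w; exact: psiE.
have -> : E (fun w => g (S J w)) =
    \sum_(j <- J) c j ^+ 2 * E (fun w => X j w ^+ 2) * E (fun w => g (S J w)).
  by rewrite -mulr_suml var1 mul1r.
rewrite addrK -sumrB mulr_sumr.
apply: le_trans (ler_norm_sum _ _ _) _.
rewrite big_seq [X in _ <= X]big_seq; apply: ler_sum => i iJ.
by rewrite distrC; exact: (H i iJ).2.
Qed.

End normalised.
End lyapunov.

(** * Ramp functions and the normal distribution function *)

Section ramp.
Variable R : realType.
Notation mu := (@lebesgue_measure R).
Variables (z delta : R).
Hypothesis d0 : 0 < delta.

(** A Lipschitz substitute for the indicator of [x <= z]. *)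
Definition ramp (x : R) : R := Num.max 0 (Num.min 1 ((z + delta - x) / delta)).

Lemma ramp01 x : 0 <= ramp x <= 1.
Proof.
rewrite /ramp; set t := _ / _.
have [t1|t1] := leP 1 t; first by rewrite (max_idPr ler01) ler01 lexx.
have [t0|t0] := leP 0 t; first by rewrite t0 ltW.
by rewrite lexx ler01.
Qed.

Lemma ramp_left x : x <= z -> ramp x = 1.
Proof.
move=> xz; rewrite /ramp (min_idPl _) ?(max_idPr ler01)//.
by rewrite ler_pdivlMr// mul1r; lra.
Qed.

Lemma ramp_right x : z + delta <= x -> ramp x = 0.
Proof.
move=> xz; have h : (z + delta - x) / delta <= 0 by rewrite ler_pdivrMr// mul0r; lra.
by rewrite /ramp (min_idPr (le_trans h ler01)) (max_idPl h).
Qed.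

Lemma ramp_lip x y : `|ramp x - ramp y| <= `|x - y| / delta.
Proof.
have -> : `|x - y| / delta = `|(z + delta - x) / delta - (z + delta - y) / delta|.
  rewrite -mulrBl normrM [`|delta^-1|]ger0_norm ?invr_ge0 ?ltW//.
  by congr (_ / _); rewrite distrC; congr `|_|; ring.
rewrite /ramp; move: (_ / delta) (_ / delta) => s t.
rewrite ler_norml.
have := ler_norm (s - t); have := ler_norm (t - s); rewrite distrC.
move: `|s - t| (normr_ge0 (s - t)) => n n0 h1 h2.
by apply/andP; split; have [?|?] := leP 1 s; have [?|?] := leP 1 t; try (have [?|?] := leP 0 s);
   try (have [?|?] := leP 0 t); rewrite ?(max_idPr ler01); lra.
Qed.

Lemma continuous_ramp : continuous ramp.
Proof.
move=> x; apply/cvgrPdist_le => e e0; near=> y.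
apply: le_trans (ramp_lip _ _) _; rewrite ler_pdivrMr//.
near: y; apply: cvgr_dist_le; [exact: cvg_id|exact: mulr_gt0].
Unshelve. all: by end_near. Qed.

End ramp.

Section normal_cdf.
Variable R : realType.
Notation mu := (@lebesgue_measure R).

Lemma PhiE (z : R) : Phi z = \int[mu]_(x in `]-oo, z]) gauss x.
Proof.
rewrite /Phi -RintegralZl//.
  by apply: eq_Rintegral => x _; rewrite gaussE.
have s0 : Num.sqrt (2 * pi) != 0 :> R by rewrite gt_eqF// sqrtr_gt0 mulr_gt0// pi_gt0.
rewrite (_ : EFin \o _ = (fun x => (Num.sqrt (2 * pi))%:E * (gauss x)%:E)%E).
  by apply: integrableZl => //; exact: integrable_gauss.
by apply/funext => x /=; rewrite gaussE -EFinM mulrA mulfV// mul1r.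
Qed.

Lemma PhiE_restrict (z : R) : Phi z = \int[mu]_x (if x <= z then gauss x else 0).
Proof.
rewrite PhiE Rintegral_mkcond; apply: eq_Rintegral => x _; rewrite patchE.
by rewrite mem_setE in_itv.
Qed.

Let Irestr (z : R) : mu.-integrable setT (EFin \o (fun x => if x <= z then gauss x else 0)).
Proof.
have := integrable_gauss (measurable_itv `]-oo, z]).
rewrite integrable_mkcond//.
apply: eq_integrable => // x _ /=.
by rewrite /= !patchE mem_setE in_itv /=; case: ifP.
Qed.

Lemma Phi01 (z : R) : 0 <= Phi z <= 1.
Proof.
rewrite PhiE_restrict; apply/andP; split.
  by apply: Rintegral_ge0 => // x _; case: ifP => // _; exact: gauss_ge0.
rewrite -(Rintegral_gauss R); apply: le_Rintegral => //.
  exact: integrable_gauss.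
by move=> x _; case: ifP => // _; exact: gauss_ge0.
Qed.

Lemma Phi_lip (z d : R) : 0 <= d -> Phi z <= Phi (z + d) <= Phi z + d.
Proof.
move=> d0; rewrite !PhiE.
have E : \int[mu]_(x in `]-oo, (z + d)]) gauss x =
    \int[mu]_(x in `]-oo, z]) gauss x + \int[mu]_(x in `]z, (z + d)]) gauss x.
  have := @Rintegral_itvB R (@gauss R) -oo%O (BRight (z + d)) z.
  by move=> <- //; [rewrite [RHS]addrC subrK|exact: integrable_gauss|rewrite bnd_simp lerDl].
have h0 : 0 <= \int[mu]_(x in `]z, (z + d)]) gauss x.
  by apply: Rintegral_ge0 => // x _; exact: gauss_ge0.
have h1 : \int[mu]_(x in `]z, (z + d)]) gauss x <= d.
  rewrite [X in _ <= X](_ : d = \int[mu]_(x in `]z, (z + d)]) 1); last first.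
    by rewrite (@Rintegral_cst _ _ _ mu)//= mul1r lebesgue_measure_itv/= lte_fin ltrDl;
      case: ltP => [_|dn]; [rewrite -EFinB addrAC subrr add0r|apply/eqP; rewrite eq_le d0 dn].
  apply: le_Rintegral => //; first exact: integrable_gauss.
    apply/integrableP; split; first by apply/measurable_EFinP; exact: measurable_cst.
    rewrite (eq_integral (cst 1%E)) => [|x _]; last by rewrite /= normr1.
    rewrite integral_cst// mul1e.
    have fin : (mu `]z, (z + d)%R] < +oo)%E.
      by rewrite lebesgue_measure_itv /=; case: ifP => // _; rewrite -EFinB ltry.
    exact: fin.
  by move=> x _; exact: gauss_le1.
by rewrite E lerDl h0 lerD2l h1.
Qed.

Lemma ramp_mean (z d : R) : 0 < d -> Phi z <= \int[mu]_x (ramp z d x * gauss x) <= Phi (z + d).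
Proof.
move=> d0; rewrite !PhiE_restrict.
have Ir : mu.-integrable setT (EFin \o (fun x => ramp z d x * gauss x)).
  apply: (le_integrable measurableT _ _ (integrable_gauss measurableT)).
  - apply/measurable_EFinP; apply: measurable_funM; last exact: measurable_gauss.
    have mr : measurable_fun setT (ramp z d).
      by apply: continuous_measurable_fun; exact: continuous_ramp.
    exact: mr.
  - move=> x _ /=; rewrite lee_fin normrM ler_piMl//.
    by have /andP[p0 p1] := ramp01 z d x; rewrite ger0_norm.
apply/andP; split; apply: le_Rintegral => // x _.
- case: ifP => [xz|_]; first by rewrite ramp_left// mul1r.
  by rewrite mulr_ge0 ?gauss_ge0//; case/andP: (ramp01 z d x).
- case: (leP x (z + d)) => xz; last by rewrite ramp_right ?mul0r// ltW.
  by rewrite ler_piMl ?gauss_ge0//; case/andP: (ramp01 z d x).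
Qed.

End normal_cdf.

(** * A bound of Berry-Esseen type *)

Lemma fine_prob_le {d} {Omega : measurableType d} {R : realType} (P : probability Omega R)
    (A : set Omega) (u : Omega -> R) : measurable A -> P.-integrable setT (EFin \o u) ->
  (forall w, \1_A w <= u w) -> fine (P A) <= Rintegral P setT u.
Proof.
move=> mA Iu Au; have IA : P.-integrable setT (EFin \o (\1_A : Omega -> R)).
  by apply: (@integrable_bounded _ _ _ _ _ 1) => // w; rewrite indicE; case: (_ \in _); rewrite ?normr1 ?normr0.
have -> : fine (P A) = Rintegral P setT (\1_A : Omega -> R).
  by rewrite /Rintegral integral_indic// setIT.
by apply: le_Rintegral => // w _; exact: Au.
Qed.

Lemma fine_prob_ge {d} {Omega : measurableType d} {R : realType} (P : probability Omega R)
    (A : set Omega) (u : Omega -> R) : measurable A -> P.-integrable setT (EFin \o u) ->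
  (forall w, u w <= \1_A w) -> Rintegral P setT u <= fine (P A).
Proof.
move=> mA Iu Au; have IA : P.-integrable setT (EFin \o (\1_A : Omega -> R)).
  by apply: (@integrable_bounded _ _ _ _ _ 1) => // w; rewrite indicE; case: (_ \in _); rewrite ?normr1 ?normr0.
have -> : fine (P A) = Rintegral P setT (\1_A : Omega -> R).
  by rewrite /Rintegral integral_indic// setIT.
by apply: le_Rintegral => // w _; exact: Au.
Qed.

(** The indicator of a half line is squeezed between two ramps of width [delta].
    This costs [delta] for the normal distribution and [L / delta] in
    [stein_bound], where [L] is the sum of the [|c j|^(r+2)]; the choice
    [delta = sqrt L] balances the two. *)
Lemma berry_esseen (R : realType) : exists2 A : R, 0 < A &
  forall d (Omega : measurableType d) (P : probability Omega R) (X : nat -> {RV P >-> R})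
    (c : nat -> R) (r Q : R), mutually_independent X -> 0 < r <= 1 ->
  (forall i, Rintegral P setT (X i) = 0) ->
  (forall i, P.-integrable setT (EFin \o (fun w => `|X i w| `^ (r + 2)))) ->
  (forall i, Rintegral P setT (fun w => `|X i w| `^ (r + 2)) <= Q) ->
  forall J, uniq J -> \sum_(j <- J) c j ^+ 2 * Rintegral P setT (fun w => X j w ^+ 2) = 1 ->
  forall z, `|fine (P [set w | \sum_(j <- J) c j * X j w <= z]) - Phi z|
    <= (1 + 16 * (A + 1) * (1 + Q) ^+ 2) * Num.sqrt (\sum_(j <- J) `|c j| `^ (r + 2)).
Proof.
have [A A0 HA] := stein_solution R.
exists A => // d Omega P X c r Q indX r01 EX IX EQ J uJ var1 z.
set L := \sum_(j <- J) _ `^ _.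
have Q0 : 0 <= Q by apply: le_trans (EQ 0%N); apply: Rintegral_ge0 => // w _; exact: powR_ge0.
have L0 : 0 < L.
  have L0 : 0 <= L by apply: sumr_ge0 => j _; exact: powR_ge0.
  rewrite lt_def L0 andbT; apply/eqP => LE.
  have := oner_neq0 R; rewrite -var1 big_seq big1 ?eqxx// => j jJ.
  have : `|c j| `^ (r + 2) == 0.
    have := LE; rewrite /L => /eqP; rewrite psumr_eq0 => [/allP/(_ j jJ)//|i _].
    exact: powR_ge0.
  by rewrite powR_eq0 normr_eq0 => /andP[/eqP-> _]; rewrite expr0n mul0r.
have s0 : 0 < Num.sqrt L by rewrite sqrtr_gt0.
set K := 1 + _.
have K1 : 1 <= K.
  by rewrite lerDl mulr_ge0 ?mulr_ge0 ?sqr_ge0 ?addr_ge0// ltW.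
have setE y : [set w | \sum_(j <- J) c j * X j w <= y] = wsum X c J @^-1` `]-oo, y].
  by apply/seteqP; split => w; rewrite /= in_itv /= wsumE.
have mA y : measurable [set w | \sum_(j <- J) c j * X j w <= y].
  rewrite setE -[X in measurable X]setTI; exact: measurable_funPT.
have Pz01 : 0 <= fine (P [set w | \sum_(j <- J) c j * X j w <= z]) <= 1.
  by rewrite fine_ge0//= -lee_fin fineK ?probability_le1// fin_num_measure.
have /andP[F0 F1] := Phi01 z.
have [L1|L1] := leP 1 L.
  apply: (@le_trans _ _ 1); first by case/andP: Pz01 => ? ?; rewrite ler_norml; apply/andP; split; lra.
  rewrite -[X in X <= _]mul1r ler_pM// -[X in X <= _]sqrtr1 ler_sqrt//; exact: ltW.
set dl := Num.sqrt L in s0 *.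
have dL : dl ^+ 2 = L by rewrite sqr_sqrtr// ltW.
have dl1 : dl <= 1 by rewrite -sqrtr1 ler_sqrt// ltW.
have H y : `|Rintegral P setT (fun w => ramp y dl (wsum X c J w)) -
    \int[lebesgue_measure]_x (ramp y dl x * gauss x)| <= 16 * (A + 1) * (1 + Q) ^+ 2 * dl.
  have [f [df fA]] := HA (ramp y dl) (@continuous_ramp R y dl s0) (@ramp01 R y dl).
  set N := \int[lebesgue_measure]_x _ in df *.
  have N01 : 0 <= N <= 1.
    have /andP[n0 n1] := ramp_mean y s0; have /andP[p0 _] := Phi01 y.
    by have /andP[_ p1] := Phi01 (y + dl); rewrite (le_trans p0 n0) (le_trans n1 p1).
  have := stein_bound indX r01 EX IX EQ uJ var1 df A0 s0 fA (@continuous_ramp R y dl s0)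
    (@ramp01 R y dl) N01 (@ramp_lip R y dl s0).
  move/le_trans; apply; rewrite -/L -dL.
  have -> : (2 * A + 2) * (3 + dl^-1) * (2 * (1 + Q) ^+ 2) * dl ^+ 2 =
    4 * (A + 1) * (1 + Q) ^+ 2 * (3 * dl ^+ 2 + dl) by field; rewrite gt_eqF.
  have -> : 16 * (A + 1) * (1 + Q) ^+ 2 * dl = 4 * (A + 1) * (1 + Q) ^+ 2 * (4 * dl) by ring.
  apply: ler_wpM2l; first by rewrite !mulr_ge0 ?sqr_ge0 ?addr_ge0// ltW.
  by have := s0; rewrite expr2; nra.
have Ir y : P.-integrable setT (EFin \o (fun w => ramp y dl (wsum X c J w))).
  have mr : measurable_fun setT (ramp y dl).
    by apply: continuous_measurable_fun; exact: continuous_ramp.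
  apply: (@integrable_bounded _ _ _ _ _ 1); first by apply: measurableT_comp => //; exact: measurable_funPT.
  by move=> w; have /andP[a0 a1] := ramp01 y dl (wsum X c J w); rewrite ger0_norm.
have up : fine (P [set w | \sum_(j <- J) c j * X j w <= z]) <=
    Rintegral P setT (fun w => ramp z dl (wsum X c J w)).
  apply: fine_prob_le => // w; rewrite indicE; case: (boolP (_ \in _)) => [|_].
    by rewrite inE /= -wsumE => h; rewrite ramp_left.
  by case/andP: (ramp01 z dl (wsum X c J w)).
have lo : Rintegral P setT (fun w => ramp (z - dl) dl (wsum X c J w)) <=
    fine (P [set w | \sum_(j <- J) c j * X j w <= z]).
  apply: fine_prob_ge => // w; rewrite indicE; case: (boolP (_ \in _)) => [_|].
    by case/andP: (ramp01 (z - dl) dl (wsum X c J w)).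
  rewrite notin_setE /= -wsumE => /negP; rewrite -ltNge => h.
  by rewrite ramp_right// subrK ltW.
have := H z; have := H (z - dl); rewrite !ler_norml => /andP[h1 h2] /andP[h3 h4].
have /andP[_ n1] := ramp_mean z s0; have /andP[n2 _] := ramp_mean (z - dl) s0.
have /andP[_ p1] := Phi_lip z (ltW s0); have /andP[_ p2] := Phi_lip (z - dl) (ltW s0).
rewrite subrK in p2; rewrite /K mulrDl mul1r.
by apply/andP; split; lra.
Qed.

(** * Twice differentiable maps on an interval *)

Section C2_interval.
Variable R : realType.
Implicit Types f : R -> R.

Lemma derivable_in_near A f x : derivable_in A f x -> forall e, 0 < e -> exists2 r, 0 < r &
  forall y, A y -> `|y - x| < r -> `|f y - f x - deriv_in A f x * (y - x)| <= e * `|y - x|.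
Proof.
move=> df e e0; have /cvgrPdist_le/(_ e e0) := df.
rewrite /within /= => /nbhs_ballP[r /= r0 H]; exists r => // y Ay yr.
have [->|yx] := eqVneq y x; first by rewrite !subrr mulr0 subr0 normr0 mulr0.
have yx0 : y - x != 0 by rewrite subr_eq0.
have : `|deriv_in A f x - slope_at f x y| <= e.
  by apply: H => //; rewrite /ball /= distrC.
rewrite -(ler_pM2r (_ : 0 < `|y - x|)) ?normr_gt0// -normrM mulrBl /slope_at divfK//.
by rewrite distrC.
Qed.

Lemma derivable_in_is_derive (u v : R) f x : u < x < v ->
  derivable_in `[u, v] f x -> is_derive x 1 f (deriv_in `[u, v] f x).
Proof.
move=> /andP[ux xv] df; set d := deriv_in _ _ _.
have cv : h^-1 *: (f (h *: 1 + x) - f x) @[h --> (0 : R)^'] --> d.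
  apply/cvgrPdist_le => e e0; have [r r0 H] := derivable_in_near df e0.
  apply/nbhs_ballP; exists (Num.min r (Num.min (x - u) (v - x))).
    by rewrite /= !lt_min r0 !subr_gt0 ux.
  move=> h; rewrite /ball /= sub0r normrN !lt_min => /and3P[hr hu hv] h0.
  have hE : h *: 1 + x = x + h by rewrite /GRing.scale /= mulr1 addrC.
  rewrite hE /GRing.scale /=.
  have := H (x + h); rewrite [x + h - x]addrAC subrr add0r -/d => /(_ _ hr).
  have hin : `[u, v]%classic (x + h).
    by move: hu hv; rewrite /= in_itv /= !ltr_norml => /andP[? ?] /andP[? ?]; apply/andP; split; lra.
  move=> /(_ hin); rewrite -(ler_pM2l (_ : 0 < `|h|^-1)) ?invr_gt0 ?normr_gt0//.
  rewrite [X in _ <= X]mulrCA mulVf ?normr_eq0// mulr1; apply: le_trans.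
  rewrite -normfV -normrM distrC le_eqVlt; apply/orP; left; apply/eqP; congr `|_|.
  by field.
split; first by apply/cvg_ex; exists d; exact: cv.
exact: (cvg_lim _ cv).
Qed.

Lemma derivable_in_continuous (u v : R) f :
  (forall x, `[u, v]%classic x -> derivable_in `[u, v] f x) -> {within `[u, v], continuous f}.
Proof.
move=> df; apply/subspace_continuousP => x xuv; have := df x xuv.
move=> /derivable_in_near/(_ _ ltr01)[r r0 H].
set d := deriv_in _ _ _ in H.
apply/cvgrPdist_lt => e e0; rewrite /within /=; apply/nbhs_ballP.
exists (Num.min r (e / (`|d| + 2))); first by rewrite /= lt_min r0 divr_gt0// ltr_wpDl.
move=> y; rewrite /ball /= distrC lt_min ltr_pdivlMr ?ltr_wpDl// => /andP[yr ye] yuv.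
have := H y yuv yr; rewrite mul1r distrC => h.
rewrite distrC; apply: le_lt_trans ye.
have -> : f y - f x = (f y - f x - d * (y - x)) + d * (y - x) by rewrite subrK.
apply: (le_trans (ler_normD _ _)); rewrite normrM.
move: h; rewrite distrC => h; apply: (le_trans (lerD h (lexx _))).
by have := normr_ge0 (y - x); lra.
Qed.

(** [f] is given on [[-1 - a, 1 + a]], whereas [wn] differentiates it within the
    smaller interval [I11]. *)
Lemma deriv_in_sub (u v u' v' : R) f x : u' < v' -> u <= u' -> v' <= v ->
  `[u', v']%classic x -> derivable_in `[u, v] f x ->
  deriv_in `[u', v'] f x = deriv_in `[u, v] f x.
Proof.
move=> uv' uu' vv' xuv' df; apply: cvg_slope_deriv_in => //.
apply: cvg_slope => e e0.
have [r r0 H] := derivable_in_near df e0; exists r => // y yuv' yx yr.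
have yuv : `[u, v]%classic y.
  by move: yuv'; rewrite /= !in_itv /= => /andP[h1 h2]; rewrite (le_trans uu' h1) (le_trans h2).
have yx0 : 0 < `|y - x| by rewrite normr_gt0 subr_eq0.
rewrite -(ler_pM2r yx0) -normrM mulrBl /slope_at divfK -?normr_gt0//.
by rewrite distrC; exact: H.
Qed.

(** The derivative is Lipschitz because the second one is bounded on the compact
    interval, and the mean value theorem does the rest. *)
Lemma C2_quadratic (u v : R) f : u < v -> C2_on `[u, v] f -> exists2 K, 0 < K &
  forall x y, u < x < v -> u <= y <= v ->
    `|f y - f x - deriv_in `[u, v] f x * (y - x)| <= K * (y - x) ^+ 2.
Proof.
move=> uv [d1 d2 c2].
set A : set R := `[u, v]%classic; set f1 := deriv_in A f; set f2 := deriv_in A f1.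
have [M HM] : exists M, forall x, u <= x <= v -> `|f2 x| <= M.
  have [|c _ cM] := @EVT_max R (fun x => `|f2 x|) u v (ltW uv).
    by move=> x; apply: cvg_norm; exact: c2.
  by exists `|f2 c| => x xuv; apply: cM; rewrite in_itv.
have cf := derivable_in_continuous d1; have cf1 := derivable_in_continuous d2.
have mvt (h h1 : R -> R) p q : (forall x, A x -> derivable_in A h x) ->
    {within A, continuous h} -> u <= p -> p < q -> q <= v ->
    exists2 c, p < c < q & h q - h p = deriv_in A h c * (q - p).
  move=> dh ch up pq qv.
  have [] := @MVT R h (deriv_in A h) p q pq.
  - move=> x; rewrite in_itv /= => /andP[px xq].
    apply: derivable_in_is_derive; first by rewrite (le_lt_trans up px) (lt_le_trans xq qv).
    by apply: dh; rewrite /A /= in_itv /= (le_trans up (ltW px)) (le_trans (ltW xq) qv).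
  - by apply: continuous_subspaceW ch; apply: subset_itvScc; rewrite bnd_simp.
  by move=> c; rewrite in_itv /= => cpq E; exists c.
have f1_lip p q : u <= p <= v -> u <= q <= v -> `|f1 q - f1 p| <= M * `|q - p|.
  wlog pq : p q / p < q => [H pi qi|/andP[up _] /andP[_ qv]].
    have [pq|qp|->] := ltgtP p q; first exact: H.
      by rewrite distrC [`|q - p|]distrC; exact: H.
    by rewrite !subrr normr0 mulr0.
  have [c /andP[pc cq] ->] := mvt f1 f1 p q d2 cf1 up pq qv.
  rewrite normrM ler_wpM2r// HM//.
  by rewrite (le_trans up (ltW pc)) (le_trans (ltW cq) qv).
exists (`|M| + 1); first by rewrite ltr_wpDl.
move=> x y /andP[ux xv] /andP[uy yv].
have [c [cuv cx E]] : exists c, [/\ u <= c <= v, `|c - x| <= `|y - x| & f y - f x = f1 c * (y - x)].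
  have [xy|yx|->] := ltgtP x y; last first.
  - by exists y; rewrite uy yv !subrr mulr0.
  - have [c /andP[yc cx] E] := mvt f f y x d1 cf uy yx (ltW xv).
    exists c; split; first by rewrite (le_trans uy (ltW yc)) (le_trans (ltW cx) (ltW xv)).
      by rewrite !ltr0_norm ?subr_lt0// lerN2 lerD2r ltW.
    by rewrite -opprB E -mulrN opprB.
  - have [c /andP[xc cy] E] := mvt f f x y d1 cf (ltW ux) xy yv.
    exists c; split => //; first by rewrite (le_trans (ltW ux) (ltW xc)) (le_trans (ltW cy) yv).
    by rewrite !gtr0_norm ?subr_gt0// lerD2r ltW.
rewrite E -mulrBl normrM -[(y - x) ^+ 2]real_normK ?num_real// expr2 mulrA ler_wpM2r//.
apply: le_trans (f1_lip x c _ cuv) _; first by rewrite !ltW.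
apply: (@le_trans _ _ (`|M| * `|c - x|)); first by rewrite ler_wpM2r// ler_norm.
by rewrite ler_pM// lerDl.
Qed.

End C2_interval.

(** * Nonlinear effects of small perturbations *)

(** Duhamel's formula expresses [y m - p m] as the linear response [sigma * \sum
    s m j * e j] plus the response to the quadratic errors [q j]. Each
    difference is first shown to be at most twice the size [sigma * b * n^2] of
    the linear response; then the quadratic errors are negligible. *)
Section perturbed_recursion.
Variables (R : realType) (f f1 : R -> R) (p y e : nat -> R) (s : nat -> nat -> R).
Variables (sigma K b : R) (n : nat).
Hypotheses (s0 : 0 <= sigma) (K0 : 0 <= K) (b0 : 0 <= b).
Hypotheses (p_rec : forall m, p m.+1 = f (p m)) (y0 : y 0%N = p 0%N)
  (y_rec : forall m, y m.+1 = f (y m) + sigma * e m.+1).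
Hypotheses (s_diag : forall m, s m m = 1)
  (s_step : forall m j, (j <= m)%N -> s m.+1 j = f1 (p m) * s m j).
Hypotheses (s_le : forall i j, (0 < j <= i)%N -> (i <= n)%N -> `|s i j| <= b)
  (e_le : forall j, (0 < j <= n)%N -> `|e j| <= n%:R)
  (quad : forall m, (m < n)%N ->
    `|f (y m) - f (p m) - f1 (p m) * (y m - p m)| <= K * (y m - p m) ^+ 2).

Let q m := f (y m) - f (p m) - f1 (p m) * (y m - p m).

Let perturbation_formula m : y m - p m =
  sigma * (\sum_(1 <= j < m.+1) s m j * e j) + \sum_(1 <= j < m.+1) s m j * q j.-1.
Proof.
elim: m => [|m IH]; first by rewrite !big_geq// y0 subrr mulr0 addr0.
rewrite !(big_nat_recr m.+1)//= s_diag !mul1r.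
have E (z : nat -> R) : \sum_(1 <= j < m.+1) s m.+1 j * z j = f1 (p m) * \sum_(1 <= j < m.+1) s m j * z j.
  rewrite mulr_sumr; apply: eq_big_nat => j /andP[_ jm].
  by rewrite s_step// mulrA.
rewrite !E y_rec p_rec /q IH; ring.
Qed.

Let sum_le (z : nat -> R) (c : R) m : (m <= n)%N -> (forall j, (0 < j <= m)%N -> `|z j| <= c) -> 0 <= c ->
  `|\sum_(1 <= j < m.+1) s m j * z j| <= n%:R * (b * c).
Proof.
move=> mn zc c0; apply: le_trans (ler_norm_sum _ _ _) _.
apply: (@le_trans _ _ (\sum_(1 <= j < m.+1) b * c)).
  rewrite big_nat_cond [X in _ <= X]big_nat_cond; apply: ler_sum => j; rewrite andbT ltnS => jm.
  by rewrite normrM ler_pM// ?s_le ?zc.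
rewrite sumr_const_nat subn1 /= -[X in X <= _]mulr_natl ler_wpM2r ?mulr_ge0// ler_nat//.
Qed.

Lemma perturbed_recursion : (0 < n)%N -> 4 * K * sigma * (b * n%:R ^+ 2) ^+ 2 <= 1 ->
  `|y n - p n - sigma * \sum_(1 <= j < n.+1) s n j * e j| <= 4 * K * sigma ^+ 2 * (b * n%:R ^+ 2) ^+ 3.
Proof.
move=> n0; set B := b * _ => hB.
have n1 : 1 <= n%:R :> R by rewrite ler1n.
have B0 : 0 <= B by rewrite mulr_ge0// sqr_ge0.
have bnB : n%:R * b <= B.
  by rewrite mulrC /B ler_wpM2l// expr2 ler_peMr// (le_trans ler01).
have rem m : (m <= n)%N -> (forall i, (i < m)%N -> `|y i - p i| <= 2 * sigma * B) ->
    `|\sum_(1 <= j < m.+1) s m j * q j.-1| <= 4 * K * sigma ^+ 2 * B ^+ 3.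
  move=> mn H; have c0 : 0 <= K * (2 * sigma * B) ^+ 2 by rewrite mulr_ge0// sqr_ge0.
  apply: (le_trans (sum_le mn (z := fun j => q j.-1) (c := K * (2 * sigma * B) ^+ 2) _ c0)).
    move=> j /andP[j0 jm]; have jm' : (j.-1 < m)%N by rewrite prednK.
    apply: le_trans (quad (leq_trans jm' mn)) _; apply: ler_wpM2l => //.
    rewrite -[X in X <= _]real_normK ?num_real// lerXn2r ?nnegrE ?H//.
    by rewrite !mulr_ge0.
  rewrite mulrA; apply: le_trans (ler_wpM2r c0 bnB) _.
  by rewrite le_eqVlt; apply/orP; left; apply/eqP; ring.
have small : 4 * K * sigma ^+ 2 * B ^+ 3 <= sigma * B.
  have -> : 4 * K * sigma ^+ 2 * B ^+ 3 = (4 * K * sigma * B ^+ 2) * (sigma * B) by ring.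
  by rewrite ler_piMl// mulr_ge0.
have bound m : (m <= n)%N -> `|y m - p m| <= 2 * sigma * B.
  elim/ltn_ind: m => m IH mn; rewrite perturbation_formula.
  have h1 : `|sigma * (\sum_(1 <= j < m.+1) s m j * e j)| <= sigma * B.
    rewrite normrM ger0_norm// ler_wpM2l//.
    apply: (le_trans (sum_le mn (c := n%:R) _ _)) => //.
      by move=> j /andP[j0 jm]; rewrite e_le// j0 (leq_trans jm).
    by rewrite /B mulrCA -expr2.
  have h2 := rem m mn (fun i im => IH i im (ltnW (leq_trans im mn))).
  apply: (le_trans (ler_normD _ _)); apply: (le_trans (lerD h1 (le_trans h2 small))).
  by rewrite le_eqVlt; apply/orP; left; apply/eqP; ring.
rewrite perturbation_formula addrAC subrr add0r.
by apply: rem => // i i_n; apply: bound; exact: ltnW.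
Qed.

End perturbed_recursion.

(** * Moments of the noise and comparison of distribution functions *)

Section noise_moments.
Context {d : measure_display} {Omega : measurableType d} {R : realType}.
Variable P : probability Omega R.
Notation I f := (P.-integrable setT (EFin \o f)).
Notation E f := (Rintegral P setT f).

Lemma integral_powR (X : {RV P >-> R}) (s C : R) : 0 < s -> 0 < C ->
  ('N[P]_(s%:E) [EFin \o X] <= C%:E)%E ->
  I (fun w => `|X w| `^ s) /\ E (fun w => `|X w| `^ s) <= C `^ s.
Proof.
move=> s0 C0 H.
have h : (\int[P]_w (`|X w| `^ s)%:E <= (C `^ s)%:E)%E.
  have := powR_Lnorm P (EFin \o X) (lt0r_neq0 s0); rewrite /= => <-.
  rewrite -poweR_EFin; apply: gt0_ler_poweR => //; first exact: ltW.
  - by rewrite in_itv /= Lnorm_ge0 leey.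
  - by rewrite in_itv /= lee_fin ltW//= leey.
have Is : I (fun w => `|X w| `^ s).
  apply/integrableP; split.
    apply/measurable_EFinP; apply: (measurableT_comp (f := fun x : R => x `^ s)).
      exact: measurable_powR.
    by apply: measurableT_comp => //; exact: measurable_funPT.
  apply: (@le_lt_trans _ _ (C `^ s)%:E); last exact: ltry.
  apply: le_trans h; rewrite le_eqVlt; apply/orP; left; apply/eqP.
  by apply: eq_integral => w _ /=; rewrite ger0_norm ?powR_ge0.
split => //; rewrite -lee_fin /Rintegral fineK//.
exact: integrable_fin_num.
Qed.

Lemma A3_moments (p r : R) (X : nat -> {RV P >-> R}) : 2 < p -> 0 < r -> r + 2 <= p -> A3 p X ->
  exists c Q : R, [/\ 0 < c, forall i, E (X i) = 0,
   forall i, I (fun w => `|X i w| `^ (r + 2)) /\ E (fun w => `|X i w| `^ (r + 2)) <= Q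
   & forall i, I (fun w => X i w ^+ 2) /\ c <= E (fun w => X i w ^+ 2)].
Proof.
move=> p2 r0 rp [EX [c [C [c0 C0 H]]]].
have p0 : 0 < p by apply: lt_trans p2.
have Mp i := integral_powR p0 C0 (let: And3 _ _ h := H i in h).
have powR_le (x s : R) : 0 <= s <= p -> `|x| `^ s <= 1 + `|x| `^ p.
  move=> /andP[s0 sr]; have [x1|x1] := leP 1 `|x|.
    by rewrite -[X in X <= _]add0r lerD// ler_powR.
  rewrite -[X in X <= _]addr0 lerD ?powR_ge0//.
  have : `|x| `^ s <= 1 `^ s by apply: ge0_ler_powR; rewrite ?nnegrE// ltW.
  by rewrite powR1.
have mom (s : R) i : 0 <= s <= p -> I (fun w => `|X i w| `^ s) /\ E (fun w => `|X i w| `^ s) <= 1 + C `^ p.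
  move=> sp; have [Ip Ep] := Mp i.
  have [I1 E1] := expectD (integrable_cst_prob P 1) Ip.
  have Is : I (fun w => `|X i w| `^ s).
    apply: (integrable_dominated _ I1) => [|w]; last by rewrite ger0_norm ?powR_ge0// powR_le.
    apply: (measurableT_comp (f := fun x : R => x `^ s)); first exact: measurable_powR.
    by apply: measurableT_comp => //; exact: measurable_funPT.
  split => //; apply: (@le_trans _ _ (E (fun w => 1 + `|X i w| `^ p))).
    by apply: le_Rintegral => // w _; exact: powR_le.
  by rewrite E1 Rintegral_cst_prob lerD2l.
exists (c ^+ 2), (1 + C `^ p); split.
- by rewrite exprn_gt0.
- by move=> i; have := EX i; rewrite unlock /Rintegral => ->.
- by move=> i; apply: mom; rewrite rp addr_ge0// ltW.
- move=> i; have E2 : (fun w => `|X i w| `^ 2) = (fun w => X i w ^+ 2).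
    by apply/funext => w; rewrite powR_mulrn// real_normK ?num_real.
  have p2' : 0 <= (2 : R) <= p by apply/andP; split; [exact: ler0n|exact: ltW].
  have [I2 _] := mom 2 i p2'; rewrite E2 in I2; split => //.
  rewrite -lee_fin /Rintegral fineK; last exact: integrable_fin_num.
  have [h _ _] := H i.
  have := powR_Lnorm P (EFin \o X i) (lt0r_neq0 (ltr0n R 2)).
  rewrite [RHS](_ : _ = \int[P]_w (X i w ^+ 2)%:E)%E; last first.
    by apply: eq_integral => w _ /=; congr EFin; exact: (congr1 (fun h => h w) E2).
  move=> <-; rewrite -powR_mulrn ?(ltW c0)// -poweR_EFin.
  apply: gt0_ler_poweR => //.
  - by rewrite in_itv /= lee_fin ltW//= leey.
  - by rewrite in_itv /= Lnorm_ge0 leey.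
Qed.

(** Markov's inequality and a union bound in one step: where some [|X j|]
    exceeds [n], the sum of the [|X j|^(r+2)] exceeds [n^2]. *)
Lemma large_noise (r Q : R) (X : nat -> {RV P >-> R}) (n : nat) : 0 < r ->
  (forall i, I (fun w => `|X i w| `^ (r + 2)) /\ E (fun w => `|X i w| `^ (r + 2)) <= Q) ->
  (0 < n)%N -> fine (P (~` [set w | forall j, (j < n)%N -> `|X j w| <= n%:R])) <= Q / n%:R.
Proof.
move=> r0 H n0; set A := [set w | _].
have nR : 0 < n%:R :> R by rewrite ltr0n.
have n1 : 1 <= n%:R :> R by rewrite ler1n.
have mA : measurable A.
  have -> : A = \bigcap_(j in [set j | (j < n)%N]) [set w | `|X j w| <= n%:R].
    by apply/seteqP; split => w h j; exact: h.
  apply: bigcap_measurableType => j _.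
  have -> : [set w | `|X j w| <= n%:R] = (fun w => `|X j w|) @^-1` `]-oo, n%:R].
    by apply/seteqP; split => w /=; rewrite in_itv.
  rewrite -[X in measurable X]setTI.
  have : measurable_fun setT (fun w => `|X j w|) by apply: measurableT_comp => //; exact: measurable_funPT.
  by apply.
have n20 : 0 < n%:R ^+ 2 :> R by rewrite exprn_gt0.
have [Is Es] := @expect_sum _ _ _ P (fun j w => `|X j w| `^ (r + 2)) (iota 0 n) (fun j _ => (H j).1).
have [I2 E2] := expectZ ((n%:R ^+ 2)^-1) Is.
apply: (@le_trans _ _ (E (fun w => (n%:R ^+ 2)^-1 * \sum_(j <- iota 0 n) `|X j w| `^ (r + 2)))).
  apply: fine_prob_le => //; first exact: measurableC.
  move=> w; rewrite indicE; case: (boolP (_ \in _)) => [|_]; last first.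
    by rewrite mulr_ge0 ?invr_ge0 ?sqr_ge0// sumr_ge0// => j _; exact: powR_ge0.
  rewrite inE /= => /existsNP[j /not_implyP[jn /negP]]; rewrite -ltNge => hj.
  rewrite mulrC ler_pdivlMr// mul1r (big_rem j)/= ?mem_iota//.
  have hh : n%:R ^+ 2 <= `|X j w| `^ (r + 2).
    apply: (@le_trans _ _ (`|X j w| `^ 2)).
      by rewrite powR_mulrn// lerXn2r ?nnegrE// ltW.
    by rewrite ler_powR ?lerDr ?(ltW r0)// (le_trans n1)// ltW.
  apply: (le_trans hh); rewrite lerDl sumr_ge0// => i _; exact: powR_ge0.
rewrite E2 Es mulrC ler_pdivrMr//.
apply: (@le_trans _ _ (\sum_(j <- iota 0 n) Q)).
  by apply: ler_sum => j _; exact: (H j).2.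
rewrite big_const_seq count_predT size_iota iter_addr_0 -[X in X <= _]mulr_natr.
by rewrite expr2 mulrA divfK// gt_eqF.
Qed.

End noise_moments.

Section sandwich.
Context {d : measure_display} {Omega : measurableType d} {R : realType}.
Variable P : probability Omega R.

(** Two variables that are [eps]-close outside an event of small probability have
    close distribution functions, as [Phi] is Lipschitz. *)
Lemma cdf_sandwich (S : Omega -> R) (A B : set Omega) (z eps eta rho : R) :
  measurable_fun setT S -> measurable A -> measurable B -> 0 <= eps ->
  (forall w, B w -> A w -> S w <= z + eps) -> (forall w, B w -> S w <= z - eps -> A w) ->
  (forall y, `|fine (P [set w | S w <= y]) - Phi y| <= eta) -> fine (P (~` B)) <= rho ->
  `|fine (P A) - Phi z| <= eta + eps + rho.
Proof.
move=> mS mA mB e0 AS SA Seta Brho.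
have mSy y : measurable [set w | S w <= y].
  have -> : [set w | S w <= y] = S @^-1` `]-oo, y] by apply/seteqP; split => w /=; rewrite in_itv.
  by rewrite -[X in measurable X]setTI; apply: mS.
have cover (C1 C2 : set Omega) : measurable C1 -> measurable C2 -> C1 `<=` C2 `|` ~` B ->
    fine (P C1) <= fine (P C2) + rho.
  move=> m1 m2 C12; apply: (@le_trans _ _ (fine (P C2) + fine (P (~` B)))); last by rewrite lerD2l.
  rewrite -fineD ?fin_num_measure//; last exact: measurableC.
  rewrite fine_le ?fin_num_measure//.
  - by rewrite fin_numD !fin_num_measure//; exact: measurableC.
  - apply: (@le_trans _ _ (P (C2 `|` ~` B))).
      by apply: le_measure => //; rewrite inE//; apply: measurableU => //; exact: measurableC.
    by apply: measureU2 => //; exact: measurableC.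
have up : fine (P A) <= fine (P [set w | S w <= z + eps]) + rho.
  apply: cover => // w Aw; have [Bw|nB] := pselect (B w); last by right.
  by left; exact: AS.
have lo : fine (P [set w | S w <= z - eps]) <= fine (P A) + rho.
  apply: cover => // w Sw; have [Bw|nB] := pselect (B w); last by right.
  by left; exact: SA.
have /andP[_ p1] := Phi_lip z e0; have /andP[_ p2] := Phi_lip (z - eps) e0.
rewrite subrK in p2.
have := Seta (z + eps); have := Seta (z - eps); rewrite !ler_norml => /andP[h1 h2] /andP[h3 h4].
by apply/andP; split; lra.
Qed.

End sandwich.

(** * Measurability of the noisy orbit *)

Section clamped_orbit.
Variables (R : realType) (a : R) (f : R -> R).
Hypotheses (a0 : 0 < a) (C2f : C2_on `[-1 - a, 1 + a] f)
  (f_range : forall x, -1 - a <= x <= 1 + a -> -1 <= f x <= 1).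

(** [f] is arbitrary outside [[-1 - a, 1 + a]], so that the noisy orbit need not
    be measurable. On the event of small noise it agrees with the orbit of the
    continuous map [f \o clamp]. *)
Definition clamp (x : R) : R := Num.max (-1 - a) (Num.min (1 + a) x).

Lemma clamp_in x : -1 - a <= clamp x <= 1 + a.
Proof.
rewrite /clamp le_max lexx /= ge_max ge_min lexx /= andbT; have := a0; lra.
Qed.

Lemma clamp_id x : -1 - a <= x <= 1 + a -> clamp x = x.
Proof. by move=> /andP[h1 h2]; rewrite /clamp (min_idPr h2) (max_idPr h1). Qed.

Lemma clamp_lip x y : `|clamp x - clamp y| <= `|x - y|.
Proof.
wlog xy : x y / x <= y => [H|].
  by have [/H//|/ltW/H] := leP x y; rewrite distrC [`|y - x|]distrC.
have cxy : clamp x <= clamp y.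
  rewrite /clamp ge_max le_max lexx /= le_max; apply/orP; right.
  by rewrite le_min !ge_min lexx xy orbT.
rewrite !ler0_norm ?subr_le0// !opprB lerBlDr {1}/clamp ge_max; apply/andP; split.
  by rewrite -[X in X <= _]add0r lerD ?subr_ge0//; case/andP: (clamp_in x).
rewrite -lerBlDl /clamp le_max; apply/orP; right.
have [xb|bx] := leP (1 + a) x; last by rewrite lerBlDr [X in _ <= X]addrC subrK ge_min lexx orbT.
by rewrite lerBlDr; apply: (@le_trans _ _ (1 + a)); rewrite ?ge_min ?lexx// lerDl subr_ge0.
Qed.

Lemma measurable_clamped : measurable_fun setT (fun x => f (clamp x)).
Proof.
apply: continuous_measurable_fun => x.
have /subspace_continuousP/(_ (clamp x)) cf := derivable_in_continuous (let: And3 h _ _ := C2f in h).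
have {}cf : f @ within `[-1 - a, 1 + a] (nbhs (clamp x)) --> f (clamp x).
  by apply: cf; rewrite /= in_itv /= clamp_in.
apply/cvgrPdist_lt => e e0; have /cvgrPdist_lt/(_ e e0) := cf.
rewrite /within /= => /nbhs_ballP[r /= r0 H]; apply/nbhs_ballP; exists r => // y xy.
apply: H; last by rewrite /= in_itv /= clamp_in.
by apply: le_lt_trans (clamp_lip _ _) xy.
Qed.

Context {d : measure_display} {Omega : measurableType d}.
Variables (P : probability Omega R) (xi : nat -> {RV P >-> R}).

Lemma measurable_clamped_orbit sigma x m :
  measurable_fun setT (noisy_orbit (fun x => f (clamp x)) sigma xi x m).
Proof.
elim: m => [|m IH] /=; first exact: measurable_cst.
apply: measurable_funD.
  by apply: (measurableT_comp measurable_clamped).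
by apply: measurable_funM; [exact: measurable_cst|exact: measurable_funPT].
Qed.

Lemma clamped_orbit sigma x n w : -1 <= x <= 1 -> 0 <= sigma -> small_noise a sigma xi n w ->
  forall m, (m <= n)%N ->
    noisy_orbit (fun x => f (clamp x)) sigma xi x m w = noisy_orbit f sigma xi x m w /\
    -1 - a <= noisy_orbit f sigma xi x m w <= 1 + a.
Proof.
move=> x1 s0 sn; elim=> [|m IH] mn /=.
  by split => //; have := a0; lra.
have [-> hm] := IH (ltnW mn); rewrite clamp_id//; split => //.
have := f_range hm; have := sn m.+1; rewrite mn /= => /(_ isT).
rewrite -{1}(ger0_norm s0) -normrM ler_norml; lra.
Qed.

Lemma measurable_noise_bound (c : nat -> R) (t : R) n : 
  measurable [set w | forall j, (1 <= j <= n)%N -> t * `|xi j w| <= c j].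
Proof.
have -> : [set w | forall j, (1 <= j <= n)%N -> t * `|xi j w| <= c j] =
    \bigcap_(j in [set j | (1 <= j <= n)%N]) [set w | t * `|xi j w| <= c j].
  by apply/seteqP; split => w h j; exact: h.
apply: bigcap_measurableType => j _.
have -> : [set w | t * `|xi j w| <= c j] = (fun w => t * `|xi j w|) @^-1` `]-oo, c j].
  by apply/seteqP; split => w /=; rewrite in_itv.
rewrite -[X in measurable X]setTI.
have : measurable_fun setT (fun w => t * `|xi j w|).
  apply: measurable_funM; first exact: measurable_cst.
  by apply: measurableT_comp => //; exact: measurable_funPT.
by apply.
Qed.

End clamped_orbit.

(** * Noisy critical orbits *)

(** The event on which the nonlinear effects are controlled. *)
Definition good_noise {d} {Omega : measurableType d} {R : realType}
    {P : probability Omega R} (a sigma : R) (xi : nat -> {RV P >-> R}) (n : nat) : set Omega :=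
  small_noise a sigma xi n `&` [set w | forall j, (1 <= j <= n)%N -> `|xi j w| <= n%:R].

Section noisy_critical_orbits.
Variables (R : realType) (k : nat) (g : R -> R) (G : Cplx R -> Cplx R).
Variables (D : set (Cplx R)) (omega : R) (f : R -> R).
Hypothesis k0 : (0 < k)%N.
Hypothesis fp : doubling_fixed_point k g G D.
Hypothesis omega01 : 0 < omega < 1.
Hypothesis f_Ws : stable_manifold k G D omega f.
Variable a : R.
Hypotheses (a0 : 0 < a) (C2f : C2_on `[-1 - a, 1 + a] f)
  (f_range : forall x, -1 - a <= x <= 1 + a -> -1 <= f x <= 1).

Let orbit_in l m : @I11 R (iter m f (iter l f 0)).
Proof. by rewrite -iterD; apply: (stable_orbit f_Ws); exact: I11_0. Qed.

Let I_inside z : @I11 R z -> -1 - a < z < 1 + a.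
Proof. by rewrite /I11 /= in_itv /= => /andP[h1 h2]; move: (a0) => a1; apply/andP; split; lra. Qed.

Let next_inside z t : -1 - a <= z <= 1 + a -> `|t| <= a -> -1 - a <= f z + t <= 1 + a.
Proof.
by move=> /f_range/andP[h1 h2]; rewrite ler_norml => /andP[h3 h4]; apply/andP; split; lra.
Qed.

(** The sensitivities up to time [n] are at most [C n^B], so the linear response
    is at most [sigma * C * n^(B+2)] and the quadratic one [sigma^2 * C *
    n^(3B+6)]. The exponent depends neither on the orbit nor on the noise. *)
Lemma orbit_linearisation : exists B : nat, forall l, exists2 C : R, 0 < C &
  forall n (sigma : R) (e : nat -> R) (y : nat -> R), (0 < n)%N -> 0 <= sigma ->
    y 0%N = iter l f 0 -> (forall m, y m.+1 = f (y m) + sigma * e m.+1) ->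
    (forall j, (0 < j <= n)%N -> sigma * `|e j| <= a) ->
    (forall j, (0 < j <= n)%N -> `|e j| <= n%:R) ->
    C * (sigma * n%:R ^+ B) <= 1 ->
    `|y n - iter n f (iter l f 0) - sigma * \sum_(1 <= j < n.+1) sens f (iter l f 0) n j * e j|
      <= sigma * (C * (sigma * n%:R ^+ B)).
Proof.
have [al [B [al0 H]]] := sens_growth k0 fp omega01 f_Ws.
have lt_a : -1 - a < 1 + a by have := a0; lra.
have [K K0 HK] := C2_quadratic lt_a C2f.
exists (3 * B + 6)%N => l; have [C C0 HC] := H l.
pose C' := 4 * K * C ^+ 2 + 4 * K * C ^+ 3.
have c2 : 0 < 4 * K * C ^+ 2 by rewrite !mulr_gt0 ?exprn_gt0.
have c3 : 0 < 4 * K * C ^+ 3 by rewrite !mulr_gt0 ?exprn_gt0.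
exists C'; first by rewrite addr_gt0.
move=> n sigma e y n0 s0 y0 yrec sma ebig hC.
have n1 : 1 <= n%:R :> R by rewrite ler1n.
have nR0 : 0 <= n%:R :> R by [].
have yin m : (m <= n)%N -> -1 - a <= y m <= 1 + a.
  elim: m => [_|m IH mn].
    by rewrite y0; have /andP[h1 h2] := I_inside (orbit_in l 0); rewrite !ltW.
  rewrite yrec; apply: next_inside; first exact: (IH (ltnW mn)).
  by rewrite normrM ger0_norm// sma.
have [_ sle] := HC n n0.
have Ix : @I11 R (iter l f 0) by exact: (orbit_in l 0).
have tau0 : 0 <= sigma * n%:R ^+ (3 * B + 6) by rewrite mulr_ge0// exprn_ge0.
have pw m : (m <= 3 * B + 6)%N -> n%:R ^+ m <= n%:R ^+ (3 * B + 6) :> R.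
  by move=> h; apply: ler_weXn2l.
have E2 : (C * n%:R ^+ B * n%:R ^+ 2) ^+ 2 = C ^+ 2 * n%:R ^+ (2 * B + 4).
  by rewrite -mulrA -exprD exprMn -exprM; rewrite mulnDl [(B * _)%N]mulnC.
have E3 : (C * n%:R ^+ B * n%:R ^+ 2) ^+ 3 = C ^+ 3 * n%:R ^+ (3 * B + 6).
  by rewrite -mulrA -exprD exprMn -exprM; rewrite mulnDl [(B * _)%N]mulnC.
have b0 : 0 <= C * n%:R ^+ B by rewrite mulr_ge0 ?exprn_ge0 ?(ltW C0).
have := @perturbed_recursion R f (deriv_in (@I11 R) f) (fun m => iter m f (iter l f 0)) y e
  (fun i j => sens f (iter l f 0) i j) sigma K (C * n%:R ^+ B) n s0 (ltW K0) b0
  (fun=> erefl) y0 yrec (fun m => sens_self f_Ws m Ix)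
  (fun m j jm => sens_step k0 fp omega01 f_Ws Ix jm) sle ebig _ n0 _.
rewrite E2 E3 => /= h; apply: le_trans (h _ _) _.
- move=> m mn; have Im := orbit_in l m.
  have -> : deriv_in (@I11 R) f (iter m f (iter l f 0)) =
      deriv_in `[-1 - a, 1 + a] f (iter m f (iter l f 0)).
    apply: deriv_in_sub => //.
    - by rewrite gerBl ltW.
    - by rewrite lerDl ltW.
    - have [d1 _ _] := C2f; apply: d1.
      by have /andP[h1 h2] := I_inside Im; rewrite /= in_itv /= !ltW.
  apply: HK; last exact/yin/ltnW.
  exact: I_inside.
- apply: le_trans hC.
  have -> : 4 * K * sigma * (C ^+ 2 * n%:R ^+ (2 * B + 4)) =
     4 * K * C ^+ 2 * (sigma * n%:R ^+ (2 * B + 4)) by ring.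
  rewrite ler_pM ?(ltW c2) ?mulr_ge0 ?exprn_ge0//; first by rewrite lerDl ltW.
  by rewrite ler_wpM2l// pw// leq_add// leq_mul2r orbT.
- have -> : 4 * K * sigma ^+ 2 * (C ^+ 3 * n%:R ^+ (3 * B + 6)) =
    sigma * (4 * K * C ^+ 3 * (sigma * n%:R ^+ (3 * B + 6))) by ring.
  by rewrite ler_wpM2l// ler_wpM2r// lerDr ltW.
Qed.

End noisy_critical_orbits.

Lemma le_sum5 (R : realType) (u1 u2 u3 u4 u5 : R) :
  0 <= u1 -> 0 <= u2 -> 0 <= u3 -> 0 <= u4 -> 0 <= u5 -> let s := u1 + u2 + u3 + u4 + u5 in
  [/\ u1 <= s, u2 <= s, u3 <= s, u4 <= s & u5 <= s].
Proof. by move=> h1 h2 h3 h4 h5 s; rewrite /s; split; lra. Qed.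

Lemma dist_le_add (R : realType) (u v e z : R) : `|u - v| <= e -> u <= z -> v <= z + e.
Proof. by rewrite ler_norml => /andP[h1 h2]; lra. Qed.

Lemma dist_le_sub (R : realType) (u v e z : R) : `|u - v| <= e -> v <= z - e -> u <= z.
Proof. by rewrite ler_norml => /andP[h1 h2]; lra. Qed.

Lemma powR_quarter (R : realType) (t u r : R) :
  (t `^ (- u)) `^ (r / 2) = (t `^ (- (u / 4 * r))) ^+ 2.
Proof.
rewrite -(powR_mulrn 2 (powR_ge0 t (- (u / 4 * r)))) -!powRrM; congr (_ `^ _).
by field.
Qed.

Section noisy_critical_orbits.
Variables (R : realType) (k : nat) (g : R -> R) (G : Cplx R -> Cplx R).
Variables (D : set (Cplx R)) (omega : R) (f : R -> R).
Hypothesis k0 : (0 < k)%N.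
Hypothesis fp : doubling_fixed_point k g G D.
Hypothesis omega01 : 0 < omega < 1.
Hypothesis f_Ws : stable_manifold k G D omega f.
Variable a : R.
Hypotheses (a0 : 0 < a) (C2f : C2_on `[-1 - a, 1 + a] f)
  (f_range : forall x, -1 - a <= x <= 1 + a -> -1 <= f x <= 1).

Let orbit_in l m : @I11 R (iter m f (iter l f 0)).
Proof. by rewrite -iterD; apply: (stable_orbit f_Ws); exact: I11_0. Qed.


Lemma good_noise_small {d} {Omega : measurableType d} (P : probability Omega R) sigma
    (xi : nat -> {RV P >-> R}) n : good_noise a sigma xi n `<=` small_noise a sigma xi n.
Proof. by move=> w []. Qed.

Lemma measurable_small_noise {d} {Omega : measurableType d} (P : probability Omega R) sigma
    (xi : nat -> {RV P >-> R}) n : measurable (small_noise a sigma xi n).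
Proof. exact: (measurable_noise_bound xi (fun=> a)). Qed.

Lemma measurable_good_noise {d} {Omega : measurableType d} (P : probability Omega R) sigma
    (xi : nat -> {RV P >-> R}) n : measurable (good_noise a sigma xi n).
Proof.
apply: measurableI; first exact: measurable_small_noise.
have := measurable_noise_bound xi (fun=> n%:R) 1 n.
rewrite (_ : [set w | _] = [set w | forall j, (1 <= j <= n)%N -> `|xi j w| <= n%:R])//.
by apply/seteqP; split => w h j /h; rewrite mul1r.
Qed.

Lemma measurable_wn {d} {Omega : measurableType d} (P : probability Omega R)
    (xi : nat -> {RV P >-> R}) l n sigma z : 0 <= sigma ->
  measurable [set w | wn f xi (iter l f 0) n sigma w * \1_(good_noise a sigma xi n) w <= z] /\
  measurable ([set w | wn f xi (iter l f 0) n sigma w <= z] `&` small_noise a sigma xi n).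
Proof.
move=> s0; set x := iter l f 0.
have x01 : -1 <= x <= 1 by have := orbit_in l 0; rewrite /I11 /= in_itv.
pose T := Num.sqrt (\sum_(1 <= j < n.+1)
  deriv_in (@I11 R) (iter (n - j) f) (iter j f x) ^+ 2 * fine 'E_P[fun w => xi j w ^+ 2]).
pose wc w := (noisy_orbit (fun x => f (clamp a x)) sigma xi x n w - iter n f x) / (sigma * T).
have mwc : measurable_fun setT wc.
  apply: measurable_funM; last exact: measurable_cst.
  by apply: measurable_funB; [exact: measurable_clamped_orbit|exact: measurable_cst].
have wcE w : small_noise a sigma xi n w -> wn f xi x n sigma w = wc w.
  move=> sn; rewrite /wc /wn -/T.
  by have [-> _] := clamped_orbit a0 f_range x01 s0 sn (leqnn n).
have mle (u : Omega -> R) y : measurable_fun setT u -> measurable [set w | u w <= y].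
  move=> mu; have -> : [set w | u w <= y] = u @^-1` `]-oo, y] by apply/seteqP; split => w /=; rewrite in_itv.
  by rewrite -[X in measurable X]setTI; apply: mu.
have mB := @measurable_good_noise _ _ P sigma xi n.
split.
- rewrite (_ : [set w | _] = [set w | wc w * \1_(good_noise a sigma xi n) w <= z]).
    by apply: mle; apply: measurable_funM => //; exact: measurable_indic.
  apply/seteqP; split => w /=; rewrite indicE; case: (boolP (w \in _)); rewrite ?mulr0// inE => - [sn _];
      by rewrite wcE.
- rewrite (_ : _ `&` _ = [set w | wc w <= z] `&` small_noise a sigma xi n).
    by apply: measurableI; [exact: mle|exact: measurable_small_noise].
  by apply/seteqP; split => w [/= h sn]; split => //; move: h; rewrite wcE.
Qed.

(** On [good_noise] the variable [wn] differs from the normalised linear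
    response by [O(sigma n^B)]; the latter is a weighted sum of independent
    variables whose weights satisfy Lyapunov's condition, with a rate, by
    [sens_ratio]. *)
Lemma clt_estimate : exists (al : R) (B : nat), 0 < al /\
  forall (r p : R) l, 0 < r <= 1 -> 2 < p -> r + 2 <= p ->
  forall (d : measure_display) (Omega : measurableType d) (P : probability Omega R)
    (xi : nat -> {RV P >-> R}),
  mutually_independent (fun n => xi n.+1) -> A3 p (fun n => xi n.+1) ->
  exists2 C : R, 0 < C & forall n (sigma : R), (0 < n)%N -> 0 < sigma ->
    C * (sigma * n%:R ^+ B) <= 1 ->
    let bound := C * (n%:R `^ (- (al * r)) + sigma * n%:R ^+ B + n%:R^-1) in
    fine (P (~` good_noise a sigma xi n)) <= bound /\
    forall z,
    `|fine (P [set w | wn f xi (iter l f 0) n sigma w * \1_(good_noise a sigma xi n) w <= z])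
      - Phi z| <= bound /\
    `|fine (P ([set w | wn f xi (iter l f 0) n sigma w <= z] `&` small_noise a sigma xi n))
      - Phi z| <= bound.
Proof.
have [al [al0 Hal]] : exists al, 0 < al /\ forall l, exists2 C : R, 0 < C & forall n (q : R), _ :=
  let: ex_intro2 al h1 h2 := sens_ratio k0 fp omega01 f_Ws in ex_intro _ al (conj h1 h2).
have [B HB] := orbit_linearisation k0 fp omega01 f_Ws a0 C2f f_range.
have [A A0 HA] := berry_esseen R.
exists (al / 4), B.+1; split; first by rewrite divr_gt0.
move=> r p l r01 p2 rp d Omega P xi ind a3.
have [r0 r1] := andP r01.
have [c [Q [c0 EX Hq H2]]] := A3_moments p2 r0 rp a3.
have [C1 C10 H1] := Hal l; have [C2 C20 HC2] := HB l.
set x := iter l f 0 in H1 HC2 *.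
pose X j := xi j.+1.
have Q0 : 0 <= Q.
  have [_ h] := Hq 0%N; apply: le_trans h; apply: Rintegral_ge0 => // w _; exact: powR_ge0.
have Ix : @I11 R x by exact: (orbit_in l 0).
have sc0 : 0 < Num.sqrt c by rewrite sqrtr_gt0.
have EXi j : fine 'E_P[fun w => xi j.+1 w ^+ 2] = Rintegral P setT (fun w => X j w ^+ 2).
  by rewrite unlock.
pose M0 := (c^-1) `^ ((r + 2) / 2).
have M00 : 0 <= M0 by exact: powR_ge0.
pose KB := (1 + 16 * (A + 1) * (1 + Q) ^+ 2) * Num.sqrt (M0 * C1 `^ (r / 2)).
have KB0 : 0 <= KB.
  rewrite mulr_ge0 ?sqrtr_ge0// addr_ge0// mulr_ge0 ?sqr_ge0// mulr_ge0//.
  by rewrite addr_ge0// ltW.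
pose C := KB + C2 + C2 / Num.sqrt c + Q + a^-1.
have ai0 : 0 < a^-1 by rewrite invr_gt0.
have C2c0 : 0 < C2 / Num.sqrt c by rewrite divr_gt0.
have [lC1 lC2 lC3 lC4 lC5] : [/\ KB <= C, C2 <= C, C2 / Num.sqrt c <= C, Q <= C & a^-1 <= C].
  exact: le_sum5 KB0 (ltW C20) (ltW C2c0) Q0 (ltW ai0).
have C0 : 0 < C by exact: lt_le_trans lC2.
exists C => // n sigma n0 s0 hC bound.
have n1 : 1 <= n%:R :> R by rewrite ler1n.
have nR0 : 0 < n%:R :> R by rewrite ltr0n.
set tau := sigma * n%:R ^+ B.+1 in hC bound *.
have tau0 : 0 <= tau by rewrite mulr_ge0 ?exprn_ge0// ltW.
have nB1 : n%:R ^+ B <= n%:R ^+ B.+1 :> R by exact: ler_weXn2l.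
have nB2 : n%:R <= n%:R ^+ B.+1 :> R by rewrite exprS ler_peMr// exprn_ege1.
pose SS := \sum_(1 <= j < n.+1) sens f x n j ^+ 2.
pose V := \sum_(1 <= j < n.+1) sens f x n j ^+ 2 * fine 'E_P[fun w => xi j w ^+ 2].
have SS1 : 1 <= SS by exact: (sens_sum_gt0 f_Ws).
have SSV : c * SS <= V.
  rewrite /V /SS mulr_sumr big_add1 [X in _ <= X]big_add1 /=; apply: ler_sum => j _.
  by rewrite mulrC ler_wpM2l ?sqr_ge0// EXi; have [] := H2 j.
have cV : c <= V by apply: le_trans SSV; rewrite ler_peMr// ltW.
have V0 : 0 < V by exact: lt_le_trans cV.
pose T := Num.sqrt V.
have T0 : 0 < T by rewrite sqrtr_gt0.
have TV : T ^+ 2 = V by rewrite sqr_sqrtr// ltW.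
have cT : Num.sqrt c <= T by rewrite ler_sqrt// ltW.
pose cc j := sens f x n j.+1 / T.
have iotaE (F : nat -> R) : \sum_(1 <= j < n.+1) F j = \sum_(j <- iota 0 n) F j.+1.
  by rewrite big_add1 /index_iota subn0.
have var1 : \sum_(j <- iota 0 n) cc j ^+ 2 * Rintegral P setT (fun w => X j w ^+ 2) = 1.
  have -> : 1 = V / T ^+ 2 by rewrite TV mulfV// gt_eqF.
  rewrite /V iotaE mulr_suml; apply: eq_bigr => j _.
  by rewrite EXi /cc expr_div_n; ring.
have sqrtL : Num.sqrt (\sum_(j <- iota 0 n) `|cc j| `^ (r + 2)) <=
    Num.sqrt (M0 * C1 `^ (r / 2)) * n%:R `^ (- (al / 4 * r)).
  have q2 : 2 <= r + 2 by rewrite lerDr ltW.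
  have -> : n%:R `^ (- (al / 4 * r)) = Num.sqrt ((n%:R `^ (- al)) `^ (r / 2)) :> R.
    by rewrite powR_quarter sqrtr_sqr ger0_norm ?powR_ge0.
  rewrite -sqrtrM ?mulr_ge0 ?powR_ge0//; apply: ler_wsqrtr.
  have -> : \sum_(j <- iota 0 n) `|cc j| `^ (r + 2) =
      (\sum_(1 <= j < n.+1) `|sens f x n j| `^ (r + 2)) * (T^-1) `^ (r + 2).
    rewrite iotaE mulr_suml; apply: eq_bigr => j _.
    by rewrite /cc normrM powRM// [`|T^-1|]ger0_norm ?invr_ge0 ?ltW.
  have h := H1 n (r + 2) n0 q2; rewrite addrK in h.
  apply: le_trans (ler_wpM2r (powR_ge0 _ _) h) _.
  rewrite -[M0 * _ * _]mulrA -powRM ?powR_ge0 ?(ltW C10)// [X in _ <= X]mulrC -mulrA.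
  rewrite ler_wpM2l ?powR_ge0//.
  have -> : (T^-1) `^ (r + 2) = (V^-1) `^ ((r + 2) / 2).
    rewrite -TV -exprVn -powR_mulrn ?invr_ge0 ?(ltW T0)// -powRrM.
    by congr (_ `^ _); field.
  rewrite /M0 -powRM ?invr_ge0 ?(ltW V0)//; last by rewrite (le_trans _ SS1).
  apply: ge0_ler_powR.
  - by rewrite divr_ge0// (le_trans _ q2).
  - by rewrite nnegrE divr_ge0 ?(ltW V0)// (le_trans _ SS1).
  - by rewrite nnegrE invr_ge0 ltW.
  - by rewrite ler_pdivrMr// mulrC ler_pdivlMr// mulrC.
pose S w := \sum_(j <- iota 0 n) cc j * X j w.
have eta y : `|fine (P [set w | S w <= y]) - Phi y| <= C * n%:R `^ (- (al / 4 * r)).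
  have := HA d Omega P X cc r Q ind r01 EX (fun i => (Hq i).1) (fun i => (Hq i).2) (iota 0 n) (iota_uniq _ _) var1 y.
  move/le_trans; apply.
  apply: (@le_trans _ _ (KB * n%:R `^ (- (al / 4 * r)))); last by rewrite ler_wpM2r ?powR_ge0.
  rewrite /KB -[X in _ <= X]mulrA ler_wpM2l// addr_ge0// mulr_ge0 ?sqr_ge0// mulr_ge0//.
  by rewrite addr_ge0// ltW.
set Bn := good_noise a sigma xi n.
have mBn : measurable Bn by exact: measurable_good_noise.
have PBn : fine (P (~` Bn)) <= C * n%:R^-1.
  have -> : Bn = [set w | forall j, (j < n)%N -> `|X j w| <= n%:R].
    apply/seteqP; split => w.
      by move=> [_ h] j jn; apply: h.
    move=> h; have hb j : (1 <= j <= n)%N -> `|xi j w| <= n%:R by case: j => // j; exact: h.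
    split => // j jn; apply: (@le_trans _ _ (sigma * n%:R)).
      by rewrite ler_wpM2l ?hb// ltW.
    have : a^-1 * (sigma * n%:R) <= 1.
      apply: le_trans hC; rewrite ler_pM ?(ltW ai0) ?mulr_ge0 ?(ltW s0)//.
      by rewrite ler_wpM2l// ltW.
    by rewrite mulrC ler_pdivrMr// mul1r.
  apply: le_trans (large_noise r0 Hq n0) _.
  by rewrite ler_wpM2r// invr_ge0 ltW.
have close w : Bn w -> `|wn f xi x n sigma w - S w| <= C * tau.
  move=> [sn bn].
  have h : `|noisy_orbit f sigma xi x n w - iter n f x - sigma * \sum_(1 <= j < n.+1) sens f x n j * xi j w|
      <= sigma * (C2 * (sigma * n%:R ^+ B)).
    apply: (HC2 n sigma (fun j => xi j w) (fun m => noisy_orbit f sigma xi x m w)) => //.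
      exact: ltW.
    apply: le_trans hC; rewrite ler_pM ?mulr_ge0 ?exprn_ge0 ?(ltW C20) ?(ltW s0)//.
    by rewrite ler_wpM2l// ltW.
  have -> : wn f xi x n sigma w - S w = (noisy_orbit f sigma xi x n w - iter n f x -
     sigma * \sum_(1 <= j < n.+1) sens f x n j * xi j w) / (sigma * T).
    have -> : S w = (\sum_(1 <= j < n.+1) sens f x n j * xi j w) / T.
      by rewrite /S iotaE mulr_suml; apply: eq_bigr => j _; rewrite /cc /X mulrAC.
    rewrite /wn -/V -/T; field; by rewrite !gt_eqF.
  rewrite normrM normfV (gtr0_norm (mulr_gt0 s0 T0)) ler_pdivrMr ?mulr_gt0//.
  apply: le_trans h _; rewrite [X in _ <= X]mulrCA ler_wpM2l ?(ltW s0)//.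
  apply: (@le_trans _ _ (C2 * tau)).
    by rewrite ler_wpM2l ?(ltW C20)// ler_wpM2l// ltW.
  rewrite mulrAC ler_wpM2r//.
  apply: (@le_trans _ _ (C2 / Num.sqrt c * T)).
    by rewrite mulrAC -mulrA ler_peMr ?(ltW C20)// ler_pdivlMr// mul1r.
  by rewrite ler_wpM2r// ltW.
have Ct0 : 0 <= C * tau by rewrite mulr_ge0// ltW.
have boundE : bound = C * n%:R `^ (- (al / 4 * r)) + C * tau + C * n%:R^-1.
  by rewrite /bound -/tau !mulrDr.
have b1 : 0 <= C * n%:R `^ (- (al / 4 * r)) by rewrite mulr_ge0 ?powR_ge0// ltW.
split; first by apply: (le_trans PBn); rewrite boundE lerDr addr_ge0.
have mS : measurable_fun setT S.
  have -> : S = wsum X cc (iota 0 n) by apply/funext => w; rewrite wsumE.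
  exact: measurable_funPT.
move=> z; rewrite boundE; split; apply: (cdf_sandwich mS _ mBn Ct0 _ _ eta PBn).
- by have [] := measurable_wn xi l n z (ltW s0).
- move=> w Bw /=; rewrite indicE mem_set// mulr1 => h.
  exact: dist_le_add (close w Bw) h.
- move=> w Bw /= h; rewrite indicE mem_set// mulr1.
  exact: dist_le_sub (close w Bw) h.
- by have [] := measurable_wn xi l n z (ltW s0).
- move=> w Bw [/= h _].
  exact: dist_le_add (close w Bw) h.
- move=> w Bw /= h; split; last exact: good_noise_small Bw.
  exact: dist_le_sub (close w Bw) h.
Qed.

End noisy_critical_orbits.

(** * The theorem *)

Lemma cvg_of_bound (R : realType) (u v : nat -> R) (l : R) :
  (\forall n \near \oo, `|u n - l| <= v n) -> v @ \oo --> (0 : R) -> u @ \oo --> l.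
Proof.
move=> uv v0; apply/cvgrPdist_le => e e0; have /cvgrPdist_le/(_ e e0) := v0.
apply: filterS2 uv => n; rewrite sub0r normrN distrC => uvn; apply: le_trans.
exact: le_trans uvn (ler_norm _).
Qed.

Lemma cvg_powRN (R : realType) (s : R) : 0 < s -> (n%:R : R) `^ (- s) @[n --> \oo] --> 0.
Proof. by move=> s0; rewrite -cvg_shiftS; exact: powR_small. Qed.

Lemma fine_prob01 {d} {Omega : measurableType d} {R : realType} (P : probability Omega R)
  (A : set Omega) : measurable A -> 0 <= fine (P A) <= 1.
Proof. by move=> mA; rewrite fine_ge0//= -lee_fin fineK ?probability_le1// fin_num_measure. Qed.

Lemma dist_le1 (R : realType) (u v : R) : 0 <= u <= 1 -> 0 <= v <= 1 -> `|u - v| <= 1.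
Proof. by move=> /andP[? ?] /andP[? ?]; rewrite ler_norml; apply/andP; split; lra. Qed.

Lemma fine_probC {d} {Omega : measurableType d} {R : realType} (P : probability Omega R)
  (A : set Omega) : measurable A -> fine (P A) = 1 - fine (P (~` A)).
Proof.
move=> mA; rewrite probability_setC// fineB ?fin_num_measure//=.
by rewrite opprB addrCA subrr addr0.
Qed.

Theorem theorem2p3 (R : realType) (k : nat) (g : R -> R)
    (G : Cplx R -> Cplx R) (D : set (Cplx R)) (omega : R) (f : R -> R)
    (k_gt0 : (0 < k)%N) (g_fp : doubling_fixed_point k g G D)
    (omega01 : 0 < omega < 1) (f_Ws : stable_manifold k G D omega f) :
  (forall (l : nat) (p : R), 2 < p ->
     Lam p f (iter l f 0) n / Lam 2 f (iter l f 0) n `^ (p / 2)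
       @[n --> \oo] --> (0 : R)) /\
  (forall a : R, 0 < a ->
     C2_on `[-1 - a, 1 + a] f ->
     (forall x, -1 - a <= x <= 1 + a -> -1 <= f x <= 1) ->
     (exists gamma : R, 0 < gamma /\
        forall (p : R) (d : measure_display) (Omega : measurableType d)
          (P : probability Omega R) (xi : nat -> {RV P >-> R}),
        2 < p ->
        mutually_independent (fun n => xi n.+1) ->
        A3 p (fun n => xi n.+1) ->
        forall sigma : nat -> R,
        (forall n, (0 < n)%N -> 0 < sigma n) ->
        sigma n * n%:R `^ (gamma + 1) @[n --> \oo] --> (0 : R) ->
        forall l : nat, exists B : nat -> set Omega,
        [/\ forall n, measurable (B n),
            forall n, B n `<=` small_noise a (sigma n) xi n,
            fine (P (B n)) @[n --> \oo] --> (1 : R),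
            cvg_in_distribution
              (fun n z => fine (P [set w |
                 wn f xi (iter l f 0) n (sigma n) w * \1_(B n) w <= z]))
              (@Phi R)
          & cvg_in_distribution
              (fun n z => cond_prob P
                 [set w | wn f xi (iter l f 0) n (sigma n) w <= z]
                 (small_noise a (sigma n) xi n))
              (@Phi R) ]) /\
     (forall p : R, 2 < p -> exists alpha theta : R,
        [/\ 0 < alpha, 0 < theta &
        forall (d : measure_display) (Omega : measurableType d)
          (P : probability Omega R) (xi : nat -> {RV P >-> R}),
        mutually_independent (fun n => xi n.+1) ->
        A3 p (fun n => xi n.+1) ->
        forall sigma : nat -> R,
        (forall n, (0 < n)%N -> 0 < sigma n <= n%:R `^ (- theta)) ->
        forall l : nat, exists (B : nat -> set Omega) (Cx : R),
        [/\ forall n, measurable (B n),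
            forall n, B n `<=` small_noise a (sigma n) xi n,
            fine (P (B n)) @[n --> \oo] --> (1 : R)
          & forall n, (0 < n)%N ->
            (ereal_sup [set (`|fine (P [set w |
                 wn f xi (iter l f 0) n (sigma n) w * \1_(B n) w <= z])
               - Phi z|)%:E | z in [set: R]]
             <= (Cx * n%:R `^ (- alpha))%:E)%E ] ])).
Proof.
split; first by move=> l p p2; exact: (Lam_ratio_cvg k_gt0 g_fp omega01 f_Ws).
move=> a a0 C2f f_range.
have [al [B [al0 H]]] := clt_estimate k_gt0 g_fp omega01 f_Ws a0 C2f f_range.
(* the expansion in [stein_summand] profits from moments up to the third one
   only *)
have exponent p : 2 < p -> exists r : R, 0 < r <= 1 /\ r + 2 <= p.
  move=> p2; exists (Num.min 1 (p - 2)); rewrite lt_min ltr01 subr_gt0 p2 ge_min lexx /=.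
  by split => //; rewrite -lerBrDr ge_min lexx orbT.
split.
  exists B.+1%:R; split; first by rewrite ltr0n.
  move=> p d Omega P xi p2 ind a3 sigma s0 scvg l.
  have [r [r01 rp]] := exponent p p2.
  have [C C0 HC] := H r p l r01 p2 rp d Omega P xi ind a3.
  pose tau n := sigma n * n%:R ^+ B.
  pose bd n := C * (n%:R `^ (- (al * r)) + tau n + n%:R^-1).
  have tau_cvg : tau @ \oo --> (0 : R).
    apply: (@cvg_of_bound _ _ (fun n => `|sigma n * n%:R `^ (B.+1%:R + 1)|)).
      near=> n; have n0 : (0 < n)%N by near: n; exists 1%N.
      have n1 : 1 <= n%:R :> R by rewrite ler1n.
      rewrite subr0 /tau !normrM ler_wpM2l//.
      rewrite natr1 powR_mulrn// !ger0_norm ?exprn_ge0//.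
      by apply: ler_weXn2l => //; rewrite (leq_trans (leqnSn _)).
    by rewrite -[X in _ --> X](normr0 R); apply: cvg_norm.
  have bd_cvg : bd @ \oo --> (0 : R).
    rewrite -[X in _ --> X](mulr0 C); apply: cvgM; first exact: cvg_cst.
    rewrite -[X in _ --> X](addr0 0) -{1}[X in _ --> X + _](addr0 0).
    apply: cvgD; [apply: cvgD => //|].
      by apply: cvg_powRN; rewrite mulr_gt0//; case/andP: r01.
    have -> : (fun n => n%:R^-1) = (fun n => n%:R `^ (- 1)) :> (nat -> R).
      by apply/funext => n; rewrite powR_inv1.
    exact: cvg_powRN.
  have ok : \forall n \near \oo, [/\ (0 < n)%N, 0 < sigma n & C * tau n <= 1].
    have /cvgrPdist_le/(_ 1 ltr01) : (fun n => C * tau n) @ \oo --> (0 : R).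
      by rewrite -[X in _ --> X](mulr0 C); apply: cvgM => //; exact: cvg_cst.
    move=> h; near=> n; have n0 : (0 < n)%N by near: n; exists 1%N.
    split => //; first exact: s0.
    have : `|0 - C * tau n| <= 1 by near: n.
    by rewrite sub0r normrN; apply: le_trans; exact: ler_norm.
  pose Bn n := good_noise a (sigma n) xi n.
  have mB n : measurable (Bn n) by exact: measurable_good_noise.
  have mS n : measurable (small_noise a (sigma n) xi n) by exact: measurable_small_noise.
  have PB : fine (P (Bn n)) @[n --> \oo] --> (1 : R).
    apply: cvg_of_bound bd_cvg; apply: filterS ok => n [n0 sn hn].
    have [h _] := HC n (sigma n) n0 sn hn.
    rewrite fine_probC// addrAC subrr add0r normrN ger0_norm//.
    by case/andP: (fine_prob01 P (measurableC (mB n))).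
  have PS : fine (P (small_noise a (sigma n) xi n)) @[n --> \oo] --> (1 : R).
    apply: (@squeeze_cvgr _ _ _ _ (fun n => fine (P (Bn n))) (fun=> 1)) => //; last exact: cvg_cst.
    near=> n; case/andP: (fine_prob01 P (mS n)) => _ ->; rewrite andbT.
    rewrite fine_le ?fin_num_measure//; apply: le_measure; rewrite ?inE//.
    exact: good_noise_small.
  exists Bn; split => //.
  - by move=> n; exact: good_noise_small.
  - move=> z _; apply: cvg_of_bound bd_cvg; apply: filterS ok => n [n0 sn hn].
    by have [_ /(_ z)[h _]] := HC n (sigma n) n0 sn hn.
  - move=> z _; rewrite /cond_prob -[Phi z]divr1; apply: cvgM; last by apply: cvgV => //; rewrite oner_eq0.
    apply: cvg_of_bound bd_cvg; apply: filterS ok => n [n0 sn hn].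
    by have [_ /(_ z)[_ h]] := HC n (sigma n) n0 sn hn.
move=> p p2; have [r [r01 rp]] := exponent p p2.
have ar0 : 0 < al * r by rewrite mulr_gt0//; case/andP: r01.
exists (Num.min (al * r) 1), B.+1%:R; split; [by rewrite lt_min ar0 ltr01|by rewrite ltr0n|].
set alpha := Num.min _ _.
move=> d Omega P xi ind a3 sigma s0 l.
have [C C0 HC] := H r p l r01 p2 rp d Omega P xi ind a3.
pose Bn n := good_noise a (sigma n) xi n.
have mB n : measurable (Bn n) by exact: measurable_good_noise.
have tau_le n : (0 < n)%N -> sigma n * n%:R ^+ B <= n%:R^-1.
  move=> n0; have nR0 : 0 < n%:R :> R by rewrite ltr0n.
  have /andP[_ h] := s0 n n0.
  apply: le_trans (ler_wpM2r (exprn_ge0 _ (ltW nR0)) h) _.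
  rewrite powRN powR_mulrn ?(ltW nR0)// exprS invfM -mulrA mulVf ?mulr1//.
  by rewrite expf_neq0// gt_eqF.
have pw n : (0 < n)%N -> n%:R `^ (- (al * r)) <= n%:R `^ (- alpha) /\ n%:R^-1 <= n%:R `^ (- alpha) :> R.
  move=> n0; have n1 : 1 <= n%:R :> R by rewrite ler1n.
  split; first by rewrite ler_powR// lerN2 ge_min lexx.
  by rewrite -powR_inv1// ler_powR// lerN2 ge_min lexx orbT.
have key n : (0 < n)%N -> fine (P (~` Bn n)) <= 3 * C * n%:R `^ (- alpha) /\ forall z,
    `|fine (P [set w | wn f xi (iter l f 0) n (sigma n) w * \1_(Bn n) w <= z]) - Phi z|
      <= 3 * C * n%:R `^ (- alpha).
  move=> n0; have [h1 h2] := pw n n0; have h3 := tau_le n n0.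
  have /andP[sn _] := s0 n n0.
  have [hC|hC] := leP (C * (sigma n * n%:R ^+ B)) 1.
    have [g1 g2] := HC n (sigma n) n0 sn hC.
    have bd : C * (n%:R `^ (- (al * r)) + sigma n * n%:R ^+ B + n%:R^-1) <= 3 * C * n%:R `^ (- alpha).
      have -> : 3 * C * n%:R `^ (- alpha) =
          C * (n%:R `^ (- alpha) + n%:R `^ (- alpha) + n%:R `^ (- alpha)) by ring.
      by rewrite ler_wpM2l ?(ltW C0)// !lerD// (le_trans h3).
    split; first exact: le_trans g1 bd.
    by move=> z; have [g3 _] := g2 z; exact: le_trans g3 bd.
  have one : 1 <= 3 * C * n%:R `^ (- alpha).
    apply: le_trans (ltW hC) _.
    have -> : 3 * C * n%:R `^ (- alpha) = C * (3 * n%:R `^ (- alpha)) by ring.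
    rewrite ler_wpM2l ?(ltW C0)//; apply: le_trans h3 (le_trans h2 _); rewrite ler_peMl ?powR_ge0// ler1n//.
  split; first by apply: le_trans one; case/andP: (fine_prob01 P (measurableC (mB n))).
  move=> z; apply: le_trans one.
  have [m1 _] := measurable_wn f_Ws a0 C2f f_range xi l n z (ltW sn).
  exact: dist_le1 (fine_prob01 P m1) (Phi01 z).
exists Bn, (3 * C); split => //.
- by move=> n; exact: good_noise_small.
- apply: (@cvg_of_bound _ _ (fun n => 3 * C * n%:R `^ (- alpha))).
    near=> n; have n0 : (0 < n)%N by near: n; exists 1%N.
    have [h _] := key n n0.
    rewrite fine_probC// addrAC subrr add0r normrN ger0_norm//.
    by case/andP: (fine_prob01 P (measurableC (mB n))).
  rewrite -[X in _ --> X](mulr0 (3 * C)); apply: cvgM; first exact: cvg_cst.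
  by apply: cvg_powRN; rewrite lt_min ar0 ltr01.
- move=> n n0; apply: ge_ereal_sup => _ [z _ <-]; rewrite lee_fin.
  by have [_] := key n n0; apply.
Unshelve. all: by end_near. Qed.
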